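(* Let $(i,j)$ be a pair of integers with $-3\le i\le 3$, $0\le j\le 3$ and $(i,j)\notin\{(1,3),(2,3),(3,1),(3,2),(3,3)\}$, and let $b,d\in\mathbf{C}$ be parameters for which all expressions below are defined (see the conventions in the context). For each integer $n\ge 0$ put $$A_{i,j}^{(n)}:=A_{i,j}(2d-1-i,\,-n,\,b),\qquad B_{i,j}^{(n)}:=B_{i,j}(2d-1-i,\,-n,\,b),$$ where $A_{i,j}(\alpha,\beta,\gamma)$ and $B_{i,j}(\alpha,\beta,\gamma)$ are the polynomials listed in the context. Then for all $x$ in the domain $\mathcal{D}=\{x\in\mathbf{C} : |x|<1,\ |x/(1+\sqrt{1-x})^2|<1\}$, $$\left(\frac12+\frac12\sqrt{1-x}\right)^{1-2d}\,{}_3F_2\left[\begin{array}{c} b,\ d-\frac12,\ 2d-1-i\\ d+\frac12,\ 2d-b+j\end{array};\ -\frac{x}{(1+\sqrt{1-x})^2}\right]$$ $$=\frac{2^{i}(-1)^{\frac12(i+|i|)}\,\Gamma(d)\,\Gamma(d+\frac12)\,\Gamma\big(b-\frac12(i+j+|i+j|)\big)}{\Gamma(b)\,\Gamma(d-b+\frac12 j)\,\Gamma(d-b+\frac12 j+\frac12)}\ \sum_{n=0}^{\infty}\frac{n!}{\big(n+\frac12 i+\frac12|i|\big)!}\,\frac{(d)_n\,(d-\frac12)_n}{(2d-b+j)_n}\,\frac{x^n}{n!}$$ $$\times\Bigg\{A_{i,j}^{(n)}\,\frac{\Gamma\big(d-b-\frac i2+[\frac{i+j+1}{2}]\big)\,\Gamma\big(d-b+\frac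 i2+\frac12+[\frac{j+1}{2}]\big)}{\Gamma\big(d-\frac i2\big)\,\Gamma\big(d+\frac12-\frac i2+[\frac i2]\big)}\ \frac{\big(d-b+\frac i2+\frac12+[\frac{j+1}{2}]\big)_n}{\big(d+\frac12-\frac i2+[\frac i2]\big)_n}$$ $$\qquad+B_{i,j}^{(n)}\,\frac{\Gamma\big(d-b+\frac12-\frac i2+[\frac{i+j}{2}]\big)\,\Gamma\big(d-b+\frac i2+1+[\frac j2]\big)}{\Gamma\big(d-\frac i2-\frac12\big)\,\Gamma\big(d-\frac i2+[\frac{i+1}{2}]\big)}\ \frac{\big(d-b+\frac i2+1+[\frac j2]\big)_n}{\big(d-\frac i2+[\frac{i+1}{2}]\big)_n}\Bigg\}.$$
   Context: Notation. $(\alpha)_n=\alpha(\alpha+1)\cdots(\alpha+n-1)$ for $n\ge1$, $(\alpha)_0=1$ (Pochhammer symbol). The generalized hypergeometric series is $${}_3F_2\left[\begin{array}{c}\alpha_1,\alpha_2,\alpha_3\\ \beta_1,\beta_2\end{array};z\right]=\sum_{n=0}^\infty\frac{(\alpha_1)_n(\alpha_2)_n(\alpha_3)_n}{(\beta_1)_n(\beta_2)_n}\frac{z^n}{n!},$$ convergent for $|z|<1$. $[y]$ denotes the greatest integer $\le y$ (for real $y$), $|y|$ the absolute value. $\sqrt{1-x}$ and the power with exponent $1-2d$ are taken with their principal branches. Convention on parameters: $b,d$ are such that no Pochhammer symbol in a denominator vanishes (on either side) and no Gamma function in a numerator is evaluated at a pole; $1/\Gamma$ is read as $0$ at poles of $\Gamma$.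 Polynomials $A_{i,j}(\alpha,\beta,\gamma)$: - $A_{3,0}=5\alpha-\beta^2+(\alpha+1)^2-(2\alpha-\beta+1)(\beta+\gamma)$. - $A_{2,0}=\frac12(\alpha-1)(\alpha-4)-(\beta^2-5\alpha+1)-(\alpha-\beta+1)(\beta+\gamma)$. - $A_{2,1}=(\beta-1)(\beta-2)-(\alpha-\beta+1)(\alpha-\beta-\gamma+3)$. - $A_{2,2}=\frac12(\alpha-\gamma+2)(\alpha-2\beta-\gamma+5)\{(\alpha-\gamma+2)(\alpha-2\beta+2)-\alpha(\gamma-3)\}-(\beta-1)(\beta-2)(\gamma-2)(\gamma-3)$. - $A_{1,0}=1$; $A_{1,1}=\gamma-\alpha-1$; $A_{1,2}=\alpha(\alpha-1)+(\beta+\gamma-3)(\gamma-2\alpha-1)$. - $A_{0,0}=1$; $A_{0,1}=-1$; $A_{0,2}=\frac12\{(\alpha-\beta-\gamma+1)^2+(\gamma-1)(\gamma-3)-\beta^2+\alpha\}$; $A_{0,3}=\gamma(\alpha-\beta-\gamma+4)-(\alpha+1)(\alpha+2)-(\alpha-1)(\beta-1)+3\alpha\beta$. - $A_{-1,0}=1$; $A_{-1,1}=1$; $A_{-1,2}=\beta+\gamma-1$; $A_{-1,3}=(\gamma-1)(\gamma-2)-\beta(\alpha-\gamma+1)$. - $A_{-2,0}=\frac12(\alpha-1)(\alpha-2\beta-2)-\gamma(\alpha-\beta-1)$; $A_{-2,1}=\alpha-\beta-1$; $A_{-2,2}=\frac12(\alpha-1)(\alpha-2\beta-2\gamma)+\beta(\beta+\gamma)$;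 $A_{-2,3}=(\alpha-\beta-1)(\gamma-1)-\beta(\beta+1)$. - $A_{-3,0}=(\alpha-1)(\alpha-2\beta-2\gamma-4)+\beta\gamma$; $A_{-3,1}=(\alpha-\beta-2)(\alpha-\gamma-1)-\alpha\gamma$; $A_{-3,2}=(\alpha-\beta-1)(\alpha-\beta-2\gamma-2)-\beta\gamma$; $A_{-3,3}=\beta(\beta+1)+(\alpha-1)(\alpha-\beta)-\gamma(2\alpha-\beta-2)$. Polynomials $B_{i,j}(\alpha,\beta,\gamma)$: - $B_{3,0}=-\alpha+3\beta^2-(\alpha+3)^2+(2\alpha-3\beta+5)(\beta+\gamma)$. - $B_{2,0}=-2$; $B_{2,1}=(\alpha-\beta-2\gamma+5)(\alpha-\beta-\gamma+3)-(\beta-1)(\beta-2)$; $B_{2,2}=-2(\alpha-\gamma+2)(\alpha-2\beta-\gamma+5)$. - $B_{1,0}=-1$; $B_{1,1}=\alpha-2\beta-\gamma+3$; $B_{1,2}=(\beta-1)(\beta-\gamma+1)-(\alpha-\beta-\gamma+2)(\alpha-\beta-\gamma+3)$. - $B_{0,0}=0$; $B_{0,1}=1$; $B_{0,2}=-2$; $B_{0,3}=(\alpha+2)(\alpha+4)-\beta(2\alpha+5)-3\gamma(\alpha-\beta-\gamma+4)+3$. - $B_{-1,0}=1$; $B_{-1,1}=1$; $B_{-1,2}=-(\beta-\gamma+1)$; $B_{-1,3}=(\gamma-1)(\gamma-2)+\beta(\alpha-2\beta-\gamma+1)$. - $B_{-2,0}=2$; $B_{-2,1}=\alpha-\beta-2\gamma-1$;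 $B_{-2,2}=2$; $B_{-2,3}=\beta(\alpha-2\gamma+2)-(\beta-\gamma+1)(\alpha-\beta-2\gamma+1)$. - $B_{-3,0}=(\alpha-2)(\alpha-2\beta-2\gamma-3)+3\beta\gamma$; $B_{-3,1}=(\alpha-\beta-2)(\alpha-2\beta-2\gamma-3)+\beta\gamma$; $B_{-3,2}=(\alpha-\beta-2)(\alpha-\beta-2\gamma-1)+\beta\gamma$; $B_{-3,3}=(\alpha-1)(\alpha-2)-3\beta(\alpha-\beta-2)-\gamma(2\alpha-3\beta-4)$. *)

(* Defs.v *)
From Stdlib Require Import Reals ZArith List ClassicalEpsilon.
From Coquelicot Require Import Coquelicot.

Open Scope R_scope.
Open Scope C_scope.

Definition ZtoC (k : Z) : C := RtoC (IZR k).
Definition NtoC (n : nat) : C := RtoC (INR n).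

(* Limits and sums in C, total and taken componentwise; meaningful when the
   sequence (resp. series) converges. *)
Definition CLim_seq (u : nat -> C) : C :=
  (real (Lim_seq (fun n => Re (u n))), real (Lim_seq (fun n => Im (u n)))).

Definition CSeries (a : nat -> C) : C :=
  (Series (fun n => Re (a n)), Series (fun n => Im (a n))).

Definition ex_Cseries (a : nat -> C) : Prop := @ex_series C_AbsRing C_NormedModule a.

Definition Cexp (z : C) : C :=
  ((exp (Re z) * cos (Im z))%R, (exp (Re z) * sin (Im z))%R).

(* Principal argument, with values in (-PI, PI] for z <> 0. *)
Definition Carg (z : C) : R :=
  if Rle_dec 0 (Im z) then acos (Re z / Cmod z) else (- acos (Re z / Cmod z))%R.

Definition Clog (z : C) : C := (ln (Cmod z), Carg z).

(* Principal branch of z ^ w, for z <> 0. *)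
Definition Cpower (z w : C) : C := Cexp (w * Clog z).

(* Principal square root: real part >= 0, and imaginary part >= 0 on the
   negative real axis. *)
Definition Csqrt (z : C) : C :=
  (sqrt ((Cmod z + Re z) / 2),
   if Rle_dec 0 (Im z) then sqrt ((Cmod z - Re z) / 2)
   else (- sqrt ((Cmod z - Re z) / 2))%R).

Fixpoint Poch (a : C) (n : nat) : C :=
  match n with
  | O => 1
  | S m => Poch a m * (a + NtoC m)
  end.

Definition Gamma_pole (z : C) : Prop := exists k : nat, z = - NtoC k.

(* Gauss's limit n! n^z / (z (z+1) ... (z+n)), valid at every z that is not a
   pole. *)
Definition Gamma (z : C) : C :=
  CLim_seq (fun n => NtoC (fact n) * Cpower (NtoC n) z / Poch z (S n)).

(* 1 / Gamma, equal to 0 at the poles of Gamma. *)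
Definition rGamma (z : C) : C :=
  if excluded_middle_informative (Gamma_pole z) then 0 else / Gamma z.

Definition hyp3F2_term (a1 a2 a3 b1 b2 z : C) (n : nat) : C :=
  Poch a1 n * Poch a2 n * Poch a3 n / (Poch b1 n * Poch b2 n)
  * (z ^ n / NtoC (fact n)).

Definition hyp3F2 (a1 a2 a3 b1 b2 z : C) : C :=
  CSeries (hyp3F2_term a1 a2 a3 b1 b2 z).

(* [coefA i j] and [coefB i j] are only meaningful for the tabulated (i, j);
   the final branch of each match is a dummy. *)
Definition coefA (i j : Z) (α β γ : C) : C :=
  match i, j with
  | 3%Z, 0%Z => 5 * α - β ^ 2 + (α + 1) ^ 2 - (2 * α - β + 1) * (β + γ)
  | 2%Z, 0%Z => 1 / 2 * (α - 1) * (α - 4) - (β ^ 2 - 5 * α + 1)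
                - (α - β + 1) * (β + γ)
  | 2%Z, 1%Z => (β - 1) * (β - 2) - (α - β + 1) * (α - β - γ + 3)
  | 2%Z, 2%Z => 1 / 2 * (α - γ + 2) * (α - 2 * β - γ + 5)
                  * ((α - γ + 2) * (α - 2 * β + 2) - α * (γ - 3))
                - (β - 1) * (β - 2) * (γ - 2) * (γ - 3)
  | 1%Z, 0%Z => 1
  | 1%Z, 1%Z => γ - α - 1
  | 1%Z, 2%Z => α * (α - 1) + (β + γ - 3) * (γ - 2 * α - 1)
  | 0%Z, 0%Z => 1
  | 0%Z, 1%Z => - (1)
  | 0%Z, 2%Z => 1 / 2 * ((α - β - γ + 1) ^ 2 + (γ - 1) * (γ - 3) - β ^ 2 + α)
  | 0%Z, 3%Z => γ * (α - β - γ + 4) - (α + 1) * (α + 2) - (α - 1) * (β - 1)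
                + 3 * α * β
  | (-1)%Z, 0%Z => 1
  | (-1)%Z, 1%Z => 1
  | (-1)%Z, 2%Z => β + γ - 1
  | (-1)%Z, 3%Z => (γ - 1) * (γ - 2) - β * (α - γ + 1)
  | (-2)%Z, 0%Z => 1 / 2 * (α - 1) * (α - 2 * β - 2) - γ * (α - β - 1)
  | (-2)%Z, 1%Z => α - β - 1
  | (-2)%Z, 2%Z => 1 / 2 * (α - 1) * (α - 2 * β - 2 * γ) + β * (β + γ)
  | (-2)%Z, 3%Z => (α - β - 1) * (γ - 1) - β * (β + 1)
  | (-3)%Z, 0%Z => (α - 1) * (α - 2 * β - 2 * γ - 4) + β * γ
  | (-3)%Z, 1%Z => (α - β - 2) * (α - γ - 1) - α * γ
  | (-3)%Z, 2%Z => (α - β - 1) * (α - β - 2 * γ - 2) - β * γ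
  | (-3)%Z, 3%Z => β * (β + 1) + (α - 1) * (α - β) - γ * (2 * α - β - 2)
  | _, _ => 0
  end.

Definition coefB (i j : Z) (α β γ : C) : C :=
  match i, j with
  | 3%Z, 0%Z => - α + 3 * β ^ 2 - (α + 3) ^ 2 + (2 * α - 3 * β + 5) * (β + γ)
  | 2%Z, 0%Z => - (2)
  | 2%Z, 1%Z => (α - β - 2 * γ + 5) * (α - β - γ + 3) - (β - 1) * (β - 2)
  | 2%Z, 2%Z => - (2) * (α - γ + 2) * (α - 2 * β - γ + 5)
  | 1%Z, 0%Z => - (1)
  | 1%Z, 1%Z => α - 2 * β - γ + 3
  | 1%Z, 2%Z => (β - 1) * (β - γ + 1) - (α - β - γ + 2) * (α - β - γ + 3)
  | 0%Z, 0%Z => 0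
  | 0%Z, 1%Z => 1
  | 0%Z, 2%Z => - (2)
  | 0%Z, 3%Z => (α + 2) * (α + 4) - β * (2 * α + 5)
                - 3 * γ * (α - β - γ + 4) + 3
  | (-1)%Z, 0%Z => 1
  | (-1)%Z, 1%Z => 1
  | (-1)%Z, 2%Z => - (β - γ + 1)
  | (-1)%Z, 3%Z => (γ - 1) * (γ - 2) + β * (α - 2 * β - γ + 1)
  | (-2)%Z, 0%Z => 2
  | (-2)%Z, 1%Z => α - β - 2 * γ - 1
  | (-2)%Z, 2%Z => 2
  | (-2)%Z, 3%Z => β * (α - 2 * γ + 2) - (β - γ + 1) * (α - β - 2 * γ + 1)
  | (-3)%Z, 0%Z => (α - 2) * (α - 2 * β - 2 * γ - 3) + 3 * β * γ
  | (-3)%Z, 1%Z => (α - β - 2) * (α - 2 * β - 2 * γ - 3) + β * γ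
  | (-3)%Z, 2%Z => (α - β - 2) * (α - β - 2 * γ - 1) + β * γ
  | (-3)%Z, 3%Z => (α - 1) * (α - 2) - 3 * β * (α - β - 2)
                   - γ * (2 * α - 3 * β - 4)
  | _, _ => 0
  end.

Definition An (i j : Z) (b d : C) (n : nat) : C :=
  coefA i j (2 * d - 1 - ZtoC i) (- NtoC n) b.

Definition Bn (i j : Z) (b d : C) (n : nat) : C :=
  coefB i j (2 * d - 1 - ZtoC i) (- NtoC n) b.

(* (k + |k|) / 2 = max(k, 0), as a natural number. *)
Definition half_abs (k : Z) : nat := Z.to_nat ((k + Z.abs k) / 2).

(* The greatest integer [k/2]: Z.div rounds towards minus infinity. *)
Definition floor_half (k : Z) : C := ZtoC (k / 2).

(* The Gamma functions and Pochhammer symbols of the transformation formula are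
   those of [Gammas_defined] and [Pochs_defined]; [rGamma] needs no hypothesis. *)
Definition Gammas_defined (i j : Z) (b d : C) : Prop :=
  ~ Gamma_pole d /\
  ~ Gamma_pole (d + 1 / 2) /\
  ~ Gamma_pole (b - 1 / 2 * ZtoC (i + j + Z.abs (i + j))) /\
  ~ Gamma_pole (d - b - ZtoC i / 2 + floor_half (i + j + 1)) /\
  ~ Gamma_pole (d - b + ZtoC i / 2 + 1 / 2 + floor_half (j + 1)) /\
  ~ Gamma_pole (d - b + 1 / 2 - ZtoC i / 2 + floor_half (i + j)) /\
  ~ Gamma_pole (d - b + ZtoC i / 2 + 1 + floor_half j).

Definition Pochs_defined (i j : Z) (b d : C) : Prop :=
  forall n : nat,
    Poch (d + 1 / 2) n <> 0 /\
    Poch (2 * d - b + ZtoC j) n <> 0 /\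
    Poch (d + 1 / 2 - ZtoC i / 2 + floor_half i) n <> 0 /\
    Poch (d - ZtoC i / 2 + floor_half (i + 1)) n <> 0.

Definition in_domain (x : C) : Prop :=
  (Cmod x < 1)%R /\ (Cmod (x / (1 + Csqrt (1 - x)) ^ 2) < 1)%R.

Definition rhs_prefactor (i j : Z) (b d : C) : C :=
  RtoC (powerRZ 2 i) * (- (1)) ^ half_abs i
  * Gamma d * Gamma (d + 1 / 2)
  * Gamma (b - 1 / 2 * ZtoC (i + j + Z.abs (i + j)))
  * rGamma b
  * rGamma (d - b + 1 / 2 * ZtoC j)
  * rGamma (d - b + 1 / 2 * ZtoC j + 1 / 2).

Definition rhs_term (i j : Z) (b d x : C) (n : nat) : C :=
  NtoC (fact n) / NtoC (fact (n + half_abs i))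
  * (Poch d n * Poch (d - 1 / 2) n / Poch (2 * d - b + ZtoC j) n)
  * (x ^ n / NtoC (fact n))
  * (An i j b d n
     * (Gamma (d - b - ZtoC i / 2 + floor_half (i + j + 1))
        * Gamma (d - b + ZtoC i / 2 + 1 / 2 + floor_half (j + 1))
        * rGamma (d - ZtoC i / 2)
        * rGamma (d + 1 / 2 - ZtoC i / 2 + floor_half i))
     * (Poch (d - b + ZtoC i / 2 + 1 / 2 + floor_half (j + 1)) n
        / Poch (d + 1 / 2 - ZtoC i / 2 + floor_half i) n)
     + Bn i j b d n
     * (Gamma (d - b + 1 / 2 - ZtoC i / 2 + floor_half (i + j))
        * Gamma (d - b + ZtoC i / 2 + 1 + floor_half j)
        * rGamma (d - ZtoC i / 2 - 1 / 2)
        * rGamma (d - ZtoC i / 2 + floor_half (i + 1)))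
     * (Poch (d - b + ZtoC i / 2 + 1 + floor_half j) n
        / Poch (d - ZtoC i / 2 + floor_half (i + 1)) n)).

(* Main.v *)
(** Write [p = 2 d - 1], [v = (1 + sqrt (1 - x)) / 2] and [u = x / (1 + sqrt (1 - x)) ^ 2],
    so that [u = x / (4 v ^ 2)].  The power series of [v ^ (- q)] has coefficients
    [wcoef q m], polynomial in [q]; inserting it for [q = p + 2 k] in
    [v ^ (- p) * sum_k c_k (- u) ^ k = sum_k c_k (- x / 4) ^ k v ^ (- p - 2 k)]
    and rearranging, the coefficient of [x ^ n] becomes a terminating [3F2] at [1] with
    parameters [2 d - 1 - i, - n, b; 2 d + n, 2 d - b + j].  For [i = j = 0] this is Dixon's
    sum; the other pairs [(i, j)] are reached from [(0, 0)] and [(-1, 0)] through three-term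
    contiguous relations, and both closed forms for the base pairs come from one induction on
    [n].  All quotients of Gamma functions on the right-hand side are rational, so only
    [Gamma (z + 1) = z * Gamma z] and [Gamma z <> 0] are needed. *)
Require Import Defs.
From Stdlib Require Import Reals ZArith List Lra Lia ClassicalEpsilon.
From Coquelicot Require Import Coquelicot.
Import ListNotations.
Open Scope R_scope.
Open Scope C_scope.

(** * Contiguous relations for terminating 3F2 series at 1 *)

(** The hypotheses only guarantee that the formula is defined, so each contiguous relation has to be
    solved for its target by a coefficient that is nonzero under just these conditions. This decides
    which relation reaches which pair. One induction serves both base pairs because the step from n
    to n + 1, which replaces d by d + 1/2, exchanges two products: the (0, 0) sum X, and 2 Y - X
    with Y the (-1, 0) sum. The rearrangement is dominated at a real point: with V = (1 + sqrt (1 -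
    |x|)) / 2, the partial sums of the series of v^-(p + 2k) are at most a constant times V^(-2k),
    and |x| / (4 V^2) = (1 - V) / V < 1. That the series with coefficients [wcoef q m] is the
    principal power of v is proved by differentiating along the segment from 0 to x, which calls for
    a second family of coefficients, that of the derivative. *)

Lemma NtoC_S (n : nat) : NtoC (S n) = NtoC n + 1.
Proof. unfold NtoC; now rewrite S_INR, RtoC_plus. Qed.

Lemma NtoC_0 : NtoC 0 = 0.
Proof. reflexivity. Qed.

Lemma NtoC_plus (m n : nat) : NtoC (m + n) = NtoC m + NtoC n.
Proof. unfold NtoC; now rewrite plus_INR, RtoC_plus. Qed.

Lemma NtoC_mult (m n : nat) : NtoC (m * n) = NtoC m * NtoC n.
Proof. unfold NtoC; now rewrite mult_INR, RtoC_mult. Qed.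

Lemma NtoC_inj (m n : nat) : NtoC m = NtoC n -> m = n.
Proof. intros H; apply INR_eq, RtoC_inj, H. Qed.

Lemma NtoC_S_neq0 (n : nat) : NtoC n + 1 <> 0.
Proof. rewrite <- NtoC_S; intros H; apply (NtoC_inj (S n) 0) in H; discriminate. Qed.

Lemma NtoC_fact_neq0 (n : nat) : NtoC (fact n) <> 0.
Proof. intros H; apply (NtoC_inj (fact n) 0) in H; now apply (fact_neq_0 n). Qed.

Lemma NtoC_fact_S (n : nat) : NtoC (fact (S n)) = (NtoC n + 1) * NtoC (fact n).
Proof. rewrite <- NtoC_S, <- NtoC_mult; reflexivity. Qed.

Lemma Poch_shift (a : C) (n : nat) : Poch a n * (a + NtoC n) = a * Poch (a + 1) n.
Proof.
  induction n as [|n IH]; simpl; [rewrite NtoC_0; ring|].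
  rewrite IH, NtoC_S; ring.
Qed.

Lemma Poch_Sl (a : C) (n : nat) : Poch a (S n) = a * Poch (a + 1) n.
Proof. simpl; apply Poch_shift. Qed.

(** Equivalent to [~ Gamma_pole z] ([nonpole_not_pole]), in the form in which the factors of
    [Poch z] appear. *)
Definition nonpole (z : C) : Prop := forall m : nat, z + NtoC m <> 0.

Lemma nonpole_S (z : C) : nonpole z -> nonpole (z + 1).
Proof.
  intros H m; specialize (H (S m)); rewrite NtoC_S in H.
  now replace (z + 1 + NtoC m) with (z + (NtoC m + 1)) by ring.
Qed.

Lemma nonpole_neq0 (z : C) : nonpole z -> z <> 0.
Proof. intros H; specialize (H 0%nat); now rewrite NtoC_0, Cplus_0_r in H. Qed.

Lemma nonpole_plus (z : C) (k : nat) : nonpole z -> nonpole (z + NtoC k).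
Proof. intros H m; rewrite <- Cplus_assoc, <- NtoC_plus; apply H. Qed.

Lemma nonpole_Poch (z : C) (n : nat) : nonpole z -> Poch z n <> 0.
Proof.
  intros H; induction n as [|n IH]; simpl; [apply C1_nz|].
  now apply Cmult_neq_0.
Qed.

Lemma sum_n_CS (u : nat -> C) (n : nat) :
  sum_n u (S n) = sum_n u n + u (S n).
Proof. exact (sum_Sn u n). Qed.

Lemma sum_n_C0 (u : nat -> C) : sum_n u 0 = u 0%nat.
Proof. exact (sum_O u). Qed.

(* [sum_n] states its equations in the carrier of an [AbelianMonoid], where [ring] fails. *)
Ltac as_C_eq := match goal with |- ?l = ?r => change (@eq C l r) end.

Lemma Poch_neg_lt (m n : nat) : (m < n)%nat -> Poch (- NtoC m) n = 0.
Proof.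
  intros H; induction H as [|n H IH]; simpl.
  - ring.
  - rewrite IH; ring.
Qed.

Lemma hyp3F2_term_S (a1 a2 a3 b1 b2 z : C) (k : nat) :
  nonpole b1 -> nonpole b2 ->
  hyp3F2_term a1 a2 a3 b1 b2 z (S k)
  = hyp3F2_term a1 a2 a3 b1 b2 z k
    * ((NtoC k + a1) / (NtoC k + b1) * ((NtoC k + a2) / (NtoC k + b2))
       * ((NtoC k + a3) / (NtoC k + 1)) * z).
Proof.
  intros H1 H2; unfold hyp3F2_term.
  rewrite NtoC_fact_S, Cpow_S; simpl (Poch _ (S k)).
  assert (P1 := nonpole_Poch _ k H1); assert (P2 := nonpole_Poch _ k H2).
  assert (F := NtoC_fact_neq0 k); assert (FS := NtoC_S_neq0 k).
  assert (N1 := H1 k); assert (N2 := H2 k); rewrite Cplus_comm in N1, N2.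
  field; repeat split; auto; rewrite Cplus_comm; auto.
Qed.

Definition term1 (a b c e f : C) : nat -> C := hyp3F2_term a b c e f 1.

(* The prefactor clears the denominators, so that lowering [e] or [n] costs no division by
   a linear form that may vanish. *)
Definition dixon_sum (n : nat) (a b e f : C) : C :=
  Poch e n * Poch f n * sum_n (term1 a b (- NtoC n) e f) n.

(** Shifting a numerator parameter multiplies the k-th term by (a + k) / a, stated here without the
    quotient. The contiguous relations below are linear dependencies between a constant and two of
    the factors a + k, b + k, c + k, e + k. *)
Lemma term1_a (a b c e f : C) (k : nat) :
  a * term1 (a + 1) b c e f k = (a + NtoC k) * term1 a b c e f k.
Proof.
  unfold term1, hyp3F2_term, Cdiv.
  transitivity (a * Poch (a + 1) k * Poch b k * Poch c k * / (Poch e k * Poch f k)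
    * (1 ^ k * / NtoC (fact k))); [ring|].
  rewrite <- Poch_shift; ring.
Qed.

Lemma term1_b (a b c e f : C) (k : nat) :
  b * term1 a (b + 1) c e f k = (b + NtoC k) * term1 a b c e f k.
Proof.
  unfold term1, hyp3F2_term, Cdiv.
  transitivity (Poch a k * (b * Poch (b + 1) k) * Poch c k * / (Poch e k * Poch f k)
    * (1 ^ k * / NtoC (fact k))); [ring|].
  rewrite <- Poch_shift; ring.
Qed.

Lemma term1_c (a b c e f : C) (k : nat) :
  c * term1 a b (c + 1) e f k = (c + NtoC k) * term1 a b c e f k.
Proof.
  unfold term1, hyp3F2_term, Cdiv.
  transitivity (Poch a k * Poch b k * (c * Poch (c + 1) k) * / (Poch e k * Poch f k)
    * (1 ^ k * / NtoC (fact k))); [ring|].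
  rewrite <- Poch_shift; ring.
Qed.

Lemma term1_e (a b c e f : C) (k : nat) : nonpole e -> nonpole f ->
  e * term1 a b c e f k = (e + NtoC k) * term1 a b c (e + 1) f k.
Proof.
  intros He Hf; pose proof (nonpole_Poch _ k He); pose proof (nonpole_Poch _ k Hf).
  pose proof (nonpole_Poch _ k (nonpole_S _ He)).
  pose proof (NtoC_fact_neq0 k).
  assert (E : e = Poch e k * (e + NtoC k) / Poch (e + 1) k)
    by (rewrite Poch_shift; field; auto).
  unfold term1, hyp3F2_term; rewrite E at 1; field; auto.
Qed.

Lemma sum_n_Clin3 (u v w : nat -> C) (x y z : C) (n : nat) :
  (forall k, z * w k = x * u k + y * v k) ->
  z * sum_n w n = x * sum_n u n + y * sum_n v n.
Proof.
  intros H; induction n as [|n IH].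
  - rewrite !sum_n_C0; apply H.
  - rewrite !sum_n_CS, Cmult_plus_distr_l, IH, H; ring.
Qed.

(** Termwise this is a - b = (a + k) - (b + k). *)
Lemma dixon_sum_ab (n : nat) (a b e f : C) :
  (a - b) * dixon_sum n a b e f = a * dixon_sum n (a + 1) b e f - b * dixon_sum n a (b + 1) e f.
Proof.
  unfold dixon_sum.
  assert (H : (a - b) * sum_n (term1 a b (- NtoC n) e f) n
    = a * sum_n (term1 (a + 1) b (- NtoC n) e f) n
      + (- b) * sum_n (term1 a (b + 1) (- NtoC n) e f) n).
  { apply sum_n_Clin3; intros k.
    transitivity ((a + NtoC k) * term1 a b (- NtoC n) e f k
      - (b + NtoC k) * term1 a b (- NtoC n) e f k); [ring|].
    rewrite <- term1_a, <- term1_b; ring. }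
  transitivity (Poch e n * Poch f n
    * ((a - b) * sum_n (term1 a b (- NtoC n) e f) n)); [ring|].
  rewrite H; ring.
Qed.

(** Termwise this is a - e = (a + k) - (e + k); the change of e in the normalising factor produces e
    + n. *)
Lemma dixon_sum_ae (n : nat) (a b e f : C) : nonpole e -> nonpole f ->
  (a - e) * dixon_sum n a b (e + 1) f
  = a * dixon_sum n (a + 1) b (e + 1) f - (e + NtoC n) * dixon_sum n a b e f.
Proof.
  intros He Hf; unfold dixon_sum.
  assert (H : (a - e) * sum_n (term1 a b (- NtoC n) (e + 1) f) n
    = a * sum_n (term1 (a + 1) b (- NtoC n) (e + 1) f) n
      + (- e) * sum_n (term1 a b (- NtoC n) e f) n).
  { apply sum_n_Clin3; intros k.
    transitivity ((a + NtoC k) * term1 a b (- NtoC n) (e + 1) f k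
      - (e + NtoC k) * term1 a b (- NtoC n) (e + 1) f k); [ring|].
    rewrite <- term1_a, <- term1_e by auto; ring. }
  transitivity (Poch (e + 1) n * Poch f n
    * ((a - e) * sum_n (term1 a b (- NtoC n) (e + 1) f) n)); [ring|].
  rewrite H.
  transitivity (a * (Poch (e + 1) n * Poch f n
     * sum_n (term1 (a + 1) b (- NtoC n) (e + 1) f) n)
     - e * Poch (e + 1) n * Poch f n * sum_n (term1 a b (- NtoC n) e f) n); [ring|].
  rewrite <- Poch_shift; ring.
Qed.

Lemma dixon_sum_ac (n : nat) (a b e f : C) :
  (a + NtoC n + 1) * dixon_sum (S n) a b e f
  = a * dixon_sum (S n) (a + 1) b e f
    + (NtoC n + 1) * (e + NtoC n) * (f + NtoC n) * dixon_sum n a b e f.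
Proof.
  unfold dixon_sum.
  assert (H : (a - - NtoC (S n)) * sum_n (term1 a b (- NtoC (S n)) e f) (S n)
    = a * sum_n (term1 (a + 1) b (- NtoC (S n)) e f) (S n)
      + NtoC (S n) * sum_n (term1 a b (- NtoC n) e f) (S n)).
  { apply sum_n_Clin3; intros k.
    transitivity ((a + NtoC k) * term1 a b (- NtoC (S n)) e f k
      - (- NtoC (S n) + NtoC k) * term1 a b (- NtoC (S n)) e f k); [ring|].
    rewrite <- term1_a, <- term1_c.
    replace (- NtoC (S n) + 1) with (- NtoC n) by (rewrite NtoC_S; ring); ring. }
  rewrite (sum_n_CS (term1 a b (- NtoC n) e f)) in H.
  (* Raising the parameter - (n + 1) to - n shortens the series: its term at n + 1 contains (-
     n)_(n+1) = 0. *)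
  assert (Z : term1 a b (- NtoC n) e f (S n) = 0).
  { unfold term1, hyp3F2_term, Cdiv; rewrite (Poch_neg_lt n (S n)) by lia; ring. }
  rewrite Z in H; rewrite NtoC_S in *; simpl (Poch _ (S n)).
  transitivity (Poch e n * (e + NtoC n) * (Poch f n * (f + NtoC n))
    * ((a - - (NtoC n + 1)) * sum_n (term1 a b (- (NtoC n + 1)) e f) (S n))); [ring|].
  rewrite H; ring.
Qed.

Definition dixon (i j : Z) (d b : C) (n : nat) : C :=
  dixon_sum n (2 * d - 1 - ZtoC i) b (2 * d + NtoC n) (2 * d - b + ZtoC j).

Lemma ZtoC_plus (x y : Z) : ZtoC (x + y) = ZtoC x + ZtoC y.
Proof. unfold ZtoC; now rewrite plus_IZR, RtoC_plus. Qed.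
Lemma ZtoC_minus (x y : Z) : ZtoC (x - y) = ZtoC x - ZtoC y.
Proof. unfold ZtoC; now rewrite minus_IZR, RtoC_minus. Qed.

Ltac Vargs := f_equal; rewrite ?ZtoC_plus, ?ZtoC_minus, ?NtoC_S; unfold ZtoC; field.

(* In the parameters of [dixon_sum], [a + 1] lowers [i], [b + 1] raises [j], [e - 1] turns
   [(i, j)] into [(i - 1, j + 1)] and [n - 1] turns it into [(i + 1, j - 1)]. *)
Lemma dixon_b (i j : Z) (d b : C) (n : nat) :
  (b - 1) * dixon i (j + 1) d b n
  = (2 * d - 1 - ZtoC i) * dixon (i - 1) j d (b - 1) n
    - (2 * d - ZtoC i - b) * dixon i j d (b - 1) n.
Proof.
  pose proof (dixon_sum_ab n (2 * d - 1 - ZtoC i) (b - 1) (2 * d + NtoC n)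
    (2 * d - (b - 1) + ZtoC j)) as H.
  unfold dixon.
  replace (dixon_sum n (2 * d - 1 - ZtoC i) b (2 * d + NtoC n) (2 * d - b + ZtoC (j + 1)))
    with (dixon_sum n (2 * d - 1 - ZtoC i) (b - 1 + 1) (2 * d + NtoC n) (2 * d - (b - 1) + ZtoC j))
    by Vargs.
  replace (2 * d - 1 - ZtoC (i - 1)) with (2 * d - 1 - ZtoC i + 1)
    by (rewrite ZtoC_minus; unfold ZtoC; ring).
  transitivity ((b - 1) * dixon_sum n (2 * d - 1 - ZtoC i) (b - 1 + 1) (2 * d + NtoC n)
     (2 * d - (b - 1) + ZtoC j)
     + ((2 * d - 1 - ZtoC i - (b - 1))
        * dixon_sum n (2 * d - 1 - ZtoC i) (b - 1) (2 * d + NtoC n) (2 * d - (b - 1) + ZtoC j))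
     - (2 * d - ZtoC i - b)
        * dixon_sum n (2 * d - 1 - ZtoC i) (b - 1) (2 * d + NtoC n) (2 * d - (b - 1) + ZtoC j));
    [ring|].
  rewrite H; ring.
Qed.

Lemma dixon_a (i j : Z) (d b : C) (n : nat) :
  (2 * d - 1 - ZtoC i) * dixon (i - 1) j d b n
  = (2 * d - 1 - ZtoC i - b) * dixon i j d b n + b * dixon i (j + 1) d (b + 1) n.
Proof.
  pose proof (dixon_sum_ab n (2 * d - 1 - ZtoC i) b (2 * d + NtoC n)
    (2 * d - b + ZtoC j)) as H.
  unfold dixon.
  replace (2 * d - (b + 1) + ZtoC (j + 1)) with (2 * d - b + ZtoC j)
    by (rewrite ZtoC_plus; unfold ZtoC; ring).
  replace (2 * d - 1 - ZtoC (i - 1)) with (2 * d - 1 - ZtoC i + 1)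
    by (rewrite ZtoC_minus; unfold ZtoC; ring).
  rewrite H; ring.
Qed.

Lemma dixon_e (i j : Z) (d b : C) (n : nat) :
  nonpole (2 * d + NtoC n) -> nonpole (2 * d - b + ZtoC (j + 1)) ->
  (2 * d + 2 * NtoC n) * dixon (i - 1) (j + 1) d b n
  = (2 * d - ZtoC i) * dixon (i - 1) j (d + 1 / 2) b n
    + (ZtoC i + NtoC n) * dixon i j (d + 1 / 2) b n.
Proof.
  intros He Hf; unfold dixon.
  replace (2 * d - b + ZtoC (j + 1)) with (2 * d - b + ZtoC j + 1) in *
    by (rewrite ZtoC_plus; unfold ZtoC; ring).
  pose proof (dixon_sum_ae n (2 * d - ZtoC i) b (2 * d + NtoC n)
    (2 * d - b + ZtoC j + 1) He Hf) as H.
  replace (2 * (d + 1 / 2) + NtoC n) with (2 * d + NtoC n + 1) by field.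
  replace (2 * (d + 1 / 2) - b + ZtoC j) with (2 * d - b + ZtoC j + 1) by field.
  replace (2 * (d + 1 / 2) - 1 - ZtoC (i - 1)) with (2 * d - ZtoC i + 1)
    by (rewrite ZtoC_minus; unfold ZtoC; field).
  replace (2 * (d + 1 / 2) - 1 - ZtoC i) with (2 * d - ZtoC i) by field.
  replace (2 * d - 1 - ZtoC (i - 1)) with (2 * d - ZtoC i)
    by (rewrite ZtoC_minus; unfold ZtoC; field).
  transitivity ((2 * d + NtoC n + NtoC n)
    * dixon_sum n (2 * d - ZtoC i) b (2 * d + NtoC n) (2 * d - b + ZtoC j + 1)
    + (2 * d - ZtoC i - (2 * d + NtoC n))
      * dixon_sum n (2 * d - ZtoC i) b (2 * d + NtoC n + 1) (2 * d - b + ZtoC j + 1)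
    + (ZtoC i + NtoC n)
      * dixon_sum n (2 * d - ZtoC i) b (2 * d + NtoC n + 1) (2 * d - b + ZtoC j + 1)); [ring|].
  rewrite H; ring.
Qed.

Lemma dixon_n (i j : Z) (d b : C) (n : nat) :
  (NtoC n + 1) * (2 * d + 2 * NtoC n) * (2 * d - b + ZtoC j - 1 + NtoC n)
  * dixon (i + 1) (j - 1) d b n
  = (2 * d - 1 - ZtoC i + NtoC n) * dixon i j (d - 1 / 2) b (S n)
    - (2 * d - 2 - ZtoC i) * dixon (i - 1) j (d - 1 / 2) b (S n).
Proof.
  pose proof (dixon_sum_ac n (2 * d - 2 - ZtoC i) b (2 * d + NtoC n)
    (2 * d - b + ZtoC j - 1)) as H.
  unfold dixon.
  replace (2 * (d - 1 / 2) + NtoC (S n)) with (2 * d + NtoC n)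
    by (rewrite NtoC_S; field).
  replace (2 * (d - 1 / 2) - b + ZtoC j) with (2 * d - b + ZtoC j - 1) by field.
  replace (2 * d - b + ZtoC (j - 1)) with (2 * d - b + ZtoC j - 1)
    by (rewrite ZtoC_minus; unfold ZtoC; ring).
  replace (2 * (d - 1 / 2) - 1 - ZtoC (i - 1)) with (2 * d - 2 - ZtoC i + 1)
    by (rewrite ZtoC_minus; unfold ZtoC; field).
  replace (2 * (d - 1 / 2) - 1 - ZtoC i) with (2 * d - 2 - ZtoC i) by field.
  replace (2 * d - 1 - ZtoC (i + 1)) with (2 * d - 2 - ZtoC i)
    by (rewrite ZtoC_plus; unfold ZtoC; field).
  replace (2 * d - 1 - ZtoC i + NtoC n) with (2 * d - 2 - ZtoC i + NtoC n + 1) by ring.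
  rewrite H; ring.
Qed.

(** * Dixon's sum *)

Section DixonStep.
Variables (a b e f : C) (n : nat).
Hypotheses (He : nonpole e) (Hf : nonpole f).
Hypotheses (Ee : e = a + NtoC n + 2) (Ef : f = a + 1 - b).

(** With a = 2 d - 1 this is the summand of the (0, 0) sum at n and d + 1/2, while [term1 a b c e f]
    is the one at n + 1 and d. *)
Let h : nat -> C := term1 (a + 1) b (- NtoC n) e (f + 1).
Let c : C := - NtoC (S n).

Lemma dixon_h_S (k : nat) :
  h (S k) = h k * ((a + 1 + NtoC k) * (b + NtoC k) * (- NtoC n + NtoC k))
    / ((e + NtoC k) * (f + 1 + NtoC k) * (NtoC k + 1)).
Proof.
  unfold h, term1; rewrite hyp3F2_term_S by auto using nonpole_S.
  assert (H1 := He k); assert (H2 := nonpole_S _ Hf k); assert (H3 := NtoC_S_neq0 k).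
  rewrite Cplus_comm in H1, H2; field; repeat split; auto; rewrite Cplus_comm; auto.
Qed.

(** As (a)_(k+1) = a (a + 1)_k, and likewise for c and f, the summand at k + 1 is a rational
    multiple of [h k]. The certificates below thus become identities of rational functions. *)
Lemma dixon_T_S (k : nat) :
  f * term1 a b c e f (S k)
  = a * (b + NtoC k) * c * h k / ((e + NtoC k) * (NtoC k + 1)).
Proof.
  unfold h, term1, hyp3F2_term, c.
  rewrite (Poch_Sl a), (Poch_Sl (- NtoC (S n))), (Poch_Sl f), NtoC_fact_S, Cpow_S.
  replace (- NtoC (S n) + 1) with (- NtoC n) by (rewrite NtoC_S; ring).
  simpl (Poch _ (S k)).
  pose proof (nonpole_Poch _ k He); pose proof (nonpole_Poch _ k (nonpole_S _ Hf)).
  pose proof (NtoC_fact_neq0 k); pose proof (NtoC_S_neq0 k).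
  pose proof (He k); pose proof (nonpole_neq0 _ Hf).
  field; repeat split; auto.
Qed.

Lemma dixon_T1_S (k : nat) :
  f * term1 (a + 1) b c e f (S k)
  = (a + NtoC k + 1) * (b + NtoC k) * c * h k / ((e + NtoC k) * (NtoC k + 1)).
Proof.
  unfold h, term1, hyp3F2_term, c.
  rewrite (Poch_Sl (- NtoC (S n))), (Poch_Sl f), NtoC_fact_S, Cpow_S.
  replace (- NtoC (S n) + 1) with (- NtoC n) by (rewrite NtoC_S; ring).
  simpl (Poch _ (S k)).
  pose proof (nonpole_Poch _ k He); pose proof (nonpole_Poch _ k (nonpole_S _ Hf)).
  pose proof (NtoC_fact_neq0 k); pose proof (NtoC_S_neq0 k).
  pose proof (He k); pose proof (nonpole_neq0 _ Hf).
  field; repeat split; auto.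
Qed.

Lemma term1_0 (a' b' c' e' f' : C) : term1 a' b' c' e' f' 0 = 1.
Proof. unfold term1, hyp3F2_term; simpl; unfold NtoC; simpl; field. Qed.

(* The last summand is a telescoping certificate; it vanishes at [K = n + 1]. *)
Lemma dixon_partial_even (K : nat) :
  (e + NtoC n) * f * sum_n (term1 a b c e f) K
  = (a + 2 - 2 * b + 2 * NtoC n) * sum_n (fun k => (a + 1 + 2 * NtoC k) * h k) K
    + h K * (b + NtoC K) * (2 * NtoC K + a - 2 * NtoC n).
Proof.
  induction K as [|K IH].
  - rewrite !sum_n_C0; unfold h; rewrite !term1_0, NtoC_0, Ee, Ef; ring.
  - rewrite !sum_n_CS, Cmult_plus_distr_l, IH, <- (Cmult_assoc _ f (term1 _ _ _ _ _ _)).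
    rewrite dixon_T_S, dixon_h_S.
    pose proof (He K) as H1; pose proof (nonpole_S _ Hf K) as H2.
    pose proof (NtoC_S_neq0 K); unfold c; rewrite !NtoC_S.
    set (S1 := sum_n _ K); clearbody S1; set (hK := h K); clearbody hK.
    rewrite Ee, Ef in *; field; repeat split; auto.
Qed.

(** Telescoping for the combination 2 Y - X; the certificate [h K * (b + NtoC K)] vanishes at K = n
    + 1 because [h] does. *)
Lemma dixon_partial_odd (K : nat) :
  f * sum_n (fun k => 2 * term1 (a + 1) b c e f k - term1 a b c e f k) K
  = (a + 1 - 2 * b) * sum_n h K + h K * (b + NtoC K).
Proof.
  induction K as [|K IH].
  - rewrite !sum_n_C0; unfold h; rewrite !term1_0, NtoC_0, Ef; ring.
  - rewrite !sum_n_CS, Cmult_plus_distr_l, IH.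
    replace (f * (2 * term1 (a + 1) b c e f (S K) - term1 a b c e f (S K)))
      with (2 * (f * term1 (a + 1) b c e f (S K)) - f * term1 a b c e f (S K)) by ring.
    rewrite dixon_T_S, dixon_T1_S, dixon_h_S.
    pose proof (He K) as H1; pose proof (nonpole_S _ Hf K) as H2.
    pose proof (NtoC_S_neq0 K); unfold c; rewrite !NtoC_S.
    set (S1 := sum_n _ K); clearbody S1; set (hK := h K); clearbody hK.
    rewrite Ee, Ef in *; field; repeat split; auto.
Qed.

Lemma dixon_h_last : h (S n) = 0.
Proof.
  unfold h, term1, hyp3F2_term, Cdiv; rewrite (Poch_neg_lt n (S n)) by lia; ring.
Qed.

(** By [term1_a], (a + 1 + 2 k) h k is a + 1 times the summand of 2 Y - X at n and d + 1/2. So X at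
    n + 1 comes from 2 Y - X at n, and [dixon_sum_S_odd] gives the converse passage. *)
Lemma dixon_sum_S_even :
  dixon_sum (S n) a b e f
  = (a + 2 - 2 * b + 2 * NtoC n) * ((a + 1)
    * (2 * dixon_sum n (a + 1 + 1) b e (f + 1) - dixon_sum n (a + 1) b e (f + 1))).
Proof.
  pose proof (dixon_partial_even (S n)) as H; rewrite dixon_h_last in H.
  rewrite (sum_n_CS (fun k => (a + 1 + 2 * NtoC k) * h k)), dixon_h_last in H.
  assert (Q : (a + 1) * (2 * sum_n (term1 (a + 1 + 1) b (- NtoC n) e (f + 1)) n
      - sum_n (term1 (a + 1) b (- NtoC n) e (f + 1)) n)
      = sum_n (fun k => (a + 1 + 2 * NtoC k) * h k) n).
  { transitivity (1 * sum_n (fun k => (a + 1 + 2 * NtoC k) * h k) n); [|ring].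
    symmetry.
    rewrite (sum_n_Clin3 (term1 (a + 1 + 1) b (- NtoC n) e (f + 1))
      (term1 (a + 1) b (- NtoC n) e (f + 1)) _ (2 * (a + 1)) (- (a + 1)) 1).
    - ring.
    - intros k; rewrite <- Cmult_assoc, term1_a; unfold h; ring. }
  unfold dixon_sum; rewrite (Poch_Sl f); simpl (Poch e (S n)).
  transitivity (Poch e n * Poch (f + 1) n
    * ((e + NtoC n) * f * sum_n (term1 a b c e f) (S n))); [unfold c; ring|].
  rewrite H, <- Q; ring.
Qed.

Lemma dixon_sum_S_odd :
  2 * dixon_sum (S n) (a + 1) b e f - dixon_sum (S n) a b e f
  = (e + NtoC n) * (a + 1 - 2 * b) * dixon_sum n (a + 1) b e (f + 1).
Proof.
  pose proof (dixon_partial_odd (S n)) as H; rewrite dixon_h_last in H.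
  rewrite (sum_n_CS h), dixon_h_last in H.
  assert (Q : 2 * sum_n (term1 (a + 1) b c e f) (S n) - sum_n (term1 a b c e f) (S n)
      = sum_n (fun k => 2 * term1 (a + 1) b c e f k - term1 a b c e f k) (S n)).
  { transitivity (1 * sum_n (fun k => 2 * term1 (a + 1) b c e f k - term1 a b c e f k) (S n));
      [|ring].
    symmetry; rewrite (sum_n_Clin3 (term1 (a + 1) b c e f) (term1 a b c e f) _ 2 (- (1)) 1).
    - ring.
    - intros k; cbv beta; ring. }
  unfold dixon_sum; rewrite (Poch_Sl f); simpl (Poch e (S n)).
  transitivity (Poch e n * Poch (f + 1) n * (e + NtoC n)
    * (f * (2 * sum_n (term1 (a + 1) b c e f) (S n) - sum_n (term1 a b c e f) (S n))));
    [unfold c; ring|].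
  rewrite Q, H; unfold h; ring.
Qed.

End DixonStep.

(** Y appears doubled since it is 2 Y - X = 4^n (d + 1/2)_n (d - b)_n that is a single product. *)
Lemma dixon_sum_closed (n : nat) : forall d b : C,
  nonpole (2 * d + NtoC n) -> nonpole (2 * d - b) ->
  dixon_sum n (2 * d - 1) b (2 * d + NtoC n) (2 * d - b)
  = 4 ^ n * Poch d n * Poch (d + 1 / 2 - b) n /\
  2 * dixon_sum n (2 * d) b (2 * d + NtoC n) (2 * d - b)
  = 4 ^ n * (Poch d n * Poch (d + 1 / 2 - b) n + Poch (d + 1 / 2) n * Poch (d - b) n).
Proof.
  induction n as [|n IH]; intros d b He Hf.
  - unfold dixon_sum; rewrite !sum_n_C0, !term1_0; simpl; split; ring.
  - rewrite NtoC_S in He.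
    replace (2 * d + (NtoC n + 1)) with (2 * (d + 1 / 2) + NtoC n) in He by field.
    assert (Hf' : nonpole (2 * (d + 1 / 2) - b)).
    { replace (2 * (d + 1 / 2) - b) with (2 * d - b + 1) by field; now apply nonpole_S. }
    destruct (IH (d + 1 / 2) b He Hf') as [IX IY].
    assert (Ee : 2 * (d + 1 / 2) + NtoC n = 2 * d - 1 + NtoC n + 2) by field.
    assert (Ef : 2 * d - b = 2 * d - 1 + 1 - b) by ring.
    pose proof (dixon_sum_S_even _ _ _ _ n He Hf Ee Ef) as X.
    pose proof (dixon_sum_S_odd _ _ _ _ n He Hf Ee Ef) as Y.
    replace (2 * d - b + 1) with (2 * (d + 1 / 2) - b) in X, Y by field.
    replace (2 * d - 1 + 1 + 1) with (2 * (d + 1 / 2)) in X by field.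
    replace (2 * d - 1 + 1) with (2 * (d + 1 / 2) - 1) in X by field.
    replace (dixon_sum n (2 * d - 1 + 1) b) with (dixon_sum n (2 * (d + 1 / 2) - 1) b) in Y
      by (f_equal; field).
    replace (dixon_sum (S n) (2 * d - 1 + 1) b) with (dixon_sum (S n) (2 * d) b) in Y
      by (f_equal; field).
    rewrite NtoC_S; replace (2 * d + (NtoC n + 1)) with (2 * (d + 1 / 2) + NtoC n) by field.
    rewrite IY, IX in X; rewrite IX in Y.
    replace (d + 1 / 2 + 1 / 2 - b) with (d - b + 1) in * by field.
    replace (d + 1 / 2 + 1 / 2) with (d + 1) in * by field.
    assert (X' : dixon_sum (S n) (2 * d - 1) b (2 * (d + 1 / 2) + NtoC n) (2 * d - b)
      = 4 ^ S n * (d * Poch (d + 1) n) * (Poch (d + 1 / 2 - b) n * (d + 1 / 2 - b + NtoC n))).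
    { rewrite X, Cpow_S; field. }
    assert (Y' : 2 * dixon_sum (S n) (2 * d) b (2 * (d + 1 / 2) + NtoC n) (2 * d - b)
      = dixon_sum (S n) (2 * d - 1) b (2 * (d + 1 / 2) + NtoC n) (2 * d - b)
       + 4 ^ S n * (Poch (d + 1 / 2) n * (d + 1 / 2 + NtoC n)) * ((d - b) * Poch (d - b + 1) n)).
    { transitivity ((2 * dixon_sum (S n) (2 * d) b (2 * (d + 1 / 2) + NtoC n) (2 * d - b)
        - dixon_sum (S n) (2 * d - 1) b (2 * (d + 1 / 2) + NtoC n) (2 * d - b))
        + dixon_sum (S n) (2 * d - 1) b (2 * (d + 1 / 2) + NtoC n) (2 * d - b)); [ring|].
      rewrite Y, Cpow_S; field. }
    rewrite Y', X'.
    rewrite (Poch_Sl d), (Poch_Sl (d - b)); simpl (Poch _ (S n)).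
    rewrite Cpow_S; split; ring.
Qed.

(** * Closed forms of the contiguous sums *)

(* [Gamma (y + m) / Gamma y], as a rational function. *)
Definition gratio (y : C) (m : Z) : C :=
  match m with
  | Z0 => 1
  | Zpos p => Poch y (Pos.to_nat p)
  | Zneg p => / Poch (y - ZtoC (Zpos p)) (Pos.to_nat p)
  end.

(* The braces of the transformation formula.  By parity, the Gamma arguments are integer
   translates of [d], [d + 1/2], [y], [y + 1/2] with [y = d - b + j/2]; the remainders modulo
   2 select which one occurs in the [A]-term and which one in the [B]-term. *)
Definition dixon_value (i j : Z) (d b : C) (n : nat) : C :=
  RtoC (powerRZ 2 i) * (- (1)) ^ half_abs i
  * gratio b (- ((i + j + Z.abs (i + j)) / 2)) / Poch (NtoC n + 1) (half_abs i)
  * 4 ^ n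
  * (An i j b d n
     * (Poch (d + ZtoC (i mod 2) / 2) n
        * gratio (d - ZtoC i / 2) ((i + i mod 2) / 2))
     * (Poch (d - b + ZtoC (j + 1 - (i + j) mod 2) / 2) n
        * gratio (d - b + ZtoC (j + 1 - (i + j) mod 2) / 2 + NtoC n)
            ((i + 2 * ((j + 1) / 2) - j + (i + j) mod 2) / 2))
     + Bn i j b d n
     * (Poch (d + ZtoC (1 - i mod 2) / 2) n
        * gratio (d - ZtoC i / 2 - 1 / 2) ((i + 2 - i mod 2) / 2))
     * (Poch (d - b + ZtoC (j + (i + j) mod 2) / 2) n
        * gratio (d - b + ZtoC (j + (i + j) mod 2) / 2 + NtoC n)
            ((i + 2 + 2 * (j / 2) - j - (i + j) mod 2) / 2))).

(* Inherited by the two sources of each contiguous relation used below.  There [d] may drop by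
   1/2 while [n] grows by 1, which is why the first condition involves [2 d + n]. *)
Definition regular (i j : Z) (d b : C) (n : nat) : Prop :=
  nonpole (2 * d + NtoC n) /\
  nonpole (2 * d - b + ZtoC j) /\
  nonpole (2 * d - 2 * b + ZtoC (j + Z.min (i + 1) 0)) /\
  (forall k : nat, (1 <= k)%nat -> (Z.of_nat k <= i + j)%Z -> b <> NtoC k) /\
  ((i < -1)%Z -> nonpole (2 * d)).

Definition evaluated (i j : Z) : Prop :=
  forall (d b : C) (n : nat), regular i j d b n -> dixon i j d b n = dixon_value i j d b n.

Lemma Poch_up (y : C) (n : nat) :
  y + NtoC n <> 0 -> Poch y n = y / (y + NtoC n) * Poch (y + 1) n.
Proof.
  intros H.
  transitivity (Poch y n * (y + NtoC n) / (y + NtoC n)); [field; auto|].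
  rewrite Poch_shift; field; auto.
Qed.

Lemma Cmult_eq_reg_l (c x y : C) : c <> 0 -> c * x = c * y -> x = y.
Proof.
  intros Hc E; transitivity (/ c * (c * x)); [field; auto|].
  rewrite E; field; auto.
Qed.

Lemma neq0_scale (k c x y : C) : c <> 0 -> y <> 0 -> k * x = c * y -> x <> 0.
Proof.
  intros Hc Hy E ->; rewrite Cmult_0_r in E; symmetry in E.
  now apply (Cmult_neq_0 c y).
Qed.

Lemma nonpole_shift (z z' : C) (k : nat) : nonpole z -> z' = z + NtoC k -> nonpole z'.
Proof. intros H ->; now apply nonpole_plus. Qed.

Lemma NtoC_1 : NtoC 1 = 1. Proof. reflexivity. Qed.
Lemma NtoC_2 : NtoC 2 = 2. Proof. unfold NtoC; simpl; f_equal; lra. Qed.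
Lemma NtoC_3 : NtoC 3 = 3. Proof. unfold NtoC; simpl; f_equal; lra. Qed.
Lemma NtoC_4 : NtoC 4 = 4. Proof. unfold NtoC; simpl; f_equal; lra. Qed.
Lemma RtoC_neq0 (r : R) : r <> 0%R -> RtoC r <> 0.
Proof. intros H E; apply H, RtoC_inj, E. Qed.
Lemma pow2_0 : powerRZ 2 0 = 1%R. Proof. reflexivity. Qed.
Lemma pow2_1 : RtoC (powerRZ 2 1) = 2. Proof. simpl; f_equal; lra. Qed.
Lemma pow2_2 : RtoC (powerRZ 2 2) = 4. Proof. simpl; f_equal; lra. Qed.
Lemma pow2_3 : RtoC (powerRZ 2 3) = 8. Proof. simpl; f_equal; lra. Qed.
Lemma pow2_m1 : RtoC (powerRZ 2 (-1)) = 1 / 2.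
Proof. simpl; rewrite <- RtoC_div; f_equal; lra. Qed.
Lemma pow2_m2 : RtoC (powerRZ 2 (-2)) = 1 / 4.
Proof. simpl; rewrite <- RtoC_div; f_equal; lra. Qed.
Lemma pow2_m3 : RtoC (powerRZ 2 (-3)) = 1 / 8.
Proof. simpl; rewrite <- RtoC_div; f_equal; lra. Qed.

Ltac vm_change t :=
  let v := eval vm_compute in t in progress change t with v.
Ltac reduce_Z :=
  unfold half_abs in *; repeat match goal with
  | |- context [Z.to_nat ?a] => vm_change (Z.to_nat a)
  | |- context [gratio _ ?a] => vm_change a
  | |- context [ZtoC ?a] => vm_change a
  | H : context [ZtoC ?a] |- _ =>
      let v := eval vm_compute in a in progress change (ZtoC a) with (ZtoC v) in H
  | H : context [dixon ?i ?j] |- _ =>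
      let v := eval vm_compute in i in let w := eval vm_compute in j in
      progress change (dixon i j) with (dixon v w) in H
  end.

Ltac unfold_value := unfold dixon_value, An, Bn; reduce_Z;
  cbn [coefA coefB gratio];
  repeat match goal with |- context [Pos.to_nat ?a] => vm_change (Pos.to_nat a) end;
  unfold ZtoC.
Ltac unfold_small :=
  cbn [Poch Cpow];
  rewrite ?pow2_0, ?pow2_1, ?pow2_2, ?pow2_3, ?pow2_m1, ?pow2_m2, ?pow2_m3.

(** Proves x <> 0 from [nonpole z] by exhibiting k x = c (z + m). The ratios 1, 1/2 and 2 tried
    below suffice, since the hypotheses concern forms such as 2 d + n or 2 d - 2 b and the
    denominators are these or their halves and doubles. *)
Ltac nonzero_by H k c m :=
  lazymatch type of H with nonpole ?z =>
    simple refine (neq0_scale k c _ (z + NtoC m) _ (H m) _);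
    [| rewrite ?NtoC_S, ?NtoC_plus, ?NtoC_0; field]; apply RtoC_neq0; lra
  end.
Ltac nonzero_multiple H m :=
  first [ nonzero_by H (RtoC 1) (RtoC 1) m | nonzero_by H (RtoC 2) (RtoC 1) m
        | nonzero_by H (RtoC 1) (RtoC 2) m ].
(** A cheap filter before [field]: x can be a multiple of z + m only if both or neither involve
    b. *)
Ltac same_dep b x z :=
  lazymatch x with
  | context [b] => lazymatch z with context [b] => idtac end
  | _ => lazymatch z with context [b] => fail | _ => idtac end
  end.
(** The shifts follow the scaling: z = 2 d + n gets its second n from m = n, so as to match d + n; a
    z free of n, such as 2 d - 2 b, needs m = n + n to match d - b + n. *)
Ltac nonzero_linear b n :=
  try assumption;
  match goal with
  | |- RtoC _ <> RtoC 0 => apply RtoC_neq0; lra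
  | H : nonpole ?z |- ?x <> RtoC 0 =>
      same_dep b x z;
      lazymatch x with
      | context [NtoC n] =>
          lazymatch z with
          | context [NtoC n] =>
              first [ nonzero_multiple H n | nonzero_multiple H (S n)
                    | nonzero_multiple H (S (S n)) ]
          | RtoC 1 =>
              first [ nonzero_multiple H n | nonzero_multiple H (S n)
                    | nonzero_multiple H (S (S n)) ]
          | _ => first [ nonzero_multiple H (n + n)%nat | nonzero_multiple H (S (n + n))
              | nonzero_multiple H (S (S (n + n))) | nonzero_multiple H n
              | nonzero_multiple H (S n) ]
          end
      | _ => first [ nonzero_multiple H 0%nat | nonzero_multiple H 1%nat
                   | nonzero_multiple H 2%nat | nonzero_multiple H 3%nat ]
      end
  end.

(** Arguments of Pochhammer symbols agree only up to [field]. A common representative makes equal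
    symbols syntactically equal before [close_field] turns them into atoms. *)
Ltac normalize_Poch z :=
  repeat match goal with
  | |- context [Poch ?w ?m] =>
      lazymatch w with z => fail | _ => idtac end;
      replace (Poch w m) with (Poch z m) by (f_equal; field)
  end.
Ltac normalize_Pochs d b :=
  normalize_Poch d; normalize_Poch (d + 1 / 2); normalize_Poch (d + 1);
  normalize_Poch (d - b); normalize_Poch (d - b + 1 / 2); normalize_Poch (d - b + 1);
  normalize_Poch (d - b + 3 / 2);
  normalize_Poch (d - b + 2); normalize_Poch (d - b + 5 / 2); normalize_Poch (d - b + 3).

Lemma evaluated_0_0 : evaluated 0 0.
Proof.
  intros d b n (He & Hf & _).
  unfold dixon; change (ZtoC 0) with (RtoC 0) in *.
  replace (2 * d - 1 - 0) with (2 * d - 1) by ring.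
  replace (2 * d - b + 0) with (2 * d - b) in * by ring.
  rewrite (proj1 (dixon_sum_closed n d b He Hf)).
  unfold_value; unfold_small; normalize_Pochs d b; unfold NtoC; simpl (INR 0).
  field.
Qed.

Lemma evaluated_m1_0 : evaluated (-1) 0.
Proof.
  intros d b n (He & Hf & _).
  unfold dixon; change (ZtoC 0) with (RtoC 0) in *; change (ZtoC (-1)) with (RtoC (-1)).
  replace (2 * d - 1 - -1) with (2 * d) by ring.
  replace (2 * d - b + 0) with (2 * d - b) in * by ring.
  apply (Cmult_eq_reg_l 2); [apply RtoC_neq0; lra|].
  rewrite (proj2 (dixon_sum_closed n d b He Hf)).
  unfold_value; unfold_small; normalize_Pochs d b; unfold NtoC; simpl (INR 0).
  field.
Qed.

Ltac nonpole_by H k E :=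
  apply (nonpole_shift _ _ k H); rewrite E; reduce_Z; unfold ZtoC; rewrite ?NtoC_S; field.
Ltac nonpole_tac :=
  match goal with
  | H : nonpole _ |- nonpole _ =>
      first [ nonpole_by H 0%nat NtoC_0 | nonpole_by H 1%nat NtoC_1
            | nonpole_by H 2%nat NtoC_2 | nonpole_by H 3%nat NtoC_3 ]
  end.

Ltac regular_tac :=
  let k := fresh "k" in let k1 := fresh in let k2 := fresh in let E := fresh in
  match goal with
  | G : regular _ _ _ _ _ |- _ =>
    destruct G as (He & Hf & Hy & Hb & Hd);
    (* Here i is a numeral, so i < -1 is a computed comparison, proved by [eq_refl] when it is
       true. *)
    try specialize (Hd eq_refl);
    split; [nonpole_tac | split; [nonpole_tac | split; [nonpole_tac | split;
      [ intros k k1 k2 E; try lia;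
        first [ apply (Hb k); [lia | lia | exact E]
              | apply (Hb (S k)); [lia | lia | rewrite NtoC_S, <- E; ring ] ]
      | first [ intros _; nonpole_tac | intros E; exfalso; lia ] ]]]]
  end.

Ltac split_regular n G :=
  let H1 := fresh "Hone" in
  destruct G as (He & Hf & Hy & Hb & Hd);
  try specialize (Hd eq_refl);
  assert (H1 : nonpole 1) by
    (let m := fresh in intros m; rewrite Cplus_comm; apply NtoC_S_neq0);
  revert He Hf Hy; reduce_Z; unfold ZtoC; intros He Hf Hy.

Ltac b_neq b k E :=
  try match goal with Hb : forall k : nat, _ -> _ -> b <> NtoC k |- _ =>
    assert (b - NtoC k <> 0) by
      (let F := fresh in intros F; apply (Hb k); [lia | lia |];
       transitivity (b - NtoC k + NtoC k); [ring | rewrite F; ring])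
  end; rewrite ?E in *.
Ltac b_neq_small b :=
  b_neq b 1%nat NtoC_1; b_neq b 2%nat NtoC_2; b_neq b 3%nat NtoC_3; b_neq b 4%nat NtoC_4.

Ltac nonzero b n :=
  match goal with
  | |- RtoC _ <> RtoC 0 => apply RtoC_neq0; lra
  | H : ?x <> RtoC 0 |- _ <> RtoC 0 => exact H
  | H : ?x <> RtoC 0 |- _ <> RtoC 0 =>
      apply (neq0_scale 1 1 _ x); [apply C1_nz | exact H | ring]
  | _ => nonzero_linear b n
  end.

Ltac close_field d b n :=
  rewrite ?NtoC_S, ?NtoC_0;
  set (N := NtoC n) in *;
  repeat match goal with |- context [Poch ?z n] =>
    let p := fresh "P" in set (p := Poch z n) in * end;
  let q := fresh "q" in set (q := RtoC 4 ^ n) in *;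
  field; cbv beta; unfold N in *; repeat split; nonzero b n.

Ltac lift_Poch z d b n :=
  rewrite (Poch_up z n); [normalize_Pochs d b | nonzero_linear b n].

(** The sources have b - 1 in place of b. The parameter z is such that (d - b + z)_n is the symbol
    of the target missing from them; lifting it to (d - b + z + 1)_n makes it common to both
    sides. *)
Ltac step_b i j H1 H2 z :=
  let d := fresh "d" in let b := fresh "b" in let n := fresh "n" in
  let G := fresh "G" in let G1 := fresh "G" in let G2 := fresh "G" in
  let R := fresh "R" in
  intros d b n G;
  assert (G1 : regular i j d (b - 1) n) by regular_tac;
  assert (G2 : regular (i - 1) j d (b - 1) n) by regular_tac;
  pose proof (dixon_b i j d b n) as R;
  reduce_Z; revert G2; reduce_Z; intros G2;
  rewrite (H1 _ _ _ G1), (H2 _ _ _ G2) in R;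
  split_regular n G; b_neq_small b;
  apply (Cmult_eq_reg_l (b - 1)); [assumption|];
  rewrite R; clear R G1 G2;
  unfold_value; unfold_small; normalize_Pochs d b; lift_Poch (d - b + z) d b n;
  close_field d b n.

(** The sources, at d + 1/2, contain (d + 1/2)_n and (d + 1)_n, so only the (d)_n of the target has
    to be lifted. *)
Ltac step_e i j H1 H2 :=
  let d := fresh "d" in let b := fresh "b" in let n := fresh "n" in
  let G := fresh "G" in let G1 := fresh "G" in let G2 := fresh "G" in
  let R := fresh "R" in
  intros d b n G;
  assert (G1 : regular i j (d + 1 / 2) b n) by regular_tac;
  assert (G2 : regular (i - 1) j (d + 1 / 2) b n) by regular_tac;
  pose proof (dixon_e i j d b n (proj1 G) (proj1 (proj2 G))) as R;
  reduce_Z; revert G2; reduce_Z; intros G2;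
  rewrite (H1 _ _ _ G1), (H2 _ _ _ G2) in R;
  split_regular n G; b_neq_small b;
  apply (Cmult_eq_reg_l (2 * d + 2 * NtoC n)); [nonzero_linear b n|];
  rewrite R; clear R G1 G2;
  unfold_value; unfold_small; normalize_Pochs d b; lift_Poch d d b n;
  close_field d b n.

(** In [step_n] the sources are at d - 1/2 and n + 1. This symbol loses its first factor, to become
    (d + 1/2)_n; the others lose their last one. *)
Lemma Poch_half_S (z d : C) (n : nat) :
  z = d - 1 / 2 -> Poch z (S n) = (d - 1 / 2) * Poch (d + 1 / 2) n.
Proof. intros ->; rewrite Poch_Sl; do 2 f_equal; field. Qed.

Ltac expand_Poch_S d n :=
  repeat match goal with |- context [Poch ?z (S n)] =>
    first [ rewrite (Poch_half_S z d n) by field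
          | change (Poch z (S n)) with (Poch z n * (z + NtoC n)) ] end.

Ltac step_n i j H1 H2 :=
  let d := fresh "d" in let b := fresh "b" in let n := fresh "n" in
  let G := fresh "G" in let G1 := fresh "G" in let G2 := fresh "G" in
  let R := fresh "R" in
  intros d b n G;
  assert (G1 : regular i j (d - 1 / 2) b (S n)) by regular_tac;
  assert (G2 : regular (i - 1) j (d - 1 / 2) b (S n)) by regular_tac;
  pose proof (dixon_n i j d b n) as R;
  reduce_Z; revert G2; reduce_Z; intros G2;
  rewrite (H1 _ _ _ G1), (H2 _ _ _ G2) in R;
  split_regular n G; b_neq_small b;
  match type of R with ?c * _ = _ =>
    apply (Cmult_eq_reg_l c); [repeat apply Cmult_neq_0; unfold ZtoC; nonzero b n|] end;
  rewrite R; clear R G1 G2;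
  unfold_value; expand_Poch_S d n; unfold_small; normalize_Pochs d b;
  close_field d b n.

(** Serves to lower i at j = 0, whereas [dixon_e] has its target at j + 1. The division is by 2 d -
    1 - i, which is 2 d or 2 d + 1 for i = -1, -2: hence the last clause of [regular]. *)
Ltac step_a i j H1 H2 :=
  let d := fresh "d" in let b := fresh "b" in let n := fresh "n" in
  let G := fresh "G" in let G1 := fresh "G" in let G2 := fresh "G" in
  let R := fresh "R" in
  intros d b n G;
  assert (G1 : regular i j d b n) by regular_tac;
  assert (G2 : regular i (j + 1) d (b + 1) n) by regular_tac;
  pose proof (dixon_a i j d b n) as R;
  reduce_Z; revert G2; reduce_Z; intros G2;
  rewrite (H1 _ _ _ G1), (H2 _ _ _ G2) in R;
  split_regular n G; b_neq_small b;
  match type of R with ?c * _ = _ =>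
    apply (Cmult_eq_reg_l c); [unfold ZtoC; nonzero b n|] end;
  rewrite R; clear R G1 G2;
  unfold_value; unfold_small; normalize_Poch (d - b - 1 / 2); normalize_Pochs d b;
  lift_Poch (d - b - 1 / 2) d b n;
  close_field d b n.

(** * The tabulated pairs, each by one contiguous relation *)

Lemma evaluated_0_1 : evaluated 0 1.
Proof. step_b 0%Z 0%Z evaluated_0_0 evaluated_m1_0 (1 / 2). Qed.

Lemma evaluated_m1_1 : evaluated (-1)%Z 1.
Proof. step_e 0%Z 0%Z evaluated_0_0 evaluated_m1_0. Qed.

Lemma evaluated_0_2 : evaluated 0 2.
Proof. step_b 0%Z 1%Z evaluated_0_1 evaluated_m1_1 (1). Qed.

Lemma evaluated_m1_2 : evaluated (-1)%Z 2.
Proof. step_e 0%Z 1%Z evaluated_0_1 evaluated_m1_1. Qed.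

Lemma evaluated_0_3 : evaluated 0 3.
Proof. step_b 0%Z 2%Z evaluated_0_2 evaluated_m1_2 (3 / 2). Qed.

Lemma evaluated_m1_3 : evaluated (-1)%Z 3.
Proof. step_e 0%Z 2%Z evaluated_0_2 evaluated_m1_2. Qed.

Lemma evaluated_1_0 : evaluated 1 0.
Proof. step_n 0%Z 1%Z evaluated_0_1 evaluated_m1_1. Qed.

Lemma evaluated_1_1 : evaluated 1 1.
Proof. step_n 0%Z 2%Z evaluated_0_2 evaluated_m1_2. Qed.

Lemma evaluated_1_2 : evaluated 1 2.
Proof. step_n 0%Z (3)%Z evaluated_0_3 evaluated_m1_3. Qed.

Lemma evaluated_2_0 : evaluated 2 0.
Proof. step_n 1%Z 1%Z evaluated_1_1 evaluated_0_1. Qed.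

Lemma evaluated_2_1 : evaluated 2 1.
Proof. step_n 1%Z 2%Z evaluated_1_2 evaluated_0_2. Qed.

Lemma evaluated_3_0 : evaluated 3 0.
Proof. step_n 2%Z 1%Z evaluated_2_1 evaluated_1_1. Qed.

(** Through [step_n] this pair would require (1, 3), which is not tabulated. *)
Lemma evaluated_2_2 : evaluated 2 2.
Proof. step_b 2%Z 1%Z evaluated_2_1 evaluated_1_1 (1). Qed.

Lemma evaluated_m2_0 : evaluated (-2)%Z 0.
Proof. step_a (-1)%Z 0%Z evaluated_m1_0 evaluated_m1_1. Qed.

Lemma evaluated_m2_1 : evaluated (-2)%Z 1.
Proof. step_e (-1)%Z 0%Z evaluated_m1_0 evaluated_m2_0. Qed.

Lemma evaluated_m2_2 : evaluated (-2)%Z 2.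
Proof. step_e (-1)%Z 1%Z evaluated_m1_1 evaluated_m2_1. Qed.

Lemma evaluated_m2_3 : evaluated (-2)%Z 3.
Proof. step_e (-1)%Z 2%Z evaluated_m1_2 evaluated_m2_2. Qed.

Lemma evaluated_m3_0 : evaluated (-3)%Z 0.
Proof. step_a (-2)%Z 0%Z evaluated_m2_0 evaluated_m2_1. Qed.

Lemma evaluated_m3_1 : evaluated (-3)%Z 1.
Proof. step_e (-2)%Z 0%Z evaluated_m2_0 evaluated_m3_0. Qed.

Lemma evaluated_m3_2 : evaluated (-3)%Z 2.
Proof. step_e (-2)%Z 1%Z evaluated_m2_1 evaluated_m3_1. Qed.

Lemma evaluated_m3_3 : evaluated (-3)%Z 3.
Proof. step_e (-2)%Z 2%Z evaluated_m2_2 evaluated_m3_2. Qed.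

(** * Convergence in the complex plane *)

(** Componentwise, to match [CLim_seq] and [CSeries]; [Cvg_of_Cmod] and [Cvg_Cmod0] translate to
    convergence in modulus. *)
Definition Cvg (u : nat -> C) (l : C) : Prop :=
  is_lim_seq (fun n => Re (u n)) (Re l) /\ is_lim_seq (fun n => Im (u n)) (Im l).

Lemma C_ext (x y : C) : Re x = Re y -> Im x = Im y -> x = y.
Proof. destruct x, y; simpl; now intros -> ->. Qed.

Lemma Cvg_lim (u : nat -> C) (l : C) : Cvg u l -> CLim_seq u = l.
Proof.
  intros [H1 H2]; apply C_ext; unfold CLim_seq; cbn -[Lim_seq];
  rewrite (is_lim_seq_unique _ _ H1) || rewrite (is_lim_seq_unique _ _ H2); reflexivity.
Qed.

Lemma Cvg_ext (u v : nat -> C) (l : C) : (forall n, u n = v n) -> Cvg u l -> Cvg v l.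
Proof.
  intros E [H1 H2]; split;
  [eapply is_lim_seq_ext; [|exact H1] | eapply is_lim_seq_ext; [|exact H2]];
  intros n; cbv beta; now rewrite E.
Qed.

Lemma Cvg_unique (u : nat -> C) (l m : C) : Cvg u l -> Cvg u m -> l = m.
Proof. intros H1 H2; rewrite <- (Cvg_lim _ _ H1); now apply Cvg_lim. Qed.

Lemma Cvg_const (c : C) : Cvg (fun _ => c) c.
Proof. split; apply is_lim_seq_const. Qed.

Lemma Cvg_plus (u v : nat -> C) (l m : C) :
  Cvg u l -> Cvg v m -> Cvg (fun n => u n + v n) (l + m).
Proof. intros [H1 H2] [H3 H4]; split; now apply is_lim_seq_plus'. Qed.

Lemma Cvg_mult (u v : nat -> C) (l m : C) :
  Cvg u l -> Cvg v m -> Cvg (fun n => u n * v n) (l * m).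
Proof.
  intros [H1 H2] [H3 H4]; split.
  - apply is_lim_seq_minus'; now apply is_lim_seq_mult'.
  - apply is_lim_seq_plus'; now apply is_lim_seq_mult'.
Qed.

Lemma Cvg_scal (c : C) (u : nat -> C) (l : C) : Cvg u l -> Cvg (fun n => c * u n) (c * l).
Proof. apply Cvg_mult, Cvg_const. Qed.

Lemma Cvg_incr_n (u : nat -> C) (N : nat) (l : C) :
  Cvg u l <-> Cvg (fun n => u (n + N)%nat) l.
Proof.
  unfold Cvg; rewrite <- (is_lim_seq_incr_n (fun n => Re (u n)) N).
  rewrite <- (is_lim_seq_incr_n (fun n => Im (u n)) N); reflexivity.
Qed.

Lemma im_le_Cmod (c : C) : (Rabs (Im c) <= Cmod c)%R.
Proof. eapply Rle_trans; [apply Rmax_r | apply Rmax_Cmod]. Qed.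

Lemma Cmod_le_Rabs (c : C) : (Cmod c <= Rabs (Re c) + Rabs (Im c))%R.
Proof.
  replace c with (RtoC (Re c) + Ci * RtoC (Im c)) at 1
    by (apply C_ext; simpl; ring).
  eapply Rle_trans; [apply Cmod_triangle|].
  rewrite Cmod_mult, !Cmod_R.
  replace (Cmod Ci) with 1%R; [lra|].
  unfold Cmod, Ci; simpl; replace (0 * (0 * 1) + 1 * (1 * 1))%R with 1%R by ring.
  now rewrite sqrt_1.
Qed.

Lemma Cvg_of_Cmod (u : nat -> C) (l : C) :
  is_lim_seq (fun n => Cmod (u n - l)) 0 -> Cvg u l.
Proof.
  intros H.
  assert (Hm : is_lim_seq (fun n => - Cmod (u n - l))%R 0%R).
  { replace (Finite 0) with (Rbar_opp (Finite 0)) by (simpl; f_equal; ring).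
    now apply is_lim_seq_opp with (u := fun n => Cmod (u n - l)). }
  (* Here f stands for [Re] and [Im] at once. *)
  assert (G : forall (f : C -> R), (forall z, (Rabs (f z) <= Cmod z)%R) ->
    (forall x y : C, f (x - y)%C = (f x - f y)%R) -> is_lim_seq (fun n => f (u n)) (f l)).
  { intros f Hf Hs.
    apply is_lim_seq_ext with (fun n => (f (u n - l)%C + f l)%R).
    - intros n; rewrite Hs; ring.
    - replace (Finite (f l)) with (Finite (0 + f l)) by (f_equal; ring).
      apply is_lim_seq_plus'; [|apply is_lim_seq_const].
      apply is_lim_seq_le_le with (2 := Hm) (3 := H).
      intros n; specialize (Hf (u n - l)); apply Rabs_le_between in Hf; lra. }
  split; apply G.
  - apply re_le_Cmod.
  - intros [x1 x2] [y1 y2]; simpl; ring.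
  - apply im_le_Cmod.
  - intros [x1 x2] [y1 y2]; simpl; ring.
Qed.

Lemma Cvg_Cmod0 (u : nat -> C) (l : C) :
  Cvg u l -> is_lim_seq (fun n => Cmod (u n - l)) 0.
Proof.
  intros [H1 H2].
  apply is_lim_seq_le_le with (fun _ => 0%R)
    (fun n => Rabs (Re (u n) - Re l) + Rabs (Im (u n) - Im l))%R.
  - intros n; split; [apply Cmod_ge_0|].
    exact (Cmod_le_Rabs (u n - l)).
  - apply is_lim_seq_const.
  - replace (Finite 0) with (Finite (0 + 0)) by (f_equal; ring).
    assert (Z : forall (w : nat -> R) (m : R), is_lim_seq w m ->
      is_lim_seq (fun n => Rabs (w n - m)) 0%R).
    { intros w m Hw; rewrite <- Rabs_R0 at 1.
      apply (is_lim_seq_abs (fun n => (w n - m)%R) (Finite 0)).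
      replace (Finite 0) with (Finite (m - m)) by (f_equal; ring).
      apply is_lim_seq_minus'; [exact Hw | apply is_lim_seq_const]. }
    apply is_lim_seq_plus'; now apply Z.
Qed.

Lemma Cmod_triangle_rev (x y : C) : (Rabs (Cmod x - Cmod y) <= Cmod (x - y))%R.
Proof.
  apply Rabs_le_between; split.
  - assert (H := Cmod_triangle (- (x - y)) x); rewrite Cmod_opp in H.
    replace (- (x - y) + x) with y in H by ring; lra.
  - assert (H := Cmod_triangle (x - y) y).
    replace (x - y + y) with x in H by ring; lra.
Qed.

Lemma Cvg_Cmod (u : nat -> C) (l : C) :
  Cvg u l -> is_lim_seq (fun n => Cmod (u n)) (Cmod l).
Proof.
  intros H; apply Cvg_Cmod0 in H.
  apply is_lim_seq_ext with (fun n => (Cmod (u n) - Cmod l) + Cmod l)%R;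
    [intros n; ring|].
  replace (Finite (Cmod l)) with (Finite (0 + Cmod l)) by (f_equal; ring).
  apply is_lim_seq_plus'; [|apply is_lim_seq_const].
  apply is_lim_seq_abs_0.
  apply is_lim_seq_le_le with (fun _ => 0%R) (fun n => Cmod (u n - l)); auto.
  - intros n; split; [apply Rabs_pos | apply Cmod_triangle_rev].
  - apply is_lim_seq_const.
Qed.

Lemma Cvg_inv (u : nat -> C) (l : C) :
  l <> 0 -> (forall n, u n <> 0) -> Cvg u l -> Cvg (fun n => / u n) (/ l).
Proof.
  intros Hl Hu H; apply Cvg_of_Cmod.
  apply is_lim_seq_ext with (fun n => (Cmod (u n - l)%C * / (Cmod (u n) * Cmod l))%R).
  - intros n; rewrite <- Cmod_mult, <- Cmod_inv, <- Cmod_mult 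
      by now apply Cmod_neq_0 || (apply Cmult_neq_0; auto).
    rewrite <- Cmod_opp; f_equal; field; auto.
  - replace (Finite 0) with (Finite (0 * / (Cmod l * Cmod l))) by (f_equal; ring).
    pose proof (Cmod_gt_0 l) as [Hp _]; specialize (Hp Hl).
    apply is_lim_seq_mult'; [now apply Cvg_Cmod0|].
    apply (is_lim_seq_inv (fun n => Cmod (u n) * Cmod l)%R (Finite (Cmod l * Cmod l))).
    + apply is_lim_seq_mult'; [now apply Cvg_Cmod | apply is_lim_seq_const].
    + intros E; injection E as E; nra.
Qed.

Lemma Re_sum_n (a : nat -> C) (n : nat) : Re (sum_n a n) = sum_n (fun k => Re (a k)) n.
Proof.
  induction n as [|n IH]; [now rewrite !sum_O|].
  now rewrite !sum_Sn, <- IH.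
Qed.

Lemma Im_sum_n (a : nat -> C) (n : nat) : Im (sum_n a n) = sum_n (fun k => Im (a k)) n.
Proof.
  induction n as [|n IH]; [now rewrite !sum_O|].
  now rewrite !sum_Sn, <- IH.
Qed.

Definition is_Cser (a : nat -> C) (l : C) : Prop := Cvg (sum_n a) l.

Lemma is_Cser_unique (a : nat -> C) (l : C) : is_Cser a l -> CSeries a = l.
Proof.
  intros [H1 H2]; apply C_ext; unfold CSeries; cbn -[Series]; apply is_series_unique.
  - change (is_lim_seq (sum_n (fun n => Re (a n))) (Re l)).
    eapply is_lim_seq_ext; [|exact H1]; intros n; apply (Re_sum_n a n).
  - change (is_lim_seq (sum_n (fun n => Im (a n))) (Im l)).
    eapply is_lim_seq_ext; [|exact H2]; intros n; apply (Im_sum_n a n).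
Qed.

Lemma is_Cser_ex (a : nat -> C) (l : C) : is_Cser a l -> ex_Cseries a.
Proof.
  intros H; exists l; unfold is_series.
  apply filterlim_locally_ball_norm; intros eps.
  apply Cvg_Cmod0 in H; apply is_lim_seq_spec in H.
  destruct (H eps) as [N HN]; exists N; intros n Hn; specialize (HN n Hn).
  rewrite Rminus_0_r, Rabs_pos_eq in HN by apply Cmod_ge_0.
  exact HN.
Qed.

Lemma is_Cser_of_Cmod (a : nat -> C) :
  ex_series (fun n => Cmod (a n)) -> is_Cser a (CSeries a).
Proof.
  intros H.
  assert (G : forall f : C -> R, (forall z, (Rabs (f z) <= Cmod z)%R) ->
    is_lim_seq (sum_n (fun n => f (a n))) (Series (fun n => f (a n)))).
  { intros f Hf; apply Series_correct, ex_series_Rabs.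
    apply (@ex_series_le R_AbsRing R_CompleteNormedModule _ (fun n => Cmod (a n))); auto.
    intros n; unfold norm; simpl; unfold abs; simpl; rewrite Rabs_Rabsolu; apply Hf. }
  split; cbn -[Series].
  - eapply is_lim_seq_ext; [|apply (G Re re_le_Cmod)].
    intros n; symmetry; apply (Re_sum_n a n).
  - eapply is_lim_seq_ext; [|apply (G Im im_le_Cmod)].
    intros n; symmetry; apply (Im_sum_n a n).
Qed.

Lemma Cmod_sum_n (a : nat -> C) (n : nat) :
  (Cmod (sum_n a n) <= sum_n (fun k => Cmod (a k)) n)%R.
Proof.
  induction n as [|n IH]; [rewrite !sum_O; lra|].
  rewrite !sum_Sn; eapply Rle_trans; [apply Cmod_triangle|].
  apply Rplus_le_compat_r, IH.
Qed.

Lemma is_Cser_Cmod_le (a : nat -> C) (b : nat -> R) (l : C) :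
  is_Cser a l -> (forall n, (Cmod (a n) <= b n)%R) -> ex_series b ->
  (Cmod l <= Series b)%R.
Proof.
  intros Ha Hb Eb.
  apply (is_lim_seq_le (fun n => Cmod (sum_n a n)) (sum_n b) (Cmod l) (Series b)).
  - intros n; eapply Rle_trans; [apply Cmod_sum_n|].
    apply sum_n_m_le; auto.
  - now apply Cvg_Cmod.
  - now apply Series_correct.
Qed.

Lemma is_Cser_ext (a b : nat -> C) (l : C) :
  (forall n, a n = b n) -> is_Cser a l -> is_Cser b l.
Proof.
  intros E; apply Cvg_ext; intros n; apply sum_n_ext; exact E.
Qed.

Lemma is_Cser_scal (c : C) (a : nat -> C) (l : C) :
  is_Cser a l -> is_Cser (fun n => c * a n) (c * l).
Proof.
  intros H; apply Cvg_ext with (fun n => c * sum_n a n); [|now apply Cvg_scal].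
  intros n; symmetry; exact (sum_n_mult_l (K := C_Ring) c a n).
Qed.

Lemma is_Cser_plus (a b : nat -> C) (l m : C) :
  is_Cser a l -> is_Cser b m -> is_Cser (fun n => a n + b n) (l + m).
Proof.
  intros H1 H2; apply Cvg_ext with (fun n => sum_n a n + sum_n b n); [|now apply Cvg_plus].
  intros n; symmetry; exact (sum_n_plus a b n).
Qed.

(** * The Gamma function *)

Lemma Cexp_plus (a b : C) : Cexp (a + b) = Cexp a * Cexp b.
Proof.
  destruct a as [a1 a2], b as [b1 b2]; unfold Cexp; simpl.
  rewrite exp_plus, cos_plus, sin_plus; apply C_ext; simpl; ring.
Qed.

Lemma Cexp_0 : Cexp 0 = 1.
Proof. unfold Cexp; simpl; rewrite exp_0, cos_0, sin_0; apply C_ext; simpl; ring. Qed.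

Lemma Cexp_opp_r (a : C) : Cexp a * Cexp (- a) = 1.
Proof. rewrite <- Cexp_plus, Cplus_opp_r; apply Cexp_0. Qed.

Lemma Cexp_neq0 (a : C) : Cexp a <> 0.
Proof.
  intros E; generalize (Cexp_opp_r a); rewrite E, Cmult_0_l; intros H.
  symmetry in H; now apply C1_nz.
Qed.

Lemma Cexp_opp (a : C) : Cexp (- a) = / Cexp a.
Proof.
  generalize (Cexp_opp_r a); intros H.
  transitivity (/ Cexp a * (Cexp a * Cexp (- a))); [field; apply Cexp_neq0|].
  rewrite H; ring.
Qed.

Lemma Cpower_NtoC (m : nat) (z : C) :
  (0 < m)%nat -> Cpower (NtoC m) z = Cexp (z * RtoC (ln (INR m))).
Proof.
  intros Hm; apply lt_INR in Hm; simpl in Hm.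
  unfold Cpower, Clog; do 2 f_equal.
  unfold NtoC; rewrite Cmod_R, Rabs_pos_eq by lra.
  unfold Carg, RtoC; simpl; f_equal.
  destruct (Rle_dec 0 0) as [_|H]; [|lra].
  change (INR m, 0%R) with (RtoC (INR m)).
  rewrite Cmod_R, Rabs_pos_eq by lra.
  replace (INR m / INR m)%R with 1%R by (field; lra).
  apply acos_1.
Qed.

(** * Elementary estimates and infinite products *)

Open Scope R_scope.

(** The inequality exp x >= 1 + x, at x and at - x, gives 1 + x <= exp x <= 1 / (1 - x), and the
    right end is at most 1 + x + 2 x^2 for |x| <= 1/2. *)
Lemma exp_taylor1 (x : R) : Rabs x <= 1 / 2 -> Rabs (exp x - 1 - x) <= 2 * x ^ 2.
Proof.
  intros H; apply Rabs_le_between in H.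
  assert (H1 := exp_ineq1_le x); assert (H2 := exp_ineq1_le (- x)).
  rewrite exp_Ropp in H2.
  assert (H3 : exp x <= / (1 - x)).
  { rewrite <- (Rinv_inv (exp x)); apply Rinv_le_contravar; lra. }
  assert (H4 : / (1 - x) <= 1 + x + 2 * x ^ 2).
  { apply Rmult_le_reg_l with (1 - x); [lra|]; rewrite Rinv_r by lra; nra. }
  apply Rabs_le_between; nra.
Qed.

Lemma sin_abs_le (y : R) : Rabs (sin y) <= Rabs y.
Proof.
  destruct (MVT_gen sin 0 y cos) as [c [_ Hc]].
  - intros x _; apply is_derive_Reals, derivable_pt_lim_sin.
  - intros x _; apply continuity_sin.
  - rewrite sin_0, !Rminus_0_r in Hc; rewrite Hc, Rabs_mult.
    assert (Rabs (cos c) <= 1) by (apply Rabs_le; pose proof (COS_bound c); lra).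
    pose proof (Rabs_pos y); nra.
Qed.

Lemma cos_taylor1 (y : R) : Rabs (cos y - 1) <= y ^ 2 / 2.
Proof.
  assert (E : cos y = 1 - 2 * sin (y / 2) * sin (y / 2)).
  { replace y with (2 * (y / 2)) at 1 by field; apply cos_2a_sin. }
  assert (H := sin_abs_le (y / 2)).
  apply Rsqr_le_abs_1 in H; unfold Rsqr in H.
  rewrite E; apply Rabs_le_between; nra.
Qed.

Lemma sin_taylor1 (y : R) : Rabs y <= 1 -> Rabs (sin y - y) <= y ^ 2.
Proof.
  intros Hy.
  destruct (MVT_gen (fun t => sin t - t) 0 y (fun t => cos t - 1)) as [c [Hc1 Hc]].
  - intros x _; auto_derive; [trivial | ring].
  - intros x _; apply (continuity_pt_minus sin (fun t => t)).
    + apply continuity_sin.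
    + apply continuity_pt_id.
  - rewrite sin_0, !Rminus_0_r in Hc; rewrite Hc, Rabs_mult.
    assert (Hcy : Rabs c <= Rabs y).
    { destruct (Rle_dec 0 y); [rewrite Rmin_left, Rmax_right in Hc1 by lra
                              | rewrite Rmin_right, Rmax_left in Hc1 by lra];
      [rewrite !Rabs_pos_eq | rewrite !Rabs_left1]; lra. }
    assert (H := cos_taylor1 c).
    pose proof (Rabs_pos c); pose proof (Rabs_pos y).
    rewrite <- (pow2_abs c) in H; rewrite <- (pow2_abs y).
    nra.
Qed.

(** The constant is generous: the five error terms [F1] to [F5] add up to 7 m^2. *)
Lemma Cexp_taylor1 (w : C) :
  Cmod w <= 1 / 2 -> Cmod (Cexp w - 1 - w)%C <= 10 * Cmod w ^ 2.
Proof.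
  intros H; destruct w as [x y].
  assert (Hx : Rabs x <= Cmod (x, y)) by exact (re_le_Cmod (x, y)).
  assert (Hy : Rabs y <= Cmod (x, y)) by exact (im_le_Cmod (x, y)).
  set (m := Cmod (x, y)) in *.
  eapply Rle_trans; [apply Cmod_le_Rabs|].
  unfold Cexp; simpl.
  replace (exp x * cos y + - (1) + - x)
    with ((exp x - 1 - x) + exp x * (cos y - 1)) by ring.
  replace (exp x * sin y + - 0 + - y)
    with ((exp x - 1 - x) * sin y + (sin y - y) + x * sin y) by ring.
  pose proof (exp_taylor1 x ltac:(lra)) as E1.
  pose proof (cos_taylor1 y) as E2.
  pose proof (sin_taylor1 y ltac:(lra)) as E3.
  pose proof (sin_abs_le y) as E4.
  rewrite <- (pow2_abs x) in E1; rewrite <- (pow2_abs y) in E2, E3.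
  pose proof (Rabs_pos x); pose proof (Rabs_pos y).
  assert (E5 : exp x <= 2).
  { apply Rabs_le_between in E1; assert (Rabs x <= 1/2) by lra.
    assert (x <= Rabs x) by apply Rle_abs.
    assert (Rabs x ^ 2 <= 1 / 4) by nra; lra. }
  pose proof (exp_pos x).
  assert (M1 : Rabs x ^ 2 <= m ^ 2) by (apply pow_incr; lra).
  assert (M2 : Rabs y ^ 2 <= m ^ 2) by (apply pow_incr; lra).
  assert (F1 : Rabs (exp x - 1 - x) <= 2 * m ^ 2) by lra.
  assert (F2 : Rabs (exp x * (cos y - 1)) <= m ^ 2).
  { rewrite Rabs_mult, (Rabs_pos_eq (exp x)) by lra.
    pose proof (Rabs_pos (cos y - 1)); nra. }
  assert (F3 : Rabs (sin y - y) <= m ^ 2) by lra.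
  assert (F4 : Rabs (x * sin y) <= m ^ 2).
  { rewrite Rabs_mult; pose proof (Rabs_pos (sin y)); nra. }
  assert (F5 : Rabs ((exp x - 1 - x) * sin y) <= 2 * m ^ 2).
  { rewrite Rabs_mult; pose proof (Rabs_pos (sin y)).
    pose proof (Rabs_pos (exp x - 1 - x)); nra. }
  pose proof (Rabs_triang (exp x - 1 - x) (exp x * (cos y - 1))).
  pose proof (Rabs_triang ((exp x - 1 - x) * sin y + (sin y - y)) (x * sin y)).
  pose proof (Rabs_triang ((exp x - 1 - x) * sin y) (sin y - y)).
  pose proof (pow2_ge_0 m).
  replace (m * (m * 1)) with (m ^ 2) by ring; lra.
Qed.

(** Both bounds are ln t <= t - 1, at t = (n + 1) / n and at its inverse. *)
Lemma ln_ratio_bounds (n : nat) :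
  (0 < n)%nat ->
  / (INR n + 1) <= ln ((INR n + 1) / INR n) <= / INR n.
Proof.
  intros Hn; apply lt_INR in Hn; simpl in Hn.
  assert (G : forall t, 0 < t -> ln t <= t - 1).
  { intros t Ht; assert (H := exp_ineq1_le (ln t)); rewrite exp_ln in H; lra. }
  split.
  - assert (H := G (INR n / (INR n + 1)) ltac:(apply Rdiv_lt_0_compat; lra)).
    replace (INR n / (INR n + 1)) with (/ ((INR n + 1) / INR n)) in H by (field; lra).
    rewrite ln_Rinv in H by (apply Rdiv_lt_0_compat; lra).
    replace (/ ((INR n + 1) / INR n) - 1) with (- / (INR n + 1)) in H by (field; lra).
    lra.
  - replace (/ INR n) with ((INR n + 1) / INR n - 1) by (field; lra).
    apply G, Rdiv_lt_0_compat; lra.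
Qed.

(** Comparison with the telescoping 1 / (n + 1) - 1 / (n + 2), which dominates only after the index
    is shifted by one. *)
Lemma ex_series_inv_sqr : ex_series (fun n => / (INR n + 1) ^ 2).
Proof.
  apply ex_series_ext with (fun n => Rabs (/ (INR n + 1) ^ 2)).
  { intros n; apply Rabs_pos_eq, Rlt_le, Rinv_0_lt_compat, pow_lt; pose proof (pos_INR n); lra. }
  apply (ex_series_incr_1 (fun n => Rabs (/ (INR n + 1) ^ 2))).
  apply (@ex_series_le R_AbsRing R_CompleteNormedModule _
    (fun n => / (INR n + 1) - / (INR n + 1 + 1))).
  - intros n; unfold norm; simpl; unfold abs; simpl.
    rewrite Rabs_Rabsolu, Rabs_pos_eq.
    + change (match n with O => 1 | S _ => INR n + 1 end) with (INR (S n)).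
      rewrite S_INR; pose proof (pos_INR n) as Hn; rewrite Rmult_1_r.
      replace (/ (INR n + 1) - / (INR n + 1 + 1)) with (/ ((INR n + 1) * (INR n + 1 + 1)))
        by (field; lra).
      apply Rinv_le_contravar; nra.
    + change (match n with O => 1 | S _ => INR n + 1 end) with (INR (S n)).
      pose proof (pos_INR (S n)).
      apply Rlt_le, Rinv_0_lt_compat; nra.
  - exists (1 - 0)%R.
    change (is_lim_seq (sum_n (fun n => / (INR n + 1) - / (INR n + 1 + 1))) (1 - 0)).
    apply is_lim_seq_ext with (fun n => 1 - / (INR n + 1 + 1)).
    + intros n; induction n as [|n IH].
      * rewrite sum_O; simpl; field.
      * rewrite sum_Sn, <- IH; unfold plus; simpl.
        change (match n with O => 1 | S _ => INR n + 1 end) with (INR (S n)).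
        rewrite S_INR; pose proof (pos_INR n); field; lra.
    + apply is_lim_seq_minus'; [apply is_lim_seq_const|].
      apply is_lim_seq_ext with (fun n => / INR (n + 2)).
      { intros n; rewrite plus_INR; simpl; f_equal; ring. }
      apply (is_lim_seq_incr_n (fun n => / INR n) 2).
      apply is_lim_seq_inv with (1 := is_lim_seq_INR); discriminate.
Qed.

Lemma sum_n_ge0 (e : nat -> R) (n : nat) : (forall k, 0 <= e k) -> 0 <= sum_n e n.
Proof.
  intros H; induction n as [|n IH]; [now rewrite sum_O|].
  rewrite sum_Sn; now apply Rplus_le_le_0_compat.
Qed.

Lemma sum_n_le_Series (e : nat -> R) (n : nat) :
  (forall k, 0 <= e k) -> ex_series e -> sum_n e n <= Series e.
Proof.
  intros H0 He.
  apply (is_lim_seq_incr_compare (sum_n e) (Series e)).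
  - now apply Series_correct.
  - intros k; rewrite sum_Sn; specialize (H0 (S k)); unfold plus; simpl; lra.
Qed.

Lemma exp_mono (x y : R) : x <= y -> exp x <= exp y.
Proof. intros [H| ->]; [now apply Rlt_le, exp_increasing | lra]. Qed.

(** As 1 + e <= exp e, the modulus of u stays below |u 0| exp (sum e). The increments u n * eps n
    are then absolutely summable, and u is u 0 plus their partial sums. *)
Lemma infinite_product (u eps : nat -> C) (e : nat -> R) :
  (forall n, u (S n) = u n * (1 + eps n))%C ->
  (forall n, Cmod (eps n) <= e n) -> ex_series e ->
  exists l : C, Cvg u l.
Proof.
  intros Hu He Es.
  assert (E0 : forall n, 0 <= e n).
  { intros n; eapply Rle_trans; [apply Cmod_ge_0 | apply He]. }
  set (B := Cmod (u 0%nat) * exp (Series e)).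
  assert (HB : forall n, Cmod (u n) <= B).
  { intros [|n].
    - unfold B; rewrite <- (Rmult_1_r (Cmod (u 0%nat))) at 1.
      apply Rmult_le_compat_l; [apply Cmod_ge_0|].
      rewrite <- exp_0; apply exp_mono.
      apply Rle_trans with (sum_n e 0); [now apply sum_n_ge0 | now apply sum_n_le_Series].
    - apply Rle_trans with (Cmod (u 0%nat) * exp (sum_n e n)).
      + induction n as [|n IH].
        * rewrite sum_O, Hu, Cmod_mult; apply Rmult_le_compat_l; [apply Cmod_ge_0|].
          eapply Rle_trans; [apply Cmod_triangle|]; rewrite Cmod_1.
          eapply Rle_trans; [|apply exp_ineq1_le]; specialize (He 0%nat); lra.
        * rewrite sum_Sn, Hu, Cmod_mult; unfold plus; simpl; rewrite exp_plus, <- Rmult_assoc.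
          apply Rmult_le_compat; try apply Cmod_ge_0; auto.
          eapply Rle_trans; [apply Cmod_triangle|]; rewrite Cmod_1.
          eapply Rle_trans; [|apply exp_ineq1_le]; specialize (He (S n)); lra.
      + apply Rmult_le_compat_l; [apply Cmod_ge_0|].
        apply exp_mono, sum_n_le_Series; auto. }
  assert (Hc : is_Cser (fun n => u n * eps n)%C (CSeries (fun n => u n * eps n)%C)).
  { apply is_Cser_of_Cmod.
    apply (@ex_series_le R_AbsRing R_CompleteNormedModule _ (fun n => B * e n)).
    - intros n; unfold norm; simpl; unfold abs; simpl.
      rewrite Rabs_pos_eq by apply Cmod_ge_0; rewrite Cmod_mult.
      apply Rmult_le_compat; auto using Cmod_ge_0.
    - now apply (ex_series_scal B e). }
  exists (u 0%nat + CSeries (fun n => u n * eps n))%C.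
  apply (Cvg_incr_n u 1).
  apply Cvg_ext with (fun n => u 0%nat + sum_n (fun n => u n * eps n) n)%C.
  - intros n; cbv beta; rewrite Nat.add_1_r; induction n as [|n IH].
    + rewrite sum_O, Hu; ring.
    + rewrite sum_Sn, (Hu (S n)); change plus with Cplus.
      rewrite Cplus_assoc, IH; ring.
  - apply Cvg_plus; [apply Cvg_const | exact Hc].
Qed.

Lemma Cmod_1_plus_ge (w : C) : Cmod w <= 1 / 2 -> 1 / 2 <= Cmod (1 + w)%C.
Proof.
  intros H; assert (T := Cmod_triangle_rev 1 (- w)).
  replace (1 - - w)%C with (1 + w)%C in T by ring.
  rewrite Cmod_1, Cmod_opp in T; apply Rabs_le_between in T; lra.
Qed.

(** The reciprocals of u form a product of the same kind, with factors 1 - eps / (1 + eps) and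
    bounds 2 e because |1 + eps| >= 1/2. Both limits exist and their product is 1. *)
Lemma infinite_product_neq0 (u eps : nat -> C) (e : nat -> R) :
  (forall n, u (S n) = u n * (1 + eps n))%C -> u 0%nat <> 0%C ->
  (forall n, Cmod (eps n) <= e n) -> (forall n, e n <= 1 / 2) -> ex_series e ->
  exists l : C, l <> RtoC 0 /\ Cvg u l.
Proof.
  intros Hu U0 He E2 Es.
  assert (N1 : forall n, (1 + eps n <> 0)%C).
  { intros n E; assert (H := Cmod_1_plus_ge (eps n) (Rle_trans _ _ _ (He n) (E2 n))).
    rewrite E, Cmod_0 in H; lra. }
  assert (Un : forall n, u n <> 0%C).
  { induction n as [|n IH]; [exact U0 | rewrite Hu; now apply Cmult_neq_0]. }
  destruct (infinite_product u eps e Hu He Es) as [l Hl].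
  destruct (infinite_product (fun n => / u n)%C (fun n => - eps n / (1 + eps n))%C
    (fun n => 2 * e n)) as [m Hm].
  - intros n; rewrite Hu; field; auto.
  - intros n; rewrite Cmod_div, Cmod_opp by auto.
    assert (H := Cmod_1_plus_ge (eps n) (Rle_trans _ _ _ (He n) (E2 n))).
    specialize (He n); apply Rmult_le_reg_r with (Cmod (1 + eps n)); [lra|].
    unfold Rdiv; rewrite Rmult_assoc, Rinv_l by lra.
    pose proof (Cmod_ge_0 (eps n)); nra.
  - now apply (ex_series_scal 2 e).
  - exists l; split; [|exact Hl]; intros ->.
    assert (H := Cvg_mult _ _ _ _ Hl Hm).
    apply (Cvg_ext _ (fun _ => RtoC 1)) in H.
    + apply C1_nz; rewrite (Cvg_unique _ _ _ (Cvg_const 1) H); ring.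
    + intros n; field; auto.
Qed.

(** * Convergence of Gauss's limit and the functional equation *)

Open Scope C_scope.

Definition Gseq (z : C) (n : nat) : C :=
  NtoC (fact n) * Cpower (NtoC n) z / Poch z (S n).

Lemma Cinv_neq0 (z : C) : z <> 0 -> / z <> 0.
Proof. intros H E; apply C1_nz; rewrite <- (Cinv_r _ H), E; ring. Qed.

(** For the reciprocals the quotient of neighbours is (1 + z / (n + 1)) ((n + 1) / n)^(-z), a factor
    of the product for 1 / Gamma that differs from 1 by O(1 / n^2). *)
Lemma Gseq_inv_S (z : C) (n : nat) :
  nonpole z -> (0 < n)%nat ->
  / Gseq z (S n) = / Gseq z n
    * ((1 + z / (NtoC n + 1)) * Cexp (- (z * RtoC (ln ((INR n + 1) / INR n))))).
Proof.
  intros Hz Hn; unfold Gseq.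
  assert (Hp := nonpole_Poch z n Hz); assert (H1 := Hz n); assert (H2 := Hz (S n)).
  assert (Hf := NtoC_fact_neq0 n); assert (HS := NtoC_S_neq0 n).
  rewrite !Cpower_NtoC by lia.
  assert (Hn' := lt_INR _ _ Hn); simpl in Hn'.
  rewrite S_INR.
  replace (ln ((INR n + 1) / INR n)) with (ln (INR n + 1) - ln (INR n))%R
    by (rewrite ln_div by lra; reflexivity).
  rewrite RtoC_minus.
  replace (- (z * (RtoC (ln (INR n + 1)) - RtoC (ln (INR n)))))
    with (- (z * RtoC (ln (INR n + 1))) + z * RtoC (ln (INR n))) by ring.
  rewrite Cexp_plus, Cexp_opp, NtoC_fact_S.
  assert (E1 := Cexp_neq0 (z * RtoC (ln (INR n + 1)))).
  assert (E2 := Cexp_neq0 (z * RtoC (ln (INR n)))).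
  simpl (Poch z _); rewrite NtoC_S in *.
  field; repeat split; auto.
Qed.

Lemma Gseq_factor_bound (z : C) (n : nat) :
  (0 < n)%nat -> (2 * (Cmod z + 1) <= INR n)%R ->
  (Cmod ((1 + z / (NtoC n + 1)) * Cexp (- (z * RtoC (ln ((INR n + 1) / INR n)))) - 1)
   <= 18 * (Cmod z + 1) ^ 2 * / INR n ^ 2)%R.
Proof.
  intros Hn Hbig; assert (Hn' := lt_INR _ _ Hn); simpl in Hn'.
  assert (HL := ln_ratio_bounds n Hn).
  set (L := ln ((INR n + 1) / INR n)) in *.
  set (t := (/ INR n)%R) in *.
  assert (Ht : (0 < t)%R) by now apply Rinv_0_lt_compat.
  set (h := (/ (INR n + 1))%R) in *.
  assert (Hh : (0 < h)%R) by (apply Rinv_0_lt_compat; lra).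
  assert (Hth : (t - h <= t ^ 2)%R).
  { unfold t, h; replace (/ INR n - / (INR n + 1))%R with (/ (INR n * (INR n + 1)))%R
      by (field; lra).
    rewrite pow_inv; apply Rinv_le_contravar; nra. }
  set (m := Cmod z) in *; assert (Hm : (0 <= m)%R) by apply Cmod_ge_0.
  assert (Hmt : ((m + 1) * t <= 1 / 2)%R).
  { apply Rmult_le_reg_r with (INR n); [lra|]; unfold t.
    rewrite Rmult_assoc, Rinv_l by lra; lra. }
  replace (z / (NtoC n + 1)) with (z * RtoC h)
    by (unfold h, NtoC; rewrite RtoC_inv, RtoC_plus by lra; reflexivity).
  set (w := - (z * RtoC L)).
  assert (Hw : (Cmod w <= m * t)%R).
  { unfold w; rewrite Cmod_opp, Cmod_mult, Cmod_R, Rabs_pos_eq by lra.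
    apply Rmult_le_compat_l; lra. }
  assert (HR := Cexp_taylor1 w ltac:(nra)).
  set (Rm := Cexp w - 1 - w) in *.
  (* The first-order parts combine into z (h - L), of order 1 / n^2 because L lies between h and t;
     the other two summands are of second order by themselves. The bounds [B1], [B2], [B3] add up to
     17 (m + 1)^2 t^2. *)
  replace ((1 + z * RtoC h) * Cexp w - 1)
    with (z * RtoC (h - L) + z * RtoC h * w + (1 + z * RtoC h) * Rm)
    by (unfold Rm, w; rewrite RtoC_minus; ring).
  eapply Rle_trans; [apply Cmod_triangle|].
  eapply Rle_trans; [apply Rplus_le_compat_r, Cmod_triangle|].
  rewrite !Cmod_mult, !Cmod_R, (Rabs_left1 (h - L)), (Rabs_pos_eq h) by lra.
  fold m; rewrite <- pow_inv; fold t.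
  assert (A1 : (Cmod (1 + z * RtoC h) <= 3 / 2)%R).
  { eapply Rle_trans; [apply Cmod_triangle|].
    rewrite Cmod_1, Cmod_mult, Cmod_R, Rabs_pos_eq by lra; fold m; nra. }
  assert (A2 : (Cmod Rm <= 10 * ((m + 1) * t) ^ 2)%R).
  { eapply Rle_trans; [exact HR|].
    apply Rmult_le_compat_l; [lra|]; apply pow_incr; split; [apply Cmod_ge_0|]; nra. }
  assert (B1 : (m * - (h - L) <= (m + 1) ^ 2 * t ^ 2)%R).
  { apply Rle_trans with ((m + 1) ^ 2 * (t - h))%R; [|apply Rmult_le_compat_l; nra].
    apply Rmult_le_compat; nra. }
  assert (B2 : (m * h * Cmod w <= (m + 1) ^ 2 * t ^ 2)%R).
  { replace ((m + 1) ^ 2 * t ^ 2)%R with (((m + 1) * t) * ((m + 1) * t))%R by ring.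
    pose proof (Cmod_ge_0 w); apply Rmult_le_compat; nra. }
  assert (B3 : (Cmod (1 + z * RtoC h) * Cmod Rm <= 15 * (m + 1) ^ 2 * t ^ 2)%R).
  { replace (15 * (m + 1) ^ 2 * t ^ 2)%R with (3 / 2 * (10 * ((m + 1) * t) ^ 2))%R by field.
    apply Rmult_le_compat; auto using Cmod_ge_0. }
  assert (0 <= (m + 1) ^ 2 * t ^ 2)%R by (apply Rmult_le_pos; apply pow2_ge_0).
  lra.
Qed.

Lemma Gseq_neq0 (z : C) (n : nat) : nonpole z -> (0 < n)%nat -> Gseq z n <> 0.
Proof.
  intros Hz Hn; unfold Gseq, Cdiv; rewrite Cpower_NtoC by lia.
  repeat apply Cmult_neq_0; [apply NtoC_fact_neq0 | apply Cexp_neq0 |].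
  now apply Cinv_neq0, nonpole_Poch.
Qed.

Lemma Gseq_cvg (z : C) : nonpole z -> exists l : C, l <> 0 /\ Cvg (Gseq z) l.
Proof.
  intros Hz.
  (* From N >= M follow both 2 (|z| + 1) <= N, for [Gseq_factor_bound], and 18 (|z| + 1)^2 / N^2 <=
     1/2, for [infinite_product_neq0]. *)
  set (M := (36 * (Cmod z + 1) ^ 2 + 2)%R).
  destruct (nfloor_ex M) as [N0 [_ HN]].
  { unfold M; pose proof (pow2_ge_0 (Cmod z + 1)); lra. }
  set (N := S N0).
  assert (HM : (M <= INR N)%R) by (unfold N; rewrite S_INR; lra).
  pose proof (Cmod_ge_0 z) as Hm.
  destruct (infinite_product_neq0 (fun n => / Gseq z (n + N))
    (fun n => (1 + z / (NtoC (n + N) + 1))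
       * Cexp (- (z * RtoC (ln ((INR (n + N) + 1) / INR (n + N))))) - 1)
    (fun n => (18 * (Cmod z + 1) ^ 2 * / INR (n + N) ^ 2)%R)) as [l [Hl Hc]].
  - intros n; cbv beta; rewrite Nat.add_succ_l, Gseq_inv_S by (auto; unfold N; lia).
    f_equal; ring.
  - apply Cinv_neq0, Gseq_neq0; [exact Hz | unfold N; lia].
  - intros n; apply Gseq_factor_bound; [unfold N; lia|].
    rewrite plus_INR; pose proof (pos_INR n); unfold M in HM; nra.
  - intros n; rewrite plus_INR; pose proof (pos_INR n).
    set (q := INR N) in *; unfold M in HM.
    assert (1 <= q)%R by nra.
    apply Rmult_le_reg_r with ((INR n + q) ^ 2)%R; [nra|].
    rewrite Rmult_assoc, Rinv_l by nra.
    assert (q <= (INR n + q) ^ 2)%R by nra; lra.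
  - apply (ex_series_scal (18 * (Cmod z + 1) ^ 2)%R (fun n => (/ INR (n + N) ^ 2)%R)).
    apply ex_series_ext with (fun n => (/ (INR (N0 + n) + 1) ^ 2)%R).
    + intros n; unfold N; rewrite Nat.add_succ_r, S_INR, Nat.add_comm; reflexivity.
    + apply (ex_series_incr_n (fun n => (/ (INR n + 1) ^ 2)%R) N0), ex_series_inv_sqr.
  - exists (/ l); split.
    + now apply Cinv_neq0.
    + apply (Cvg_incr_n _ N).
      apply Cvg_ext with (fun n => / / Gseq z (n + N)).
      * intros n; assert (H := Gseq_neq0 z (n + N) Hz ltac:(unfold N; lia)).
        now field.
      * apply Cvg_inv; auto; intros n.
        apply Cinv_neq0, Gseq_neq0; [exact Hz | unfold N; lia].
Qed.

Lemma Gamma_cvg (z : C) : nonpole z -> Cvg (Gseq z) (Gamma z).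
Proof.
  intros Hz; destruct (Gseq_cvg z Hz) as [l [_ Hl]].
  change (Cvg (Gseq z) (CLim_seq (Gseq z))); now rewrite (Cvg_lim _ _ Hl).
Qed.

Lemma Gamma_neq0 (z : C) : nonpole z -> Gamma z <> 0.
Proof.
  intros Hz; destruct (Gseq_cvg z Hz) as [l [H0 Hl]].
  now rewrite (Cvg_unique _ _ _ (Gamma_cvg z Hz) Hl).
Qed.

Lemma Cvg_shift_ratio (a b : C) :
  nonpole b -> Cvg (fun n => (NtoC n + a) / (NtoC n + b)) 1.
Proof.
  intros Hb.
  assert (Hb' : forall n, NtoC n + b <> 0) by (intros n; rewrite Cplus_comm; apply Hb).
  apply Cvg_of_Cmod.
  apply is_lim_seq_ext with (fun n => (Cmod (a - b) * / Cmod (NtoC n + b))%R).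
  - intros n; rewrite <- Cmod_inv, <- Cmod_mult by auto; f_equal; field; auto.
  - replace (Finite 0) with (Rbar_mult (Cmod (a - b)) (Rbar_inv p_infty))
      by (simpl; f_equal; ring).
    apply is_lim_seq_scal_l, is_lim_seq_inv; [|discriminate].
    apply is_lim_seq_le_p_loc with (fun n => (INR n + - Cmod b)%R).
    + exists 0%nat; intros n _.
      assert (H := Cmod_triangle (NtoC n + b) (- b)).
      replace (NtoC n + b + - b) with (NtoC n) in H by ring.
      rewrite Cmod_opp in H; unfold NtoC in H at 1.
      rewrite Cmod_R, Rabs_pos_eq in H by apply pos_INR; lra.
    + apply is_lim_seq_plus with (1 := is_lim_seq_INR) (2 := is_lim_seq_const _).
      reflexivity.
Qed.

(** With G_n for [Gseq], G_(n+1)(z + 1) = z G_(n+1)(z) (n + 1) / (n + z + 2), and the last quotient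
    tends to 1. *)
Lemma Gamma_S (z : C) : nonpole z -> Gamma (z + 1) = z * Gamma z.
Proof.
  intros Hz; assert (Hz1 := nonpole_S z Hz).
  apply (Cvg_unique _ _ _ (proj1 (Cvg_incr_n _ 1 _) (Gamma_cvg _ Hz1))).
  apply Cvg_ext with (fun n => z * Gseq z (n + 1) * ((NtoC n + 1) / (NtoC n + (z + 1 + 1)))).
  - intros n; rewrite Nat.add_1_r; unfold Gseq.
    assert (H1 := nonpole_Poch _ (S (S n)) Hz1); assert (H2 := nonpole_Poch _ (S (S n)) Hz).
    assert (S1 := Poch_shift z (S (S n))).
    assert (H3 : NtoC n + (z + 1 + 1) <> 0).
    { generalize (Hz (S (S n))); rewrite !NtoC_S; intros H E; apply H; rewrite <- E; ring. }
    rewrite !Cpower_NtoC, Cmult_plus_distr_r, Cexp_plus by lia.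
    assert (HE : Cexp (1 * RtoC (ln (INR (S n)))) = NtoC n + 1).
    { assert (Hr : (0 < INR (S n))%R) by (apply lt_0_INR; lia).
      rewrite Cmult_1_l, <- NtoC_S; unfold NtoC; set (r := INR (S n)) in *.
      unfold Cexp, RtoC; simpl; rewrite exp_ln, cos_0, sin_0 by exact Hr.
      apply C_ext; simpl; ring. }
    rewrite HE.
    set (P1 := Poch (z + 1) (S (S n))) in *; set (P0 := Poch z (S (S n))) in *.
    assert (H0 := nonpole_neq0 _ Hz).
    rewrite !NtoC_S in S1.
    set (c := Cexp _); set (f := NtoC (fact (S n))); clearbody c f P0 P1.
    assert (E : P0 = z * P1 / (NtoC n + (z + 1 + 1))).
    { rewrite <- S1; field; auto. }
    rewrite E.
    field; repeat split; auto.
  - replace (z * Gamma z) with (z * Gamma z * 1) by ring.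
    apply Cvg_mult.
    + apply Cvg_scal, (proj1 (Cvg_incr_n (Gseq z) 1 _)), Gamma_cvg, Hz.
    + apply Cvg_shift_ratio; now repeat apply nonpole_S.
Qed.

Lemma nonpole_not_pole (z : C) : ~ Gamma_pole z <-> nonpole z.
Proof.
  split.
  - intros H m E; apply H; exists m.
    transitivity (z + NtoC m - NtoC m); [ring | rewrite E; ring].
  - intros H [k E]; apply (H k); rewrite E; ring.
Qed.

Lemma rGamma_nonpole (z : C) : nonpole z -> rGamma z = / Gamma z.
Proof.
  intros Hz; unfold rGamma.
  destruct (excluded_middle_informative (Gamma_pole z)) as [H|]; [|reflexivity].
  now apply nonpole_not_pole in Hz.
Qed.

(** True at poles as well: at z = 0 the factor z vanishes, and at z = - (k + 1) both reciprocals are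
    0 by convention. *)
Lemma rGamma_S (z : C) : rGamma z = z * rGamma (z + 1).
Proof.
  destruct (excluded_middle_informative (Gamma_pole z)) as [[[|k] ->]|Hz].
  - unfold rGamma at 1; destruct (excluded_middle_informative _) as [|H];
      [|exfalso; apply H; now exists 0%nat].
    rewrite NtoC_0; ring.
  - unfold rGamma; destruct (excluded_middle_informative _) as [|H];
      [|exfalso; apply H; now exists (S k)].
    destruct (excluded_middle_informative _) as [|H]; [ring|].
    exfalso; apply H; exists k; rewrite NtoC_S; ring.
  - apply nonpole_not_pole in Hz.
    rewrite !rGamma_nonpole, Gamma_S by auto using nonpole_S.
    assert (H := Gamma_neq0 z Hz); assert (z <> 0) by now apply nonpole_neq0.
    field; auto.
Qed.

Lemma Gamma_Poch (z : C) (n : nat) :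
  nonpole z -> Gamma (z + NtoC n) = Poch z n * Gamma z.
Proof.
  intros Hz; induction n as [|n IH]; simpl.
  - rewrite NtoC_0, Cplus_0_r; ring.
  - rewrite NtoC_S, Cplus_assoc, Gamma_S, IH by now apply nonpole_plus.
    ring.
Qed.

Lemma rGamma_Poch (z : C) (n : nat) :
  rGamma z = Poch z n * rGamma (z + NtoC n).
Proof.
  induction n as [|n IH]; simpl.
  - rewrite NtoC_0, Cplus_0_r; ring.
  - rewrite IH, (rGamma_S (z + NtoC n)), NtoC_S, Cplus_assoc; ring.
Qed.

(** * The power series of ((1 + sqrt (1 - x)) / 2) ^ (- q) *)

Lemma Csqrt_sqr (z : C) : Csqrt z * Csqrt z = z.
Proof.
  assert (H1 := re_le_Cmod z); apply Rabs_le_between in H1.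
  assert (H2 := Cmod2_alt z).
  set (m := Cmod z) in *.
  set (p := ((m + Re z) / 2)%R); set (q := ((m - Re z) / 2)%R).
  assert (Hp : (0 <= p)%R) by (unfold p; lra).
  assert (Hq : (0 <= q)%R) by (unfold q; lra).
  assert (Sp := sqrt_sqrt p Hp); assert (Sq := sqrt_sqrt q Hq).
  assert (Hpq : (sqrt p * sqrt q = Rabs (Im z) / 2)%R).
  { rewrite <- sqrt_mult by assumption.
    replace (p * q)%R with (Rsqr (Im z / 2)) by (unfold p, q, Rsqr; nra).
    rewrite sqrt_Rsqr_abs; unfold Rdiv; rewrite Rabs_mult, (Rabs_pos_eq (/ 2)) by lra; ring. }
  unfold Csqrt; fold m; fold p; fold q.
  apply C_ext; simpl.
  - destruct (Rle_dec 0 (Im z)); [|]; unfold p, q in *; nra.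
  - destruct (Rle_dec 0 (Im z)) as [H|H];
    [rewrite Rabs_pos_eq in Hpq by lra | rewrite Rabs_left in Hpq by lra]; lra.
Qed.

Definition half_1_sqrt (x : C) : C := 1 / 2 + 1 / 2 * Csqrt (1 - x).
(** At r = |x| this is the number V that bounds Re v, hence |v|, from below. *)
Definition half_1_sqrtR (r : R) : R := ((1 + sqrt (1 - r)) / 2)%R.

Lemma half_1_sqrt_mul (x : C) : half_1_sqrt x * (1 - half_1_sqrt x) = x / 4.
Proof.
  unfold half_1_sqrt; assert (H := Csqrt_sqr (1 - x)).
  transitivity ((1 - Csqrt (1 - x) * Csqrt (1 - x)) / 4); [field|].
  rewrite H; field.
Qed.

Lemma half_1_sqrtR_mul (r : R) : (r <= 1)%R ->
  (half_1_sqrtR r * (1 - half_1_sqrtR r) = r / 4)%R.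
Proof.
  intros H; unfold half_1_sqrtR; assert (S := sqrt_sqrt (1 - r) ltac:(lra)); nra.
Qed.

Lemma half_1_sqrtR_bounds (r : R) : (0 <= r < 1)%R -> (1 / 2 < half_1_sqrtR r <= 1)%R.
Proof.
  intros H; unfold half_1_sqrtR.
  assert (S := sqrt_lt_R0 (1 - r) ltac:(lra)).
  assert (T := sqrt_le_1 (1 - r) 1 ltac:(lra) ltac:(lra) ltac:(lra)); rewrite sqrt_1 in T.
  lra.
Qed.

Lemma Re_Csqrt_ge (x : C) : (Cmod x < 1)%R ->
  (sqrt (1 - Cmod x) <= Re (Csqrt (1 - x)))%R.
Proof.
  intros H; simpl.
  assert (H1 := re_le_Cmod x); apply Rabs_le_between in H1.
  assert (H2 := Cmod_triangle_rev 1 x); rewrite Cmod_1 in H2; apply Rabs_le_between in H2.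
  apply sqrt_le_1; simpl; unfold Re in *; try lra.
Qed.

Lemma Re_half_1_sqrt (x : C) : Re (half_1_sqrt x) = ((1 + Re (Csqrt (1 - x))) / 2)%R.
Proof. unfold half_1_sqrt; destruct (Csqrt (1 - x)) as [a b]; simpl; field. Qed.

Lemma Re_half_1_sqrt_ge (x : C) : (Cmod x < 1)%R ->
  (half_1_sqrtR (Cmod x) <= Re (half_1_sqrt x))%R.
Proof.
  intros H; rewrite Re_half_1_sqrt; unfold half_1_sqrtR.
  assert (S := Re_Csqrt_ge x H); lra.
Qed.

Lemma half_1_sqrt_neq0 (x : C) : (Cmod x < 1)%R -> half_1_sqrt x <> 0.
Proof.
  intros H E; assert (S := Re_half_1_sqrt_ge x H).
  assert (T := half_1_sqrtR_bounds (Cmod x) (conj (Cmod_ge_0 x) H)).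
  rewrite E in S; simpl in S; lra.
Qed.

(** |v| |1 - v| = |x| / 4 = V (1 - V), and |v| >= V. *)
Lemma Cmod_1_minus_half (x : C) : (Cmod x < 1)%R ->
  (Cmod (1 - half_1_sqrt x) <= 1 - half_1_sqrtR (Cmod x))%R.
Proof.
  intros H; assert (S := Re_half_1_sqrt_ge x H).
  assert (T := half_1_sqrtR_bounds (Cmod x) (conj (Cmod_ge_0 x) H)).
  assert (M := half_1_sqrtR_mul (Cmod x) ltac:(lra)).
  assert (N : (half_1_sqrtR (Cmod x) <= Cmod (half_1_sqrt x))%R).
  { eapply Rle_trans; [exact S|]; eapply Rle_trans; [apply Rle_abs | apply re_le_Cmod]. }
  assert (E : (Cmod (half_1_sqrt x) * Cmod (1 - half_1_sqrt x) = Cmod x / 4)%R).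
  { rewrite <- Cmod_mult, half_1_sqrt_mul, Cmod_div by (intros E0; apply RtoC_inj in E0; lra).
    rewrite Cmod_R, Rabs_pos_eq by lra; reflexivity. }
  set (V := half_1_sqrtR (Cmod x)) in *.
  pose proof (Cmod_ge_0 (1 - half_1_sqrt x)).
  apply Rmult_le_reg_l with V; [lra|]; rewrite M, <- E.
  now apply Rmult_le_compat_r.
Qed.

(** * Power series obeying the recursion of v^-q, with a real majorant *)

Section Family.
Variables (c : C -> nat -> C) (cR : R -> nat -> R).
Hypothesis c_real : forall q m, c (RtoC q) m = RtoC (cR q m).
Hypothesis c_major : forall q k m, (Cmod q <= k)%R -> (Cmod (c q m) <= cR k m)%R.
Hypothesis c_rec0 : forall q, c (q + 1) 0 = c q 0.
(** The coefficients of v^-(q+1) = v^-q + (x/4) v^-(q+2), an identity equivalent to v (1 - v) = x /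
    4. Both [wcoef] and [dcoef] satisfy it. *)
Hypothesis c_recS : forall q m, c (q + 1) (S m) = c q (S m) + c (q + 1 + 1) m / 4.
Hypothesis c_base : forall r, (0 <= r < 1)%R ->
  exists B, forall M, (sum_n (fun m => cR 0 m * r ^ m) M <= B)%R.

Lemma cR_nonneg (k : R) (m : nat) : (0 <= k)%R -> (0 <= cR k m)%R.
Proof.
  intros Hk; eapply Rle_trans; [apply Cmod_ge_0|].
  apply (c_major (RtoC k)); rewrite Cmod_R, Rabs_pos_eq; lra.
Qed.

Lemma cR_rec0 (q : R) : cR (q + 1) 0 = cR q 0.
Proof. apply RtoC_inj; rewrite <- !c_real, RtoC_plus; apply c_rec0. Qed.

Lemma cR_recS (q : R) (m : nat) :
  cR (q + 1) (S m) = (cR q (S m) + cR (q + 1 + 1) m / 4)%R.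
Proof.
  apply RtoC_inj; rewrite RtoC_plus, RtoC_div by lra.
  rewrite <- !c_real, !RtoC_plus; apply c_recS.
Qed.

Lemma family_partial_rec (q r : R) (M : nat) :
  (sum_n (fun m => cR (q + 1) m * r ^ m) (S M)
   = sum_n (fun m => cR q m * r ^ m) (S M)
     + r / 4 * sum_n (fun m => cR (q + 1 + 1) m * r ^ m) M)%R.
Proof.
  induction M as [|M IH].
  - rewrite !sum_Sn, !sum_O, cR_rec0, cR_recS; unfold plus; simpl; field.
  - rewrite sum_Sn, IH, (sum_Sn _ (S M)), (sum_Sn (fun m => cR (q + 1 + 1) m * r ^ m)%R M).
    unfold plus; simpl; rewrite cR_recS; field.
Qed.

(* With [V = half_1_sqrtR r], [V^-(k+1) = V^-k + r/4 V^-(k+2)] propagates the bound from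
   [k = 0] by induction on [M] and [k]. *)
Lemma family_partial_bound (r B : R) : (0 <= r < 1)%R ->
  (forall M, (sum_n (fun m => cR 0 m * r ^ m) M <= B)%R) ->
  forall M k, (sum_n (fun m => cR (INR k) m * r ^ m) M <= B * / half_1_sqrtR r ^ k)%R.
Proof.
  intros Hr HB; assert (HV := half_1_sqrtR_bounds r Hr).
  assert (HM := half_1_sqrtR_mul r ltac:(lra)).
  set (V := half_1_sqrtR r) in *.
  assert (B0 : (0 <= B)%R).
  { eapply Rle_trans; [|apply (HB 0%nat)]; rewrite sum_O; simpl.
    rewrite Rmult_1_r; apply cR_nonneg; lra. }
  assert (VI : (1 <= / V)%R) by (rewrite <- Rinv_1; apply Rinv_le_contravar; lra).
  intros M; induction M as [|M IHM]; intros k.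
  - rewrite sum_O; simpl.
    replace (cR (INR k) 0) with (cR 0 0).
    + eapply Rle_trans; [specialize (HB 0%nat); rewrite sum_O in HB; exact HB|].
      rewrite <- (Rmult_1_r B) at 1; apply Rmult_le_compat_l; [exact B0|].
      rewrite <- pow_inv; now apply pow_R1_Rle.
    + induction k as [|k IHk]; [reflexivity|].
      now rewrite S_INR, cR_rec0.
  - induction k as [|k IHk].
    + simpl; rewrite Rinv_1, Rmult_1_r; apply HB.
    + rewrite S_INR, family_partial_rec.
      replace (INR k + 1 + 1)%R with (INR (S (S k))) by (rewrite !S_INR; reflexivity).
      eapply Rle_trans.
      { apply Rplus_le_compat; [exact IHk|].
        apply Rmult_le_compat_l; [lra | apply IHM]. }
      rewrite <- HM; simpl.
      assert (Hk : (0 < V ^ k)%R) by (apply pow_lt; lra).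
      right; field; lra.
Qed.

Lemma family_sum_bound (r : R) : (0 <= r < 1)%R ->
  exists B, (0 <= B)%R /\ forall k, ex_series (fun m => cR (INR k) m * r ^ m)%R /\
    (Series (fun m => cR (INR k) m * r ^ m) <= B * / half_1_sqrtR r ^ k)%R.
Proof.
  intros Hr; destruct (c_base r Hr) as [B HB]; exists B; split.
  { eapply Rle_trans; [|apply (HB 0%nat)]; rewrite sum_O; simpl.
    rewrite Rmult_1_r; apply cR_nonneg; lra. }
  intros k; assert (P := fun M => family_partial_bound r B Hr HB M k).
  assert (Ex : ex_series (fun m => cR (INR k) m * r ^ m)%R).
  { destruct (ex_finite_lim_seq_incr (sum_n (fun m => cR (INR k) m * r ^ m)%R)
      (B * / half_1_sqrtR r ^ k)) as [l Hl]; [|exact P|now exists l].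
    intros n; rewrite sum_Sn; unfold plus; simpl.
    assert (0 <= cR (INR k) (S n) * (r * r ^ n))%R; [|lra].
    apply Rmult_le_pos; [apply cR_nonneg, pos_INR|]; apply (pow_le r (S n)); lra. }
  split; [exact Ex|].
  apply (is_lim_seq_le (sum_n (fun m => cR (INR k) m * r ^ m)%R)
    (fun _ => (B * / half_1_sqrtR r ^ k)%R) (Series _) (B * / half_1_sqrtR r ^ k)%R);
  [exact P | now apply Series_correct | apply is_lim_seq_const].
Qed.

Definition Fser (q x : C) : C := CSeries (fun m => c q m * x ^ m).

Lemma Cmod_pow (x : C) (n : nat) : Cmod (x ^ n) = (Cmod x ^ n)%R.
Proof. induction n as [|n IH]; simpl; [apply Cmod_1 | now rewrite Cmod_mult, IH]. Qed.

Lemma family_term_le (q x : C) (k : nat) (m : nat) : (Cmod q <= INR k)%R ->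
  (Cmod (c q m * x ^ m) <= cR (INR k) m * Cmod x ^ m)%R.
Proof.
  intros H; rewrite Cmod_mult, Cmod_pow; apply Rmult_le_compat_r.
  - apply pow_le, Cmod_ge_0.
  - now apply c_major.
Qed.

Lemma Cmod_le_INR (q : C) : exists k : nat, (Cmod q <= INR k)%R.
Proof.
  destruct (nfloor_ex (Cmod q) (Cmod_ge_0 q)) as [k [_ Hk]].
  exists (S k); rewrite S_INR; lra.
Qed.

Lemma family_ex_abs (q x : C) : (Cmod x < 1)%R ->
  ex_series (fun m => Cmod (c q m * x ^ m)).
Proof.
  intros Hx; destruct (Cmod_le_INR q) as [k Hk].
  destruct (family_sum_bound (Cmod x) (conj (Cmod_ge_0 x) Hx)) as [B [_ HB]].
  apply (@ex_series_le R_AbsRing R_CompleteNormedModule _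
    (fun m => cR (INR k) m * Cmod x ^ m)%R); [|apply HB].
  intros m; unfold norm; simpl; unfold abs; simpl.
  rewrite Rabs_pos_eq by apply Cmod_ge_0; now apply family_term_le.
Qed.

Lemma Fser_correct (q x : C) : (Cmod x < 1)%R ->
  is_Cser (fun m => c q m * x ^ m) (Fser q x).
Proof. intros Hx; now apply is_Cser_of_Cmod, family_ex_abs. Qed.

(** One B serves all q: [Fser_shift] lets q grow without bound, and the partial sums give the
    majorant for the rearrangement. *)
Lemma Fser_bound (x : C) : (Cmod x < 1)%R ->
  exists B, (0 <= B)%R /\ forall q k, (Cmod q <= INR k)%R ->
    (Cmod (Fser q x) <= B * / half_1_sqrtR (Cmod x) ^ k)%R /\
    forall M : nat, (Cmod (sum_n (fun m => (c q m * x ^ m)%C) M)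
               <= B * / half_1_sqrtR (Cmod x) ^ k)%R.
Proof.
  intros Hx; destruct (family_sum_bound (Cmod x) (conj (Cmod_ge_0 x) Hx)) as [B [B0 HB]].
  exists B; split; [exact B0|]; intros q k Hk; destruct (HB k) as [E1 E2]; split.
  - eapply Rle_trans; [|exact E2].
    apply (is_Cser_Cmod_le _ _ _ (Fser_correct q x Hx)); [|exact E1].
    intros m; now apply family_term_le.
  - intros M; eapply Rle_trans; [apply Cmod_sum_n|].
    eapply Rle_trans; [|exact E2].
    apply Rle_trans with (sum_n (fun m => cR (INR k) m * Cmod x ^ m)%R M).
    + apply sum_n_m_le; intros m; now apply family_term_le.
    + apply (is_lim_seq_incr_compare (sum_n (fun m => cR (INR k) m * Cmod x ^ m)%R)
        (Series (fun m => cR (INR k) m * Cmod x ^ m)%R)).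
      * now apply Series_correct.
      * intros n; rewrite sum_Sn; unfold plus; simpl.
        assert (0 <= cR (INR k) (S n) * (Cmod x * Cmod x ^ n))%R; [|lra].
        apply Rmult_le_pos; [apply cR_nonneg, pos_INR|].
        apply (pow_le (Cmod x) (S n)), Cmod_ge_0.
Qed.

Lemma Fser_rec (q x : C) : (Cmod x < 1)%R ->
  Fser (q + 1) x = Fser q x + x / 4 * Fser (q + 1 + 1) x.
Proof.
  intros Hx.
  apply (Cvg_unique (fun M => sum_n (fun m => c (q + 1) m * x ^ m) (M + 1))).
  - apply (proj1 (Cvg_incr_n _ 1 _)), Fser_correct, Hx.
  - apply Cvg_ext with (fun M => sum_n (fun m => c q m * x ^ m) (M + 1)
      + x / 4 * sum_n (fun m => c (q + 1 + 1) m * x ^ m) M).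
    + intros M; rewrite Nat.add_1_r; symmetry; induction M as [|M IH].
      * rewrite !sum_n_CS, !sum_n_C0, c_rec0, c_recS; simpl; field.
      * rewrite sum_n_CS, IH, (sum_n_CS _ (S M)), (sum_n_CS (fun m => c (q + 1 + 1) m * x ^ m) M).
        rewrite c_recS, !Cpow_S; field.
    + apply Cvg_plus.
      * apply (proj1 (Cvg_incr_n _ 1 _)), Fser_correct, Hx.
      * apply Cvg_scal, Fser_correct, Hx.
Qed.

(* The defect [rho_q = F_q - v F_(q+1)] satisfies [rho_q = (1 - v) rho_(q+1)], while
   [rho_(q+N)] grows at most like [V^-N] and [|1 - v| <= 1 - V < V]. *)
Lemma Fser_shift (q x : C) : (Cmod x < 1)%R ->
  Fser q x = half_1_sqrt x * Fser (q + 1) x.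
Proof.
  intros Hx; set (v := half_1_sqrt x).
  set (rho := fun q => Fser q x - v * Fser (q + 1) x).
  assert (Hrec : forall q, rho q = (1 - v) * rho (q + 1)).
  { intros q'; unfold rho.
    assert (H := Fser_rec q' x Hx).
    assert (M := half_1_sqrt_mul x); fold v in M; rewrite <- M in H.
    rewrite H; ring. }
  assert (HN : forall N q, rho q = (1 - v) ^ N * rho (q + NtoC N)).
  { induction N as [|N IH]; intros q'.
    - rewrite NtoC_0, Cplus_0_r; simpl; ring.
    - rewrite (IH q'), (Hrec (q' + NtoC N)), NtoC_S, Cplus_assoc, Cpow_S; ring. }
  destruct (Fser_bound x Hx) as [B [B0 HB]].
  assert (HV := half_1_sqrtR_bounds _ (conj (Cmod_ge_0 x) Hx)).
  assert (H1v := Cmod_1_minus_half x Hx); fold v in H1v.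
  set (V := half_1_sqrtR (Cmod x)) in *.
  destruct (Cmod_le_INR q) as [k Hk].
  set (M := (B * (/ V ^ k + Cmod v * / V ^ (k + 1)))%R).
  assert (Hb : forall N, (Cmod (rho q) <= M * ((1 - V) / V) ^ N)%R).
  { intros N; rewrite (HN N q), Cmod_mult, Cmod_pow.
    assert (Hq : (Cmod (q + NtoC N) <= INR (k + N))%R).
    { eapply Rle_trans; [apply Cmod_triangle|].
      unfold NtoC; rewrite Cmod_R, (Rabs_pos_eq _ (pos_INR N)), plus_INR; lra. }
    assert (Hq1 : (Cmod (q + NtoC N + 1) <= INR (k + 1 + N))%R).
    { eapply Rle_trans; [apply Cmod_triangle|].
      rewrite Cmod_1; rewrite !plus_INR in *; simpl (INR 1); lra. }
    assert (Hr : (Cmod (rho (q + NtoC N)%C)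
      <= B * / V ^ (k + N) + Cmod v * (B * / V ^ (k + 1 + N)))%R).
    { unfold rho, Cminus; eapply Rle_trans; [apply Cmod_triangle|].
      rewrite Cmod_opp, Cmod_mult; apply Rplus_le_compat; [now apply HB|].
      apply Rmult_le_compat_l; [apply Cmod_ge_0 | now apply HB]. }
    replace (M * ((1 - V) / V) ^ N)%R
      with ((1 - V) ^ N * (B * / V ^ (k + N) + Cmod v * (B * / V ^ (k + 1 + N))))%R.
    - apply Rmult_le_compat; auto using Cmod_ge_0.
      + apply pow_le, Cmod_ge_0.
      + apply pow_incr; auto using Cmod_ge_0.
    - unfold M, Rdiv; rewrite !pow_add, Rpow_mult_distr, pow_inv, pow_1.
      assert (V ^ k <> 0)%R by (apply pow_nonzero; lra).
      assert (V ^ N <> 0)%R by (apply pow_nonzero; lra).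
      field; split; lra || assumption. }
  assert (Hz : (Cmod (rho q) <= 0)%R).
  { apply (is_lim_seq_le (fun _ => Cmod (rho q)) (fun N => (M * ((1 - V) / V) ^ N)%R)
      (Cmod (rho q)) 0%R Hb (is_lim_seq_const _)).
    replace (Finite 0) with (Rbar_mult M 0%R) by (simpl; f_equal; ring).
    apply is_lim_seq_scal_l, is_lim_seq_geom.
    assert (0 <= (1 - V) / V)%R
      by (apply Rmult_le_pos; [lra | apply Rlt_le, Rinv_0_lt_compat; lra]).
    rewrite Rabs_pos_eq by assumption.
    apply Rmult_lt_reg_r with V; [lra|]; unfold Rdiv; rewrite Rmult_assoc, Rinv_l by lra; lra. }
  assert (E : rho q = 0) by (apply Cmod_eq_0; pose proof (Cmod_ge_0 (rho q)); lra).
  unfold rho in E; rewrite <- (Cplus_0_r (v * _)), <- E; ring.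
Qed.

End Family.

(** * The coefficients of v^-q and of its derivative *)

Open Scope R_scope.

Fixpoint PochR (a : R) (n : nat) : R :=
  match n with O => 1 | S m => PochR a m * (a + INR m) end.

Lemma RtoC_PochR (a : R) (n : nat) : RtoC (PochR a n) = Poch (RtoC a) n.
Proof.
  induction n as [|n IH]; simpl; [reflexivity|].
  now rewrite RtoC_mult, IH, RtoC_plus.
Qed.

Lemma Cmod_Poch_le (a : C) (r : R) (n : nat) :
  Cmod a <= r -> Cmod (Poch a n) <= PochR r n.
Proof.
  intros H; induction n as [|n IH]; simpl; [rewrite Cmod_1; lra|].
  rewrite Cmod_mult; apply Rmult_le_compat; auto using Cmod_ge_0.
  eapply Rle_trans; [apply Cmod_triangle|].
  unfold NtoC; rewrite Cmod_R, (Rabs_pos_eq _ (pos_INR n)); lra.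
Qed.

Lemma PochR_Sl (a : R) (n : nat) : PochR a (S n) = a * PochR (a + 1) n.
Proof.
  apply RtoC_inj; rewrite RtoC_mult, !RtoC_PochR, RtoC_plus; apply Poch_Sl.
Qed.

Open Scope C_scope.

Lemma RtoC_pow (r : R) (n : nat) : RtoC (r ^ n) = RtoC r ^ n.
Proof. induction n as [|n IH]; simpl; [reflexivity | now rewrite RtoC_mult, IH]. Qed.

Lemma C4_pow_neq0 (n : nat) : RtoC 4 ^ n <> 0.
Proof. apply Cpow_nz; intros E; apply RtoC_inj in E; lra. Qed.

(** This is 4^(-m) q / (q + 2 m) binomial(q + 2 m, m), the coefficient in the q-th power of the
    Catalan generating function 1 / v, with the denominator q + 2 m cancelled. *)
Definition wcoef (q : C) (m : nat) : C :=
  match m with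
  | O => 1
  | S k => q * Poch (q + NtoC k + 2) k / (NtoC (fact (S k)) * 4 ^ S k)
  end.

Definition wcoefR (q : R) (m : nat) : R :=
  match m with
  | O => 1
  | S k => (q * PochR (q + INR k + 2) k / (INR (fact (S k)) * 4 ^ S k))%R
  end.

(** This is 4^(-m-1) binomial(q + 2 m, m); the additional 1/4 is the one in v' = - 1 / (4 sqrt (1 -
    x)) and keeps [wcoef_deriv] free of constants. *)
Definition dcoef (q : C) (m : nat) : C :=
  Poch (q + NtoC m + 1) m / (NtoC (fact m) * 4 ^ S m).

Definition dcoefR (q : R) (m : nat) : R :=
  (PochR (q + INR m + 1) m / (INR (fact m) * 4 ^ S m))%R.

Lemma fact_pow_pos (m n : nat) : (0 < INR (fact m) * 4 ^ n)%R.
Proof.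
  apply Rmult_lt_0_compat; [apply INR_fact_lt_0 | apply pow_lt; lra].
Qed.

Lemma wcoef_real (q : R) (m : nat) : wcoef (RtoC q) m = RtoC (wcoefR q m).
Proof.
  destruct m as [|k]; [reflexivity|]; unfold wcoef, wcoefR.
  assert (H := fact_pow_pos (S k) (S k)).
  rewrite RtoC_div, !RtoC_mult, RtoC_PochR, !RtoC_plus, RtoC_pow by lra; reflexivity.
Qed.

Lemma dcoef_real (q : R) (m : nat) : dcoef (RtoC q) m = RtoC (dcoefR q m).
Proof.
  unfold dcoef, dcoefR; assert (H := fact_pow_pos m (S m)).
  rewrite RtoC_div, !RtoC_mult, RtoC_PochR, !RtoC_plus, RtoC_pow by lra; reflexivity.
Qed.

Lemma Cmod_div_fact_pow (z : C) (m n : nat) :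
  Cmod (z / (NtoC (fact m) * 4 ^ n)) = (Cmod z / (INR (fact m) * 4 ^ n))%R.
Proof.
  assert (H := fact_pow_pos m n).
  replace (NtoC (fact m) * 4 ^ n) with (RtoC (INR (fact m) * 4 ^ n))
    by (rewrite RtoC_mult, RtoC_pow; reflexivity).
  rewrite Cmod_div, Cmod_R, Rabs_pos_eq by (try (intros E; apply RtoC_inj in E); lra).
  reflexivity.
Qed.

Lemma Cmod_shift_le (q : C) (k r : R) (n : nat) : (Cmod q <= k)%R -> (0 <= r)%R ->
  (Cmod (q + NtoC n + RtoC r) <= k + INR n + r)%R.
Proof.
  intros H Hr; eapply Rle_trans; [apply Cmod_triangle|].
  rewrite Cmod_R, (Rabs_pos_eq r Hr); apply Rplus_le_compat_r.
  eapply Rle_trans; [apply Cmod_triangle|].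
  unfold NtoC; rewrite Cmod_R, (Rabs_pos_eq _ (pos_INR n)); lra.
Qed.

Lemma wcoef_major (q : C) (k : R) (m : nat) : (Cmod q <= k)%R ->
  (Cmod (wcoef q m) <= wcoefR k m)%R.
Proof.
  intros H; destruct m as [|m]; [simpl; rewrite Cmod_1; lra|]; unfold wcoef, wcoefR.
  rewrite Cmod_div_fact_pow, Cmod_mult.
  apply Rmult_le_compat_r; [apply Rlt_le, Rinv_0_lt_compat, fact_pow_pos|].
  apply Rmult_le_compat; auto using Cmod_ge_0.
  apply Cmod_Poch_le, Cmod_shift_le; lra.
Qed.

Lemma dcoef_major (q : C) (k : R) (m : nat) : (Cmod q <= k)%R ->
  (Cmod (dcoef q m) <= dcoefR k m)%R.
Proof.
  intros H; unfold dcoef, dcoefR; rewrite Cmod_div_fact_pow.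
  apply Rmult_le_compat_r; [apply Rlt_le, Rinv_0_lt_compat, fact_pow_pos|].
  apply Cmod_Poch_le, Cmod_shift_le; lra.
Qed.

Lemma wcoef_rec0 (q : C) : wcoef (q + 1) 0 = wcoef q 0.
Proof. reflexivity. Qed.

Lemma wcoef_recS (q : C) (m : nat) :
  wcoef (q + 1) (S m) = wcoef q (S m) + wcoef (q + 1 + 1) m / 4.
Proof.
  assert (Hf := NtoC_fact_neq0 m); assert (H4 := C4_pow_neq0 m).
  assert (HS := NtoC_S_neq0 m).
  destruct m as [|k]; unfold wcoef.
  - simpl; unfold NtoC; simpl; field.
  - rewrite (NtoC_fact_S (S k)), !NtoC_S, !(Cpow_S 4 (S k)).
    replace (q + 1 + (NtoC k + 1) + 2) with (q + NtoC k + 4) by ring.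
    replace (q + (NtoC k + 1) + 2) with (q + NtoC k + 3) by ring.
    replace (q + 1 + 1 + NtoC k + 2) with (q + NtoC k + 4) by ring.
    rewrite (Poch_Sl (q + NtoC k + 3) k).
    replace (q + NtoC k + 3 + 1) with (q + NtoC k + 4) by ring.
    simpl (Poch _ (S k)); rewrite NtoC_S in HS; field; repeat split; auto.
Qed.

Lemma dcoef_rec0 (q : C) : dcoef (q + 1) 0 = dcoef q 0.
Proof. reflexivity. Qed.

Lemma dcoef_recS (q : C) (m : nat) :
  dcoef (q + 1) (S m) = dcoef q (S m) + dcoef (q + 1 + 1) m / 4.
Proof.
  assert (Hf := NtoC_fact_neq0 m); assert (H4 := C4_pow_neq0 m).
  assert (HS := NtoC_S_neq0 m).
  unfold dcoef; rewrite NtoC_fact_S, !NtoC_S, !Cpow_S.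
  replace (q + 1 + (NtoC m + 1) + 1) with (q + NtoC m + 3) by ring.
  replace (q + (NtoC m + 1) + 1) with (q + NtoC m + 2) by ring.
  replace (q + 1 + 1 + NtoC m + 1) with (q + NtoC m + 3) by ring.
  rewrite (Poch_Sl (q + NtoC m + 2) m).
  replace (q + NtoC m + 2 + 1) with (q + NtoC m + 3) by ring.
  simpl (Poch _ (S m)); field; repeat split; auto.
Qed.

Lemma wcoef_deriv (q : C) (m : nat) :
  (NtoC m + 1) * wcoef q (S m) = q * dcoef (q + 1) m.
Proof.
  assert (Hf := NtoC_fact_neq0 m); assert (H4 := C4_pow_neq0 m).
  assert (HS := NtoC_S_neq0 m).
  unfold wcoef, dcoef; rewrite NtoC_fact_S, Cpow_S.
  replace (q + 1 + NtoC m + 1) with (q + NtoC m + 2) by ring.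
  field; repeat split; auto.
Qed.

(** The coefficients of 4 (2 v - 1) D_(q+1) = W_(q+1), where v D_(q+1) has been replaced by D_q;
    note that 2 v - 1 = sqrt (1 - x). *)
Lemma dcoef_wcoef (q : C) (m : nat) :
  8 * dcoef q m - 4 * dcoef (q + 1) m = wcoef (q + 1) m.
Proof.
  destruct m as [|k]; unfold wcoef, dcoef.
  - simpl; unfold NtoC; simpl; field.
  - assert (Hf := NtoC_fact_neq0 k); assert (H4 := C4_pow_neq0 k).
    assert (HS := NtoC_S_neq0 k).
    rewrite NtoC_fact_S, !NtoC_S, !Cpow_S.
    replace (q + 1 + (NtoC k + 1) + 1) with (q + NtoC k + 3) by ring.
    replace (q + (NtoC k + 1) + 1) with (q + NtoC k + 2) by ring.
    replace (q + 1 + NtoC k + 2) with (q + NtoC k + 3) by ring.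
    rewrite (Poch_Sl (q + NtoC k + 2) k).
    replace (q + NtoC k + 2 + 1) with (q + NtoC k + 3) by ring.
    simpl (Poch _ (S k)); field; repeat split; auto.
Qed.

Open Scope R_scope.

Lemma wcoef_base (r : R) : 0 <= r < 1 ->
  exists B, forall M, sum_n (fun m => wcoefR 0 m * r ^ m) M <= B.
Proof.
  intros _; exists 1; intros M; induction M as [|M IH].
  - rewrite sum_O; simpl; lra.
  - rewrite sum_Sn; unfold plus; simpl in *; unfold Rdiv; rewrite !Rmult_0_l, Rplus_0_r; exact IH.
Qed.

(** [dcoefR 0 m] is binomial(2 m, m) / 4^(m+1), and the central binomial coefficient is at most 4^m:
    the ratio of neighbours is 2 (2 m + 1) / (m + 1) <= 4. *)
Lemma dcoefR_0_le (m : nat) : 0 <= dcoefR 0 m <= 1 / 4.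
Proof.
  assert (H : 0 <= PochR (INR m + 1) m <= INR (fact m) * 4 ^ m).
  { induction m as [|m IH]; [simpl; lra|].
    assert (E : PochR (INR (S m) + 1) (S m) * (INR m + 1)
      = PochR (INR m + 1) m * (2 * INR m + 1) * (2 * INR m + 2)).
    { rewrite S_INR; transitivity (PochR (INR m + 1) (S (S m))).
      - rewrite (PochR_Sl (INR m + 1)); ring.
      - change (PochR (INR m + 1) (S (S m)))
          with (PochR (INR m + 1) m * (INR m + 1 + INR m) * (INR m + 1 + INR (S m))).
        rewrite S_INR; ring. }
    change (fact (S m)) with (S m * fact m)%nat; rewrite mult_INR.
    assert (Hm := pos_INR m); rewrite S_INR in *.
    assert (E' : PochR (INR m + 1 + 1) (S m) = PochR (INR m + 1) m * (2 * (2 * INR m + 1))).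
    { apply Rmult_eq_reg_r with (INR m + 1); [rewrite E; ring | lra]. }
    rewrite E'; split.
    - apply Rmult_le_pos; [apply IH | lra].
    - simpl (4 ^ S m).
      apply Rle_trans with (INR (fact m) * 4 ^ m * (4 * (INR m + 1))); [|right; ring].
      apply Rmult_le_compat; lra. }
  unfold dcoefR; rewrite Rplus_0_l; assert (F := fact_pow_pos m m).
  split.
  - apply Rmult_le_pos; [apply H | apply Rlt_le, Rinv_0_lt_compat, fact_pow_pos].
  - replace (1 / 4) with (INR (fact m) * 4 ^ m / (INR (fact m) * 4 ^ S m))
      by (simpl; assert (4 ^ m <> 0) by (apply pow_nonzero; lra);
          assert (INR (fact m) <> 0) by apply INR_fact_neq_0; field; auto).
    apply Rmult_le_compat_r; [apply Rlt_le, Rinv_0_lt_compat, fact_pow_pos | apply H].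
Qed.

Lemma dcoef_base (r : R) : 0 <= r < 1 ->
  exists B, forall M, sum_n (fun m => dcoefR 0 m * r ^ m) M <= B.
Proof.
  intros Hr; exists (1 / 4 * Series (fun m => r ^ m)); intros M.
  apply Rle_trans with (1 / 4 * sum_n (fun m => r ^ m) M).
  - rewrite <- (sum_n_mult_l (K := R_Ring) (1 / 4)).
    apply sum_n_m_le; intros m; unfold mult; simpl.
    apply Rmult_le_compat_r; [apply pow_le; lra | apply dcoefR_0_le].
  - apply Rmult_le_compat_l; [lra|].
    apply sum_n_le_Series; [intros k; apply pow_le; lra|].
    apply ex_series_geom; rewrite Rabs_pos_eq; lra.
Qed.

Open Scope C_scope.

Definition Fw : C -> C -> C := Fser wcoef.
Definition Fd : C -> C -> C := Fser dcoef.

Lemma Fw_shift (q x : C) : (Cmod x < 1)%R -> Fw q x = half_1_sqrt x * Fw (q + 1) x.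
Proof.
  exact (Fser_shift wcoef wcoefR wcoef_real wcoef_major wcoef_rec0 wcoef_recS wcoef_base q x).
Qed.

Lemma Fd_shift (q x : C) : (Cmod x < 1)%R -> Fd q x = half_1_sqrt x * Fd (q + 1) x.
Proof.
  exact (Fser_shift dcoef dcoefR dcoef_real dcoef_major dcoef_rec0 dcoef_recS dcoef_base q x).
Qed.

Lemma Fw_correct (q x : C) : (Cmod x < 1)%R -> is_Cser (fun m => wcoef q m * x ^ m) (Fw q x).
Proof.
  exact (Fser_correct wcoef wcoefR wcoef_real wcoef_major wcoef_rec0 wcoef_recS wcoef_base q x).
Qed.

Lemma Fd_correct (q x : C) : (Cmod x < 1)%R -> is_Cser (fun m => dcoef q m * x ^ m) (Fd q x).
Proof.
  exact (Fser_correct dcoef dcoefR dcoef_real dcoef_major dcoef_rec0 dcoef_recS dcoef_base q x).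
Qed.

(* [Fd q] is the expansion of [v^-q / (4 sqrt (1 - x))]. *)
Lemma Fw_Fd (q x : C) : (Cmod x < 1)%R ->
  4 * (2 * half_1_sqrt x - 1) * Fd (q + 1) x = Fw (q + 1) x.
Proof.
  intros Hx.
  transitivity (8 * Fd q x + - (4) * Fd (q + 1) x);
    [rewrite (Fd_shift q x Hx); ring|].
  apply (Cvg_unique (sum_n (fun m => wcoef (q + 1) m * x ^ m))); [|now apply Fw_correct].
  apply (is_Cser_ext (fun m => 8 * (dcoef q m * x ^ m) + - (4) * (dcoef (q + 1) m * x ^ m))).
  - intros m; rewrite <- dcoef_wcoef; ring.
  - apply is_Cser_plus; apply is_Cser_scal; now apply Fd_correct.
Qed.

(** * Derivatives of complex-valued functions of a real variable *)

Open Scope R_scope.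

Ltac split_ex_derive :=
  repeat match goal with |- _ /\ _ => split end; try (eexists; eassumption).

Definition Cder (f : R -> C) (t : R) (l : C) : Prop :=
  is_derive (fun t => Re (f t)) t (Re l) /\ is_derive (fun t => Im (f t)) t (Im l).

Lemma Cder_ext (f g : R -> C) (t : R) (l : C) :
  (forall t, f t = g t) -> Cder f t l -> Cder g t l.
Proof.
  intros E [H1 H2]; split; eapply is_derive_ext; [|exact H1| |exact H2];
  intros u; cbv beta; now rewrite E.
Qed.

Lemma is_derive_Rmult (f g : R -> R) (t a b : R) :
  is_derive f t a -> is_derive g t b -> is_derive (fun t => f t * g t) t (a * g t + f t * b).
Proof. intros H1 H2; apply (is_derive_mult f g t a b H1 H2 Rmult_comm). Qed.

Lemma Cder_mult (f g : R -> C) (t : R) (a b : C) :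
  Cder f t a -> Cder g t b -> Cder (fun t => f t * g t)%C t (a * g t + f t * b)%C.
Proof.
  intros [H1 H2] [H3 H4]; split.
  - replace (Re (a * g t + f t * b)%C)
      with ((Re a * Re (g t) + Re (f t) * Re b) - (Im a * Im (g t) + Im (f t) * Im b))
      by (simpl; unfold Re, Im; ring).
    apply (is_derive_minus (fun t => Re (f t) * Re (g t)) (fun t => Im (f t) * Im (g t)));
    now apply is_derive_Rmult.
  - replace (Im (a * g t + f t * b)%C)
      with ((Re a * Im (g t) + Re (f t) * Im b) + (Im a * Re (g t) + Im (f t) * Re b))
      by (simpl; unfold Re, Im; ring).
    apply (is_derive_plus (fun t => Re (f t) * Im (g t)) (fun t => Im (f t) * Re (g t)));
    now apply is_derive_Rmult.
Qed.

Lemma Cder_const (c : C) (t : R) : Cder (fun _ => c) t 0.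
Proof. split; apply (is_derive_const (V := R_NormedModule)). Qed.

Lemma Cder_scal (c : C) (f : R -> C) (t : R) (a : C) :
  Cder f t a -> Cder (fun t => c * f t)%C t (c * a)%C.
Proof.
  intros H; replace (c * a)%C with (0 * f t + c * a)%C by ring.
  apply (Cder_mult (fun _ => c)); [apply Cder_const | exact H].
Qed.

Lemma Cder_Cexp (g : R -> C) (t : R) (l : C) :
  Cder g t l -> Cder (fun t => Cexp (g t)) t (Cexp (g t) * l)%C.
Proof.
  intros [H1 H2]; unfold Cexp; split; simpl.
  - set (a := fun t => Re (g t)) in *; set (b := fun t => Im (g t)) in *.
    assert (D1 : Derive (fun x : R => a x) t = Re l) by exact (is_derive_unique _ _ _ H1).
    assert (D2 : Derive (fun x : R => b x) t = Im l) by exact (is_derive_unique _ _ _ H2).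
    change (is_derive (fun t => exp (a t) * cos (b t)) t
      (exp (a t) * cos (b t) * Re l - exp (a t) * sin (b t) * Im l)).
    auto_derive; [split_ex_derive; trivial|].
    rewrite D1, D2; ring.
  - set (a := fun t => Re (g t)) in *; set (b := fun t => Im (g t)) in *.
    assert (D1 : Derive (fun x : R => a x) t = Re l) by exact (is_derive_unique _ _ _ H1).
    assert (D2 : Derive (fun x : R => b x) t = Im l) by exact (is_derive_unique _ _ _ H2).
    change (is_derive (fun t => exp (a t) * sin (b t)) t
      (exp (a t) * cos (b t) * Im l + exp (a t) * sin (b t) * Re l)).
    auto_derive; [split_ex_derive; trivial|].
    rewrite D1, D2; ring.
Qed.

(** The principal logarithm on the right half-plane. [Carg] is an arccosine split at Im z = 0; the
    arctangent is differentiable across the real axis. *)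
Definition log_rhp (z : C) : C := (ln (Cmod z), atan (Im z / Re z)).

Lemma Clog_rhp (z : C) : 0 < Re z -> Clog z = log_rhp z.
Proof.
  intros H; unfold Clog, log_rhp, Carg; f_equal.
  assert (H2 := Cmod2_alt z).
  assert (Hm : 0 < Cmod z).
  { apply Cmod_gt_0; intros ->; simpl in H; lra. }
  set (m := Cmod z) in *; set (a := Re z) in *; set (b := Im z) in *.
  rewrite acos_atan by (apply Rdiv_lt_0_compat; lra).
  replace (sqrt (1 - Rsqr (a / m)) / (a / m)) with (Rabs b / a).
  - destruct (Rle_dec 0 b) as [Hb|Hb].
    + rewrite Rabs_pos_eq by lra; reflexivity.
    + rewrite Rabs_left by lra; rewrite <- atan_opp; f_equal; field; lra.
  - replace (1 - Rsqr (a / m)) with (Rsqr (b / m)).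
    + rewrite sqrt_Rsqr_abs; unfold Rdiv; rewrite Rabs_mult, (Rabs_pos_eq (/ m));
        [field; lra | apply Rlt_le, Rinv_0_lt_compat, Hm].
    + unfold Rsqr; apply Rmult_eq_reg_r with (m ^ 2); [|nra].
      transitivity (b ^ 2); [field; lra|].
      transitivity (m ^ 2 - a ^ 2); [lra | field; lra].
Qed.

Lemma Cder_log_rhp (v : R -> C) (t : R) (l : C) :
  0 < Re (v t) -> Cder v t l -> Cder (fun t => log_rhp (v t)) t (l / v t)%C.
Proof.
  intros Hv [H1 H2].
  assert (E : (l / v t)%C =
    ((Re l * Re (v t) + Im l * Im (v t)) / (Re (v t) ^ 2 + Im (v t) ^ 2),
     (Im l * Re (v t) - Re l * Im (v t)) / (Re (v t) ^ 2 + Im (v t) ^ 2))).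
  { apply C_ext; simpl; unfold Re, Im in *; field; nra. }
  rewrite E; unfold log_rhp, Cmod; split; simpl Re; simpl Im.
  - set (a := fun t => Re (v t)) in *; set (b := fun t => Im (v t)) in *.
    assert (D1 : Derive (fun x : R => a x) t = Re l) by exact (is_derive_unique _ _ _ H1).
    assert (D2 : Derive (fun x : R => b x) t = Im l) by exact (is_derive_unique _ _ _ H2).
    change (is_derive (fun t => ln (sqrt (a t ^ 2 + b t ^ 2))) t
      ((Re l * a t + Im l * b t) / (a t ^ 2 + b t ^ 2))).
    change (0 < a t) in Hv.
    assert (P : 0 < a t ^ 2 + b t ^ 2) by nra.
    auto_derive.
    + split_ex_derive.
      * simpl in P; lra.
      * apply sqrt_lt_R0; simpl in P; lra.
    + rewrite D1, D2.
      replace (a t * (a t * 1) + b t * (b t * 1)) with (a t ^ 2 + b t ^ 2) by ring.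
      assert (S := sqrt_sqrt _ (Rlt_le _ _ P)).
      assert (Q := sqrt_lt_R0 _ P).
      set (r := sqrt (a t ^ 2 + b t ^ 2)) in *; rewrite <- S; field; lra.
  - set (a := fun t => Re (v t)) in *; set (b := fun t => Im (v t)) in *.
    assert (D1 : Derive (fun x : R => a x) t = Re l) by exact (is_derive_unique _ _ _ H1).
    assert (D2 : Derive (fun x : R => b x) t = Im l) by exact (is_derive_unique _ _ _ H2).
    change (is_derive (fun t => atan (b t / a t)) t
      ((Im l * a t - Re l * b t) / (a t ^ 2 + b t ^ 2))).
    change (0 < a t) in Hv.
    auto_derive.
    + split_ex_derive; lra.
    + rewrite D1, D2.
      field; nra.
Qed.

Lemma Cder_0_const (f : R -> C) :
  (forall t, 0 <= t <= 1 -> Cder f t 0) -> f 0 = f 1.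
Proof.
  intros H; apply C_ext.
  - apply (eq_is_derive (fun t => Re (f t)) 0 1); [|lra]; intros t Ht; apply (H t Ht).
  - apply (eq_is_derive (fun t => Im (f t)) 0 1); [|lra]; intros t Ht; apply (H t Ht).
Qed.

Lemma Re_mult_real (z : C) (t : R) (n : nat) : Re (z * RtoC t ^ n)%C = Re z * t ^ n.
Proof. rewrite <- RtoC_pow; simpl; unfold Re; ring. Qed.

Lemma Im_mult_real (z : C) (t : R) (n : nat) : Im (z * RtoC t ^ n)%C = Im z * t ^ n.
Proof. rewrite <- RtoC_pow; simpl; unfold Im; ring. Qed.

Lemma CV_radius_gt (a : nat -> R) (t y : R) :
  Rabs t < y -> ex_series (fun n => a n * y ^ n) -> Rbar_lt (Rabs t) (CV_radius a).
Proof.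
  intros H E; apply Rbar_lt_le_trans with y; [exact H|].
  apply Rbar_not_lt_le; intros L.
  apply (CV_disk_outside a y); [|now apply ex_series_lim_0].
  rewrite Rabs_pos_eq; [exact L|]; pose proof (Rabs_pos t); lra.
Qed.

Lemma Cder_power_series (a : nat -> C) (t y : R) (D : C) :
  Rabs t < y -> ex_series (fun m => Cmod (a m * RtoC y ^ m)%C) ->
  is_Cser (fun m => (NtoC m + 1) * a (S m) * RtoC t ^ m)%C D ->
  Cder (fun t => CSeries (fun m => a m * RtoC t ^ m)%C) t D.
Proof.
  intros Ht Ey HD.
  assert (Ef : forall f : C -> R, (forall z, Rabs (f z) <= Cmod z) ->
    (forall z u n, f (z * RtoC u ^ n)%C = f z * u ^ n) ->
    ex_series (fun m => f (a m) * y ^ m)).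
  { intros f Hf Hs; apply ex_series_Rabs.
    apply (@ex_series_le R_AbsRing R_CompleteNormedModule _
      (fun m => Cmod (a m * RtoC y ^ m)%C)); [|exact Ey].
    intros m; unfold norm; simpl; unfold abs; simpl.
    rewrite Rabs_Rabsolu, <- Hs; apply Hf. }
  assert (CR := CV_radius_gt _ t y Ht (Ef Re re_le_Cmod Re_mult_real)).
  assert (CI := CV_radius_gt _ t y Ht (Ef Im im_le_Cmod Im_mult_real)).
  destruct HD as [D1 D2].
  split.
  - apply is_derive_ext with (PSeries (fun m => Re (a m))).
    + intros u; apply Series_ext; intros n; symmetry; apply Re_mult_real.
    + replace (Re D) with (PSeries (PS_derive (fun m => Re (a m))) t);
        [now apply is_derive_PSeries|].
      apply is_series_unique.
      change (is_lim_seq (sum_n (fun n => PS_derive (fun m => Re (a m)) n * t ^ n)) (Re D)).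
      eapply is_lim_seq_ext; [|exact D1].
      intros n; cbv beta; rewrite Re_sum_n; apply sum_n_ext; intros m.
      rewrite Re_mult_real; unfold PS_derive; rewrite <- NtoC_S.
      unfold NtoC; simpl; unfold Re; ring.
  - apply is_derive_ext with (PSeries (fun m => Im (a m))).
    + intros u; apply Series_ext; intros n; symmetry; apply Im_mult_real.
    + replace (Im D) with (PSeries (PS_derive (fun m => Im (a m))) t);
        [now apply is_derive_PSeries|].
      apply is_series_unique.
      change (is_lim_seq (sum_n (fun n => PS_derive (fun m => Im (a m)) n * t ^ n)) (Im D)).
      eapply is_lim_seq_ext; [|exact D2].
      intros n; cbv beta; rewrite Im_sum_n; apply sum_n_ext; intros m.
      rewrite Im_mult_real; unfold PS_derive; rewrite <- NtoC_S.
      unfold NtoC; simpl; unfold Im; ring.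
Qed.

Lemma Fw_ex_abs (q x : C) : Cmod x < 1 -> ex_series (fun m => Cmod (wcoef q m * x ^ m)%C).
Proof.
  exact (family_ex_abs wcoef wcoefR wcoef_real wcoef_major wcoef_rec0 wcoef_recS wcoef_base q x).
Qed.

Lemma Cder_Fw (q x : C) (t : R) : 0 <= t <= 1 -> Cmod x < 1 ->
  Cder (fun t => Fw q (RtoC t * x)%C) t (x * q * Fd (q + 1) (RtoC t * x))%C.
Proof.
  intros Ht Hx.
  assert (Htx : Cmod (RtoC t * x)%C < 1).
  { rewrite Cmod_mult, Cmod_R, Rabs_pos_eq by lra; pose proof (Cmod_ge_0 x); nra. }
  apply Cder_ext with (fun t => CSeries (fun m => wcoef q m * x ^ m * RtoC t ^ m)%C).
  { intros u; unfold Fw, Fser, CSeries; f_equal; apply Series_ext; intros n;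
    rewrite Cpow_mult_l; f_equal; ring. }
  (* Some y > 1 with y |x| < 1, so that t = 1 is still interior to the disk of convergence. *)
  set (y := 1 + (1 - Cmod x) / 2).
  assert (Hy : Cmod (RtoC y * x)%C < 1).
  { pose proof (Cmod_ge_0 x).
    rewrite Cmod_mult, Cmod_R, Rabs_pos_eq by (unfold y; lra); unfold y; nra. }
  apply (Cder_power_series _ t y).
  - rewrite Rabs_pos_eq; unfold y; lra.
  - eapply ex_series_ext; [|exact (Fw_ex_abs q _ Hy)].
    intros n; cbv beta; f_equal; rewrite Cpow_mult_l; ring.
  - apply (is_Cser_ext (fun m => x * q * (dcoef (q + 1) m * (RtoC t * x) ^ m))%C).
    + intros m; rewrite Cpow_S, Cpow_mult_l.
      transitivity (x * (q * dcoef (q + 1) m) * (x ^ m * RtoC t ^ m))%C; [ring|].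
      rewrite <- wcoef_deriv; ring.
    + apply is_Cser_scal, Fd_correct, Htx.
Qed.

Open Scope C_scope.

Lemma Fser_at_0 (c : C -> nat -> C) (q : C) : Fser c q 0 = c q 0%nat.
Proof.
  apply is_Cser_unique, Cvg_ext with (fun _ => c q 0%nat); [|apply Cvg_const].
  intros n; induction n as [|n IH]; [rewrite sum_n_C0; simpl; ring|].
  rewrite sum_n_CS, <- IH, Cpow_S; ring.
Qed.

Lemma Fw_0 (x : C) : Fw 0 x = 1.
Proof.
  apply is_Cser_unique, Cvg_ext with (fun _ => RtoC 1); [|apply Cvg_const].
  intros n; induction n as [|n IH]; [rewrite sum_n_C0; simpl; ring|].
  rewrite sum_n_CS, <- IH; unfold wcoef, Cdiv; ring.
Qed.

Lemma Fw_m1 (x : C) : (Cmod x < 1)%R -> Fw (- (1)) x = half_1_sqrt x.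
Proof.
  intros Hx; rewrite Fw_shift by exact Hx.
  replace (- (1) + 1) with (RtoC 0) by ring; rewrite Fw_0; ring.
Qed.

(* The derivative of [t => Fw q (t x) v(t x)^q] vanishes, [v] itself being [Fw (-1)]. *)
Lemma Fw_power (q x : C) : (Cmod x < 1)%R ->
  Fw q x = Cpower (half_1_sqrt x) (- q).
Proof.
  intros Hx.
  assert (Htx : forall t, (0 <= t <= 1)%R -> (Cmod (RtoC t * x) < 1)%R).
  { intros t Ht; rewrite Cmod_mult, Cmod_R, Rabs_pos_eq by lra.
    pose proof (Cmod_ge_0 x); nra. }
  set (v := fun t : R => Fw (- (1)) (RtoC t * x)).
  assert (Hv : forall t, (0 <= t <= 1)%R -> (0 < Re (v t))%R).
  { intros t Ht; unfold v; rewrite Fw_m1 by auto.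
    assert (S := Re_half_1_sqrt_ge _ (Htx t Ht)).
    assert (T := half_1_sqrtR_bounds _ (conj (Cmod_ge_0 (RtoC t * x)) (Htx t Ht))); lra. }
  set (E := fun t : R => Fw q (RtoC t * x) * Cexp (q * log_rhp (v t))).
  assert (HE : E 0%R = E 1%R).
  { apply Cder_0_const; intros t Ht.
    assert (H1 := Cder_Fw q x t Ht Hx); assert (H2 := Cder_Fw (- (1)) x t Ht Hx).
    assert (H3 := Cder_log_rhp v t _ (Hv t Ht) H2).
    assert (H4 := Cder_Cexp _ t _ (Cder_scal q _ t _ H3)).
    assert (H5 := Cder_mult _ _ t _ _ H1 H4).
    match type of H5 with Cder _ _ ?l => replace (RtoC 0) with l; [exact H5|] end.
    assert (K1 := Fw_Fd q _ (Htx t Ht)); assert (K2 := Fw_Fd (- (1)) _ (Htx t Ht)).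
    replace (- (1) + 1) with (RtoC 0) in * by ring; rewrite Fw_0 in K2.
    assert (K3 := Fw_shift q _ (Htx t Ht)).
    assert (Nv := half_1_sqrt_neq0 _ (Htx t Ht)).
    assert (Ev : v t = half_1_sqrt (RtoC t * x)) by (unfold v; apply Fw_m1; auto).
    rewrite Ev in *; rewrite K3, <- K1.
    set (w := half_1_sqrt (RtoC t * x)) in *.
    set (e := Cexp _); set (d0 := Fd 0 _) in *; set (d1 := Fd (q + 1) _) in *.
    (* The last factor vanishes: [K2] is [Fw_Fd] at q = -1, that is 4 (2 w - 1) d0 = 1. *)
    transitivity (x * q * d1 * e * (1 - 4 * (2 * w - 1) * d0)); [field; exact Nv|].
    rewrite K2; ring. }
  assert (E0 : E 0%R = 1).
  { unfold E, v; rewrite Cmult_0_l; unfold Fw; rewrite !Fser_at_0; simpl.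
    unfold log_rhp; rewrite Cmod_1; simpl; rewrite ln_1.
    replace (0 / 1)%R with 0%R by field; rewrite atan_0.
    change (0%R, 0%R) with (RtoC 0); rewrite Cmult_0_r, Cexp_0; ring. }
  assert (E1 : E 1%R = Fw q x * Cexp (q * Clog (half_1_sqrt x))).
  { assert (H1 := Hv 1%R ltac:(lra)); unfold E, v in *; rewrite Cmult_1_l in *.
    rewrite Fw_m1 in * by exact Hx; now rewrite Clog_rhp. }
  rewrite E0, E1 in HE.
  unfold Cpower; replace (- q * Clog (half_1_sqrt x)) with (- (q * Clog (half_1_sqrt x))) by ring.
  rewrite Cexp_opp.
  transitivity (1 * / Cexp (q * Clog (half_1_sqrt x))); [|ring].
  rewrite HE; field; apply Cexp_neq0.
Qed.

(** * Rearrangement *)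

Open Scope R_scope.

Lemma sum_n_lim_0 (u : nat -> nat -> R) (K : nat) :
  (forall k, is_lim_seq (fun N => u N k) 0) -> is_lim_seq (fun N => sum_n (u N) K) 0.
Proof.
  intros H; induction K as [|K IH].
  - eapply is_lim_seq_ext; [|apply (H 0%nat)]; intros N; now rewrite sum_O.
  - apply is_lim_seq_ext with (fun N => sum_n (u N) K + u N (S K)).
    + intros N; now rewrite sum_Sn.
    + replace (Finite 0) with (Finite (0 + 0)) by (f_equal; ring).
      now apply is_lim_seq_plus'.
Qed.

(** Dominated convergence for a triangular array: the terms up to K converge one by one, and those
    beyond K contribute at most twice the tail of M. *)
Lemma tannery (g : nat -> nat -> C) (h : nat -> C) (M : nat -> R) :
  ex_series M -> (forall N k, (k <= N)%nat -> Cmod (g N k) <= M k) ->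
  (forall k, Cvg (fun N => g N k) (h k)) ->
  is_Cser h (CSeries h) /\ Cvg (fun N => sum_n (g N) N) (CSeries h).
Proof.
  intros HM Hg Hl.
  assert (Hh : forall k, Cmod (h k) <= M k).
  { intros k; apply (is_lim_seq_le_loc (fun N => Cmod (g N k)) (fun _ => M k) (Cmod (h k)) (M k)).
    - exists k; intros N HN; now apply Hg.
    - now apply Cvg_Cmod.
    - apply is_lim_seq_const. }
  assert (M0 : forall k, 0 <= M k) by (intros k; eapply Rle_trans; [apply Cmod_ge_0 | apply Hh]).
  assert (HS : is_Cser h (CSeries h)).
  { apply is_Cser_of_Cmod.
    apply (@ex_series_le R_AbsRing R_CompleteNormedModule _ M); [|exact HM].
    intros n; unfold norm; simpl; unfold abs; simpl.
    rewrite Rabs_pos_eq by apply Cmod_ge_0; apply Hh. }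
  split; [exact HS|].
  apply Cvg_ext with (fun N => sum_n h N + (sum_n (g N) N - sum_n h N))%C; [intros; ring|].
  rewrite <- (Cplus_0_r (CSeries h)); apply Cvg_plus; [exact HS|].
  apply Cvg_of_Cmod, is_lim_seq_spec; intros eps.
  assert (HM' := Series_correct _ HM).
  apply (is_lim_seq_spec (sum_n M) (Series M)) in HM'.
  destruct (HM' (mkposreal (eps / 4) ltac:(destruct eps; simpl; lra))) as [K HK]; simpl in HK.
  assert (HD := sum_n_lim_0 (fun N k => Cmod (g N k - h k)%C) K
    (fun k => Cvg_Cmod0 _ _ (Hl k))).
  apply is_lim_seq_spec in HD.
  destruct (HD (mkposreal (eps / 4) ltac:(destruct eps; simpl; lra))) as [N0 HN0]; simpl in HN0.
  exists (max K N0); intros N HN.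
  rewrite Rminus_0_r, Rabs_pos_eq by apply Cmod_ge_0.
  assert (E : (sum_n (g N) N - sum_n h N - 0)%C = sum_n (fun k => g N k - h k)%C N).
  { transitivity (1 * sum_n (g N) N + - (1) * sum_n h N)%C; [ring|].
    rewrite <- (sum_n_Clin3 _ _ (fun k => g N k - h k)%C 1 (- (1))%C 1);
      [ring | intros k; cbv beta; ring]. }
  rewrite E; eapply Rle_lt_trans; [apply Cmod_sum_n|].
  assert (B : forall n, (n + K <= N)%nat ->
    sum_n (fun k => Cmod (g N k - h k)%C) (n + K)
    <= sum_n (fun k => Cmod (g N k - h k)%C) K + 2 * (sum_n M (n + K) - sum_n M K)).
  { induction n as [|n IH]; intros Hn; [simpl; lra|].
    rewrite Nat.add_succ_l, !sum_Sn; unfold plus; simpl.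
    specialize (IH ltac:(lia)).
    assert (T : Cmod (g N (S (n + K)) - h (S (n + K)))%C <= 2 * M (S (n + K))).
    { unfold Cminus; eapply Rle_trans; [apply Cmod_triangle|]; rewrite Cmod_opp.
      specialize (Hg N (S (n + K)) ltac:(lia)); specialize (Hh (S (n + K))); lra. }
    lra. }
  specialize (B (N - K)%nat ltac:(lia)).
  replace (N - K + K)%nat with N in B by lia.
  eapply Rle_lt_trans; [exact B|].
  specialize (HN0 N ltac:(lia)); rewrite Rminus_0_r in HN0.
  apply Rle_lt_trans with (r2 := eps / 4 + 2 * (eps / 4)).
  - apply Rplus_le_compat; [eapply Rle_trans; [apply Rle_abs | lra]|].
    assert (sum_n M N <= Series M) by (apply sum_n_le_Series; auto).
    specialize (HK K ltac:(lia)); apply Rabs_def2 in HK; lra.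
  - destruct eps; simpl; lra.
Qed.

Open Scope C_scope.

(** The triangle k + m <= N summed by diagonals and by rows; the induction adds one diagonal. *)
Lemma sum_n_diagonal (A : nat -> C) (a : nat -> nat -> C) (N : nat) :
  sum_n (fun n => sum_n (fun k => A k * a k (n - k)%nat) n) N
  = sum_n (fun k => A k * sum_n (a k) (N - k)%nat) N.
Proof.
  induction N as [|N IH]; [now rewrite !sum_n_C0|].
  rewrite sum_n_CS, IH, !(sum_n_CS _ N), Nat.sub_diag, sum_n_C0, Cplus_assoc.
  f_equal.
  transitivity (1 * sum_n (fun k => A k * sum_n (a k) (S N - k)%nat) N); [|ring].
  rewrite (sum_n_ext_loc (fun k => A k * sum_n (a k) (S N - k)%nat)
    (fun k => A k * sum_n (a k) (N - k)%nat + A k * a k (S N - k)%nat)).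
  - rewrite (sum_n_Clin3 (fun k => A k * sum_n (a k) (N - k)%nat)
      (fun k => A k * a k (S N - k)%nat) _ 1 1 1); [ring | intros k; cbv beta; ring].
  - intros k Hk; rewrite Nat.sub_succ_l by exact Hk.
    rewrite sum_n_CS; as_C_eq; ring.
Qed.

(** A ratio test in the form t (N + n) <= t N q^n, which tolerates the vanishing terms that arise
    when a numerator parameter is a nonpositive integer. *)
Lemma hyp3F2_ex_abs (a1 a2 a3 b1 b2 : C) (U : R) :
  nonpole b1 -> nonpole b2 -> (0 <= U < 1)%R ->
  ex_series (fun k => Cmod (hyp3F2_term a1 a2 a3 b1 b2 (RtoC U) k)).
Proof.
  intros H1 H2 HU.
  set (rho := fun k => (NtoC k + a1) / (NtoC k + b1) * ((NtoC k + a2) / (NtoC k + b2))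
       * ((NtoC k + a3) / (NtoC k + 1)) * RtoC U).
  assert (Hr : Cvg rho (1 * 1 * 1 * RtoC U)).
  { apply Cvg_mult; [|apply Cvg_const].
    apply Cvg_mult; [apply Cvg_mult|]; apply Cvg_shift_ratio; auto.
    intros m; rewrite Cplus_comm; apply NtoC_S_neq0. }
  apply Cvg_Cmod in Hr; rewrite !Cmult_1_l, Cmod_R, Rabs_pos_eq in Hr by lra.
  apply is_lim_seq_spec in Hr.
  destruct (Hr (mkposreal ((1 - U) / 2) ltac:(lra))) as [N HN]; simpl in HN.
  set (q := ((1 + U) / 2)%R).
  set (t := fun k => Cmod (hyp3F2_term a1 a2 a3 b1 b2 (RtoC U) k)).
  assert (Ht : forall n, (t (N + n)%nat <= t N * q ^ n)%R).
  { induction n as [|n IH]; [rewrite Nat.add_0_r; simpl; lra|].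
    rewrite Nat.add_succ_r; unfold t; rewrite hyp3F2_term_S, Cmod_mult by assumption.
    fold (t (N + n)%nat); fold (rho (N + n)%nat).
    specialize (HN (N + n)%nat ltac:(lia)); apply Rabs_def2 in HN.
    simpl; rewrite (Rmult_comm q), <- Rmult_assoc.
    apply Rmult_le_compat; try apply Cmod_ge_0; [exact IH | unfold q; lra]. }
  apply (ex_series_incr_n t N).
  apply (@ex_series_le R_AbsRing R_CompleteNormedModule _ (fun n => t N * q ^ n)%R).
  - intros n; unfold norm; simpl; unfold abs; simpl.
    rewrite Rabs_pos_eq by apply Cmod_ge_0; apply Ht.
  - apply (ex_series_scal (t N) (fun n => q ^ n)%R), ex_series_geom.
    unfold q; rewrite Rabs_pos_eq; lra.
Qed.

Lemma hyp3F2_term_pow (a1 a2 a3 b1 b2 z : C) (k : nat) :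
  hyp3F2_term a1 a2 a3 b1 b2 z k = hyp3F2_term a1 a2 a3 b1 b2 1 k * z ^ k.
Proof. unfold hyp3F2_term, Cdiv; rewrite Cpow_1_l; ring. Qed.

Lemma hyp3F2_transform (a1 a2 a3 b1 b2 p x : C) :
  nonpole b1 -> nonpole b2 -> (Cmod x < 1)%R ->
  let z := - (x / (1 + Csqrt (1 - x)) ^ 2) in
  is_Cser (hyp3F2_term a1 a2 a3 b1 b2 z) (hyp3F2 a1 a2 a3 b1 b2 z) /\
  is_Cser (fun n => sum_n (fun k => hyp3F2_term a1 a2 a3 b1 b2 (- (1) / 4) k
                                    * wcoef (p + 2 * NtoC k) (n - k)) n * x ^ n)
    (Cpower (half_1_sqrt x) (- p) * hyp3F2 a1 a2 a3 b1 b2 z).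
Proof.
  intros Hb1 Hb2 Hx z.
  set (v := half_1_sqrt x); set (c := hyp3F2_term a1 a2 a3 b1 b2).
  assert (Hv := half_1_sqrt_neq0 x Hx); fold v in Hv.
  assert (Ez : z = - (1) / 4 * x / (v * v)).
  { unfold z; replace (1 + Csqrt (1 - x)) with (2 * v) by (unfold v, half_1_sqrt; field).
    simpl; field; exact Hv. }
  assert (HV := half_1_sqrtR_bounds _ (conj (Cmod_ge_0 x) Hx)).
  assert (HVm := half_1_sqrtR_mul (Cmod x) ltac:(lra)).
  destruct (Fser_bound wcoef wcoefR wcoef_real wcoef_major wcoef_rec0 wcoef_recS wcoef_base x Hx)
    as [B [B0 HB]].
  set (V := half_1_sqrtR (Cmod x)) in *.
  (* U bounds |z| and is the point at which the double series is dominated. By |x| / 4 = V (1 - V)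
     it equals (1 - V) / V, and V > 1/2. *)
  set (U := (Cmod x / (4 * V ^ 2))%R).
  assert (HU : (0 <= U < 1)%R).
  { unfold U; assert (0 < 4 * V ^ 2)%R by nra; pose proof (Cmod_ge_0 x); split.
    - apply Rmult_le_pos; [assumption | now apply Rlt_le, Rinv_0_lt_compat].
    - apply Rmult_lt_reg_r with (4 * V ^ 2)%R; [assumption|].
      unfold Rdiv; rewrite Rmult_assoc, Rinv_l by lra; nra. }
  destruct (Cmod_le_INR p) as [K HK].
  assert (HF : forall k, Fw p x = (v * v) ^ k * Fw (p + 2 * NtoC k) x).
  { induction k as [|k IH].
    - rewrite NtoC_0, Cmult_0_r, Cplus_0_r; simpl; ring.
    - rewrite IH, (Fw_shift (p + 2 * NtoC k) x Hx), (Fw_shift _ x Hx), NtoC_S, Cpow_S.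
      replace (p + 2 * NtoC k + 1 + 1) with (p + 2 * (NtoC k + 1)) by ring.
      fold v; ring. }
  set (A := fun k => c (- (1) / 4) k * x ^ k).
  set (a := fun k m => wcoef (p + 2 * NtoC k) m * x ^ m).
  (* By [Fser_bound] the inner sums are at most B / V^(K + 2 k); multiplied by |A k| this is, up to
     a constant, a term of the absolutely convergent 3F2 at U. *)
  set (Mk := fun k => (B * / V ^ K * Cmod (c (RtoC U) k))%R).
  assert (EM : ex_series Mk).
  { apply (ex_series_scal (B * / V ^ K)%R (fun k => Cmod (c (RtoC U) k))).
    now apply hyp3F2_ex_abs. }
  assert (HA : forall k, (Cmod (A k) * (B * / V ^ (K + 2 * k)) = Mk k)%R).
  { intros k; unfold A, Mk, c.
    rewrite (hyp3F2_term_pow _ _ _ _ _ (- (1) / 4)), (hyp3F2_term_pow _ _ _ _ _ (RtoC U)).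
    rewrite !Cmod_mult, !Cmod_pow, Cmod_R, (Rabs_pos_eq U) by lra.
    rewrite Cmod_div, Cmod_opp, Cmod_1, Cmod_R, (Rabs_pos_eq 4)
      by (try (intros E; apply RtoC_inj in E); lra).
    unfold U, Rdiv; rewrite pow_add, pow_mult, Rinv_mult, !Rpow_mult_distr, !pow_inv.
    assert (V ^ K <> 0)%R by (apply pow_nonzero; lra).
    assert ((V ^ 2) ^ k <> 0)%R by (apply pow_nonzero; nra).
    assert (4 ^ k <> 0)%R by (apply pow_nonzero; lra).
    rewrite pow1, (Rpow_mult_distr 4); field; auto. }
  assert (HK2 : forall k, (Cmod (p + 2 * NtoC k)%C <= INR (K + 2 * k))%R).
  { intros k; eapply Rle_trans; [apply Cmod_triangle|].
    unfold NtoC; rewrite Cmod_mult, !Cmod_R, (Rabs_pos_eq _ (pos_INR k)), (Rabs_pos_eq 2) by lra.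
    rewrite plus_INR, mult_INR; simpl (INR 2); lra. }
  (* By [sum_n_diagonal], the sum of this array over k <= N is the N-th partial sum of the
     rearranged power series. *)
  destruct (tannery (fun N k => A k * sum_n (a k) (N - k)%nat)
    (fun k => A k * Fw (p + 2 * NtoC k) x) Mk EM) as [T1 T2].
  - intros N k _; rewrite <- HA, Cmod_mult.
    apply Rmult_le_compat_l; [apply Cmod_ge_0 | now apply HB].
  - intros k; apply Cvg_scal, (Cvg_incr_n _ k).
    apply Cvg_ext with (sum_n (a k)); [intros n; now rewrite Nat.add_sub|].
    apply Fw_correct, Hx.
  - assert (Eh : forall k, A k * Fw (p + 2 * NtoC k) x = Fw p x * c z k).
    { intros k; unfold A, c.
      rewrite (hyp3F2_term_pow _ _ _ _ _ (- (1) / 4)), (hyp3F2_term_pow _ _ _ _ _ z).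
      assert (Nv : (v * v) ^ k <> 0) by (apply Cpow_nz, Cmult_neq_0; exact Hv).
      assert (Zk : z ^ k * (v * v) ^ k = (- (1) / 4) ^ k * x ^ k).
      { rewrite <- !Cpow_mult_l; f_equal; rewrite Ez; field; exact Hv. }
      rewrite (HF k).
      transitivity (hyp3F2_term a1 a2 a3 b1 b2 1 k * (z ^ k * (v * v) ^ k)
        * Fw (p + 2 * NtoC k) x); [rewrite Zk; ring | ring]. }
    assert (Tc : is_Cser (c z) (hyp3F2 a1 a2 a3 b1 b2 z)).
    { apply is_Cser_of_Cmod.
      apply (@ex_series_le R_AbsRing R_CompleteNormedModule _ (fun k => Cmod (c (RtoC U) k)));
        [|now apply hyp3F2_ex_abs].
      intros k; unfold norm; simpl; unfold abs; simpl.
      rewrite Rabs_pos_eq by apply Cmod_ge_0; unfold c.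
      rewrite (hyp3F2_term_pow _ _ _ _ _ z), (hyp3F2_term_pow _ _ _ _ _ (RtoC U)).
      rewrite !Cmod_mult, !Cmod_pow; apply Rmult_le_compat_l; [apply Cmod_ge_0|].
      apply pow_incr; split; [apply Cmod_ge_0|].
      rewrite Cmod_R, (Rabs_pos_eq U), Ez by lra.
      rewrite Cmod_div, !Cmod_mult, Cmod_div, Cmod_opp, Cmod_1, Cmod_R, (Rabs_pos_eq 4)
        by (try apply Cmult_neq_0; try (intros E; apply RtoC_inj in E); auto; lra).
      assert (HVv : (V <= Cmod v)%R).
      { eapply Rle_trans; [apply (Re_half_1_sqrt_ge x Hx)|].
        eapply Rle_trans; [apply Rle_abs | apply re_le_Cmod]. }
      unfold U.
      replace (Cmod x / (4 * V ^ 2))%R with (1 / 4 * Cmod x * / (V * V))%R by (field; lra).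
      apply Rmult_le_compat_l; [pose proof (Cmod_ge_0 x); lra|].
      apply Rinv_le_contravar; nra. }
    split; [exact Tc|].
    assert (Es : CSeries (fun k => A k * Fw (p + 2 * NtoC k) x)
      = Cpower v (- p) * hyp3F2 a1 a2 a3 b1 b2 z).
    { apply is_Cser_unique, is_Cser_ext with (fun k => Fw p x * c z k).
      - intros k; symmetry; apply Eh.
      - rewrite (Fw_power p x Hx); now apply is_Cser_scal. }
    rewrite <- Es; apply Cvg_ext with (2 := T2).
    intros N; rewrite <- sum_n_diagonal; apply sum_n_ext; intros n.
    assert (G : forall n0, (n0 <= n)%nat ->
      sum_n (fun k => A k * a k (n - k)%nat) n0
      = x ^ n * sum_n (fun k => c (- (1) / 4) k * wcoef (p + 2 * NtoC k) (n - k)) n0).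
    { induction n0 as [|n0 IH]; intros Hn.
      - rewrite !sum_n_C0; unfold A, a; rewrite Nat.sub_0_r.
        as_C_eq; simpl; ring.
      - rewrite !sum_n_CS, IH by lia; unfold A, a.
        replace (x ^ n) with (x ^ S n0 * x ^ (n - S n0));
          [as_C_eq; ring|].
        rewrite <- Cpow_add_r; f_equal; lia. }
    rewrite (G n) by lia; unfold c.
    as_C_eq; ring.
Qed.

(** * Coefficients of the transformation formula *)

Lemma Poch_add (a : C) (k m : nat) : Poch a (k + m) = Poch a k * Poch (a + NtoC k) m.
Proof.
  induction m as [|m IH]; [rewrite Nat.add_0_r; simpl; ring|].
  rewrite Nat.add_succ_r; simpl; rewrite IH, NtoC_plus; ring.
Qed.

Lemma Poch_neg_fact (k m : nat) :
  Poch (- NtoC (k + m)) k * NtoC (fact m) = (- (1)) ^ k * NtoC (fact (k + m)).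
Proof.
  revert m; induction k as [|k IH]; intros m; [simpl; ring|].
  rewrite Nat.add_succ_l, <- Nat.add_succ_r.
  simpl (Poch _ (S k)); rewrite Cpow_S, <- (Cmult_assoc (- (1))), <- IH, NtoC_fact_S.
  rewrite NtoC_plus, NtoC_S; ring.
Qed.

(** 2 z1 + 2 k is twice z1 + k, and 2 z1 + 2 k + 1 is twice z2 + k. *)
Lemma nonpole_half (z1 z2 t : C) :
  nonpole z1 -> nonpole z2 -> t = 2 * z1 -> z2 = z1 + 1 / 2 -> nonpole t.
Proof.
  intros H1 H2 -> E2 m E.
  destruct (Nat.Even_or_Odd m) as [[k ->]|[k ->]].
  - apply (H1 k); rewrite NtoC_mult, NtoC_2 in E.
    transitivity ((2 * z1 + 2 * NtoC k) / 2); [field | rewrite E; field].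
  - apply (H2 k); rewrite NtoC_plus, NtoC_mult, NtoC_2, NtoC_1 in E; rewrite E2.
    transitivity ((2 * z1 + (2 * NtoC k + 1)) / 2); [field | rewrite E; field].
Qed.

(** The parameters d - 1/2 over d + 1/2 make this work: (d - 1/2)_k / (d + 1/2)_k = (d - 1/2) / (d -
    1/2 + k), whose denominator cancels the leading factor 2 d - 1 + 2 k of [wcoef]. For m > 0 and n
    = k + m, the symbol left in [wcoef] is (2 d + n)_n / (2 d + n)_k without the last factor 2 (d -
    1/2 + n), which (d - 1/2)_n / (d + 1/2)_n absorbs. *)
Lemma coefficient_term (a b d f : C) (k m : nat) :
  nonpole (d + 1 / 2) -> nonpole (2 * d) -> nonpole f -> d - 1 / 2 + NtoC (k + m) <> 0 ->
  hyp3F2_term b (d - 1 / 2) a (d + 1 / 2) f (- (1) / 4) k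
    * wcoef (2 * d - 1 + 2 * NtoC k) m
  = Poch (d - 1 / 2) (k + m)
    / (4 ^ (k + m) * Poch (d + 1 / 2) (k + m) * NtoC (fact (k + m)))
    * Poch (2 * d + NtoC (k + m)) (k + m)
    * term1 a b (- NtoC (k + m)) (2 * d + NtoC (k + m)) f k.
Proof.
  intros Hd H2d Hf Hn.
  set (n := (k + m)%nat) in *.
  assert (Pd : forall l, Poch (d - 1 / 2) l * (d - 1 / 2 + NtoC l)
                         = (d - 1 / 2) * Poch (d + 1 / 2) l).
  { intros l; rewrite Poch_shift; do 2 f_equal; field. }
  assert (Nk := nonpole_Poch _ k Hd); assert (Nn := nonpole_Poch _ n Hd).
  assert (Ne := nonpole_Poch _ k (nonpole_plus _ n H2d)).
  assert (Nf := nonpole_Poch _ k Hf).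
  assert (Fk := NtoC_fact_neq0 k); assert (Fm := NtoC_fact_neq0 m).
  assert (Fn := NtoC_fact_neq0 n).
  assert (E4 : RtoC 4 ^ n = 4 ^ k * 4 ^ m) by (unfold n; apply Cpow_add_r).
  assert (N4k := C4_pow_neq0 k); assert (N4m := C4_pow_neq0 m).
  assert (Ek : (- (1) / 4) ^ k = (- (1)) ^ k / 4 ^ k).
  { unfold Cdiv; rewrite Cpow_mult_l, Cpow_inv; [reflexivity|].
    intros E; apply RtoC_inj in E; lra. }
  assert (Ep : Poch (- NtoC n) k = (- (1)) ^ k * NtoC (fact n) / NtoC (fact m)).
  { unfold n; rewrite <- Poch_neg_fact; field; exact Fm. }
  assert (Ea : Poch (2 * d + NtoC n) n
    = Poch (2 * d + NtoC n) k * Poch (2 * d + NtoC n + NtoC k) m)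
    by (unfold n at 2; apply Poch_add).
  unfold hyp3F2_term, term1, hyp3F2_term; rewrite Ek, Ep, Ea, E4, Cpow_1_l.
  assert (En : Poch (d - 1 / 2) n
    = (d - 1 / 2) * Poch (d + 1 / 2) n / (d - 1 / 2 + NtoC n))
    by (rewrite <- Pd; set (D := d - 1 / 2 + NtoC n) in *; field; exact Hn).
  destruct m as [|m].
  - assert (Enk : n = k) by (unfold n; lia); clearbody n; subst n.
    change (fact 0) with 1%nat; rewrite NtoC_1; cbn [Poch Cpow wcoef].
    field; repeat split; auto.
  - rewrite En; unfold wcoef.
    assert (Nm : NtoC n = NtoC k + NtoC m + 1)
      by (unfold n; rewrite NtoC_plus, NtoC_S; ring).
    replace (2 * d - 1 + 2 * NtoC k + NtoC m + 2) with (2 * d + NtoC n + NtoC k)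
      by (rewrite Nm; ring).
    simpl (Poch _ (S m)).
    (* If d - 1/2 + k = 0 the cancellation is impossible. As [nonpole (d + 1 / 2)] then forces k =
       0, both sides vanish with d - 1/2. *)
    destruct (Ceq_dec (d - 1 / 2 + NtoC k) 0) as [Hk|Hk]; cycle 1.
    + assert (Ek' : Poch (d - 1 / 2) k
        = (d - 1 / 2) * Poch (d + 1 / 2) k / (d - 1 / 2 + NtoC k))
        by (rewrite <- Pd; set (D' := d - 1 / 2 + NtoC k) in *; field; exact Hk).
      rewrite Ek'.
      set (Q := Poch (2 * d + NtoC n + NtoC k) m).
      set (e := Poch (2 * d + NtoC n) k) in *.
      replace (2 * d + NtoC n + NtoC k + NtoC m) with (2 * (d - 1 / 2 + NtoC n))
        by (rewrite Nm; field).
      set (D := d - 1 / 2 + NtoC n) in *.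
      replace (2 * d - 1 + 2 * NtoC k) with (2 * (d - 1 / 2 + NtoC k)) by field.
      set (D' := d - 1 / 2 + NtoC k) in *.
      field; repeat split; auto.
    + assert (k = 0%nat).
      { destruct k as [|k]; [reflexivity|]; exfalso; apply (Hd k); rewrite NtoC_S in Hk.
        rewrite <- Hk; field. }
      subst k; rewrite NtoC_0, Cplus_0_r in Hk; rewrite Hk; rewrite NtoC_0.
      replace (2 * d - 1 + 2 * 0) with (2 * (d - 1 / 2)) by field; rewrite Hk.
      unfold Cdiv; ring.
Qed.

Lemma coefficient_sum (i j : Z) (b d : C) (n : nat) :
  nonpole (d + 1 / 2) -> nonpole (2 * d) -> nonpole (2 * d - b + ZtoC j) ->
  sum_n (fun k => hyp3F2_term b (d - 1 / 2) (2 * d - 1 - ZtoC i) (d + 1 / 2)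
                    (2 * d - b + ZtoC j) (- (1) / 4) k
                  * wcoef (2 * d - 1 + 2 * NtoC k) (n - k)) n
  = Poch (d - 1 / 2) n
    / (4 ^ n * Poch (d + 1 / 2) n * NtoC (fact n) * Poch (2 * d - b + ZtoC j) n)
    * dixon i j d b n.
Proof.
  intros Hd H2d Hf.
  set (a := 2 * d - 1 - ZtoC i); set (f := 2 * d - b + ZtoC j) in *.
  unfold dixon, dixon_sum; fold a f.
  assert (Nf := nonpole_Poch _ n Hf); assert (Nn := nonpole_Poch _ n Hd).
  assert (Fn := NtoC_fact_neq0 n); assert (N4 := C4_pow_neq0 n).
  (* At n = 0 the number d - 1/2 + n may vanish, which [coefficient_term] excludes. *)
  destruct n as [|n].
  - rewrite !sum_n_C0; unfold hyp3F2_term, term1, hyp3F2_term; simpl; unfold NtoC; simpl.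
    as_C_eq; field.
  - assert (Hn : d - 1 / 2 + NtoC (S n) <> 0).
    { rewrite NtoC_S; intros E; apply (Hd n); rewrite <- E; field. }
    set (c := Poch (d - 1 / 2) (S n) / (4 ^ S n * Poch (d + 1 / 2) (S n) * NtoC (fact (S n)))
              * Poch (2 * d + NtoC (S n)) (S n)).
    transitivity (c * sum_n (term1 a b (- NtoC (S n)) (2 * d + NtoC (S n)) f) (S n)).
    + transitivity (sum_n (fun k => c * term1 a b (- NtoC (S n)) (2 * d + NtoC (S n)) f k) (S n)).
      * apply sum_n_ext_loc; intros k Hk.
        assert (T := coefficient_term a b d f k (S n - k) Hd H2d Hf).
        replace (k + (S n - k))%nat with (S n) in T by lia.
        exact (T Hn).
      * exact (sum_n_mult_l (K := C_Ring) c _ (S n)).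
    + as_C_eq.
      unfold c; field; repeat split; auto.
Qed.

Lemma Gamma_gratio (y z : C) (m : Z) :
  nonpole y -> nonpole z -> z = y + ZtoC m -> Gamma z = gratio y m * Gamma y.
Proof.
  intros Hy Hz E; destruct m as [|p|p]; unfold gratio.
  - rewrite E; change (ZtoC 0) with (RtoC 0); rewrite Cplus_0_r; ring.
  - rewrite E; replace (ZtoC (Zpos p)) with (NtoC (Pos.to_nat p)).
    + now apply Gamma_Poch.
    + unfold NtoC, ZtoC; rewrite INR_IZR_INZ, positive_nat_Z; reflexivity.
  - assert (Ep : ZtoC (Zpos p) = NtoC (Pos.to_nat p))
      by (unfold NtoC, ZtoC; rewrite INR_IZR_INZ, positive_nat_Z; reflexivity).
    assert (En : ZtoC (Zneg p) = - ZtoC (Zpos p)).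
    { unfold ZtoC; rewrite <- RtoC_opp, <- opp_IZR; reflexivity. }
    replace (y - ZtoC (Zpos p)) with z by (rewrite E, En; ring).
    replace y with (z + NtoC (Pos.to_nat p)) by (rewrite E, En, Ep; ring).
    rewrite Gamma_Poch by exact Hz; field; now apply nonpole_Poch.
Qed.

(** Here z may be a pole; then m > 0, and [Poch z m] vanishes together with [rGamma z]. *)
Lemma rGamma_gratio (y z : C) (m : Z) :
  nonpole y -> z = y - ZtoC m -> rGamma z = gratio z m * / Gamma y.
Proof.
  intros Hy E; destruct m as [|p|p]; unfold gratio.
  - rewrite E; change (ZtoC 0) with (RtoC 0); unfold Cminus; rewrite Copp_0, Cplus_0_r.
    rewrite rGamma_nonpole by exact Hy; ring.
  - rewrite (rGamma_Poch z (Pos.to_nat p)), <- rGamma_nonpole by exact Hy.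
    do 2 f_equal; rewrite E; unfold NtoC, ZtoC; rewrite INR_IZR_INZ, positive_nat_Z; ring.
  - assert (Ep : ZtoC (Zpos p) = NtoC (Pos.to_nat p))
      by (unfold NtoC, ZtoC; rewrite INR_IZR_INZ, positive_nat_Z; reflexivity).
    assert (En : ZtoC (Zneg p) = - ZtoC (Zpos p)).
    { unfold ZtoC; rewrite <- RtoC_opp, <- opp_IZR; reflexivity. }
    replace (z - ZtoC (Zpos p)) with y by (rewrite E, En; ring).
    replace z with (y + NtoC (Pos.to_nat p)) by (rewrite E, En, Ep; ring).
    rewrite rGamma_nonpole, Gamma_Poch by (try apply nonpole_plus; exact Hy).
    assert (H1 := Gamma_neq0 y Hy); assert (H2 := nonpole_Poch y (Pos.to_nat p) Hy).
    field; auto.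
Qed.

(** Parity decides which of z and z + 1/2 belongs to the A-term, but products over both do not
    depend on the order. *)
Definition pair_half (z z1 z2 : C) : Prop :=
  (z1 = z /\ z2 = z + 1 / 2) \/ (z1 = z + 1 / 2 /\ z2 = z).

Lemma pair_half_prod (g : C -> C) (z z1 z2 : C) :
  pair_half z z1 z2 -> g z * g (z + 1 / 2) = g z1 * g z2.
Proof. intros [[-> ->]|[-> ->]]; ring. Qed.

Lemma pair_half_nonpole (z z1 z2 : C) :
  pair_half z z1 z2 -> nonpole z1 -> nonpole z2 -> nonpole z /\ nonpole (z + 1 / 2).
Proof. intros [[-> ->]|[-> ->]]; auto. Qed.

Lemma pair_half_nonpole' (z z1 z2 : C) :
  pair_half z z1 z2 -> nonpole z -> nonpole (z + 1 / 2) -> nonpole z1 /\ nonpole z2.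
Proof. intros [[-> ->]|[-> ->]]; auto. Qed.

(** The prefactor supplies Gamma (dA) Gamma (dB) / (Gamma (yA) Gamma (yB)). In the A-term g = yB and
    q = dB cancel exactly, which leaves integer shifts of dA and yA; the B-term is the same with A
    and B exchanged. *)
Lemma Gamma_block (d dA dB y yA yB g z r q : C) (m e : Z) (n : nat) :
  pair_half d dA dB -> pair_half y yA yB ->
  nonpole dA -> nonpole dB -> nonpole yA -> nonpole yB -> nonpole z ->
  g = yB -> z = yA + ZtoC m -> r = dA - ZtoC e -> q = dB ->
  Gamma d * Gamma (d + 1 / 2) * rGamma y * rGamma (y + 1 / 2)
  * (Poch d n * Poch (d + 1 / 2) n)
  * (Gamma g * Gamma z * rGamma r * rGamma q * (Poch z n / Poch q n))
  = Poch dA n * gratio r e * (Poch yA n * gratio (yA + NtoC n) m).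
Proof.
  intros Pd Py HdA HdB HyA HyB Hz -> Ez Er ->.
  rewrite <- (Cmult_assoc (Gamma d * _)).
  rewrite (pair_half_prod Gamma _ _ _ Pd), (pair_half_prod (fun z => Poch z n) _ _ _ Pd),
    (pair_half_prod rGamma _ _ _ Py).
  rewrite (rGamma_gratio dA r e HdA Er), !rGamma_nonpole by assumption.
  assert (E : Gamma z * Poch z n = gratio (yA + NtoC n) m * (Poch yA n * Gamma yA)).
  { rewrite <- (Gamma_Poch yA n HyA), <- (Gamma_gratio (yA + NtoC n) (z + NtoC n) m);
      auto using nonpole_plus.
    - rewrite Gamma_Poch by exact Hz; ring.
    - rewrite Ez; ring. }
  assert (N1 := Gamma_neq0 _ HdA); assert (N2 := Gamma_neq0 _ HdB).
  assert (N3 := Gamma_neq0 _ HyA); assert (N4 := Gamma_neq0 _ HyB).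
  assert (N5 := nonpole_Poch _ n HdB).
  transitivity (Poch dA n * gratio r e * / Gamma yA * (Gamma z * Poch z n)).
  - field; repeat split; auto.
  - rewrite E; field; exact N3.
Qed.

(** Turns i and j into numerals, so that quotients and remainders compute. *)
Lemma small_index_ind (P : Z -> Z -> Prop) :
  P (-3)%Z 0%Z -> P (-3)%Z 1%Z -> P (-3)%Z 2%Z -> P (-3)%Z 3%Z ->
  P (-2)%Z 0%Z -> P (-2)%Z 1%Z -> P (-2)%Z 2%Z -> P (-2)%Z 3%Z ->
  P (-1)%Z 0%Z -> P (-1)%Z 1%Z -> P (-1)%Z 2%Z -> P (-1)%Z 3%Z ->
  P 0%Z 0%Z -> P 0%Z 1%Z -> P 0%Z 2%Z -> P 0%Z 3%Z ->
  P 1%Z 0%Z -> P 1%Z 1%Z -> P 1%Z 2%Z -> P 1%Z 3%Z ->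
  P 2%Z 0%Z -> P 2%Z 1%Z -> P 2%Z 2%Z -> P 2%Z 3%Z ->
  P 3%Z 0%Z -> P 3%Z 1%Z -> P 3%Z 2%Z -> P 3%Z 3%Z ->
  forall i j, (-3 <= i <= 3)%Z -> (0 <= j <= 3)%Z -> P i j.
Proof.
  intros; assert (Hi : (i = -3 \/ i = -2 \/ i = -1 \/ i = 0 \/ i = 1 \/ i = 2 \/ i = 3)%Z) by lia.
  assert (Hj : (j = 0 \/ j = 1 \/ j = 2 \/ j = 3)%Z) by lia.
  destruct Hi as [->|[->|[->|[->|[->|[->| ->]]]]]];
  destruct Hj as [->|[->|[->| ->]]]; assumption.
Qed.

Ltac close_index :=
  unfold floor_half;
  repeat match goal with
  | |- context [ZtoC ?a] => vm_change a
  end; unfold ZtoC; field.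

(** Brings the arguments in [rhs_term] into the form asked for by [Gamma_block], so that the Gamma
    functions are treated uniformly in (i, j). *)
Lemma index_equations (d b : C) (i j : Z) : (-3 <= i <= 3)%Z -> (0 <= j <= 3)%Z ->
  let dA := d + ZtoC (i mod 2) / 2 in
  let dB := d + ZtoC (1 - i mod 2) / 2 in
  let yA := d - b + ZtoC (j + 1 - (i + j) mod 2) / 2 in
  let yB := d - b + ZtoC (j + (i + j) mod 2) / 2 in
  pair_half d dA dB /\ pair_half (d - b + 1 / 2 * ZtoC j) yA yB /\
  d - b - ZtoC i / 2 + floor_half (i + j + 1) = yB /\
  d - b + ZtoC i / 2 + 1 / 2 + floor_half (j + 1)
    = yA + ZtoC ((i + 2 * ((j + 1) / 2) - j + (i + j) mod 2) / 2) /\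
  d - ZtoC i / 2 = dA - ZtoC ((i + i mod 2) / 2) /\
  d + 1 / 2 - ZtoC i / 2 + floor_half i = dB /\
  d - b + 1 / 2 - ZtoC i / 2 + floor_half (i + j) = yA /\
  d - b + ZtoC i / 2 + 1 + floor_half j
    = yB + ZtoC ((i + 2 + 2 * (j / 2) - j - (i + j) mod 2) / 2) /\
  d - ZtoC i / 2 - 1 / 2 = dB - ZtoC ((i + 2 - i mod 2) / 2) /\
  d - ZtoC i / 2 + floor_half (i + 1) = dA.
Proof.
  intros hi hj dA dB yA yB; unfold dA, dB, yA, yB; clear dA dB yA yB.
  pattern i, j; revert i j hi hj; apply small_index_ind;
  (split; [first [left; split; close_index | right; split; close_index]|]);
  (split; [first [left; split; close_index | right; split; close_index]|]);
  repeat split; close_index.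
Qed.

Lemma Pochs_nonpole (z : C) : (forall n, Poch z n <> 0) -> nonpole z.
Proof. intros H m E; apply (H (S m)); simpl; rewrite E; ring. Qed.

Lemma regular_of_defined (i j : Z) (b d : C) (n : nat) :
  (-3 <= i <= 3)%Z -> (0 <= j <= 3)%Z ->
  Gammas_defined i j b d -> Pochs_defined i j b d -> regular i j d b n.
Proof.
  intros hi hj (G1 & G2 & G3 & G4 & G5 & G6 & G7) HP.
  apply nonpole_not_pole in G1, G2, G4, G5, G6, G7.
  assert (H2d : nonpole (2 * d)) by (apply (nonpole_half d (d + 1 / 2)); auto).
  split; [now apply nonpole_plus|].
  split; [apply Pochs_nonpole; intros k; apply (HP k)|].
  split; [|split; [|now intros _]].
  - clear HP G3; revert G4 G5 G6 G7.
    pattern i, j; revert i j hi hj; apply small_index_ind; intros G4 G5 G6 G7;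
    (* The form is twice the lower of two Gamma arguments that differ by 1/2; the pair and its order
       depend on (i, j). *)
    first [ apply (nonpole_half _ _ _ G5 G7); close_index
          | apply (nonpole_half _ _ _ G7 G5); close_index
          | apply (nonpole_half _ _ _ G4 G6); close_index
          | apply (nonpole_half _ _ _ G6 G4); close_index ].
  - intros k Hk1 Hk2 E; apply G3; exists (Z.to_nat (i + j - Z.of_nat k)).
    rewrite Z.abs_eq by lia; rewrite E; unfold NtoC, ZtoC.
    rewrite !INR_IZR_INZ, Z2Nat.id by lia; rewrite minus_IZR, plus_IZR.
    rewrite RtoC_minus, RtoC_plus, plus_IZR, RtoC_plus; field.
Qed.

Lemma evaluated_all (i j : Z) :
  (-3 <= i <= 3)%Z -> (0 <= j <= 3)%Z ->
  ~ In (i, j) [(1, 3); (2, 3); (3, 1); (3, 2); (3, 3)]%Z -> evaluated i j.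
Proof.
  intros hi hj; pattern i, j; revert i j hi hj; apply small_index_ind; intros H;
  first [ exfalso; apply H; simpl; solve [auto 8]
    | exact evaluated_m3_0 | exact evaluated_m3_1 | exact evaluated_m3_2 | exact evaluated_m3_3
    | exact evaluated_m2_0 | exact evaluated_m2_1 | exact evaluated_m2_2 | exact evaluated_m2_3
    | exact evaluated_m1_0 | exact evaluated_m1_1 | exact evaluated_m1_2 | exact evaluated_m1_3
    | exact evaluated_0_0 | exact evaluated_0_1 | exact evaluated_0_2 | exact evaluated_0_3
    | exact evaluated_1_0 | exact evaluated_1_1 | exact evaluated_1_2
    | exact evaluated_2_0 | exact evaluated_2_1 | exact evaluated_2_2 | exact evaluated_3_0 ].
Qed.

Lemma fact_ratio (n h : nat) :
  NtoC (fact n) / NtoC (fact (n + h)) = / Poch (NtoC n + 1) h.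
Proof.
  assert (E : NtoC (fact (n + h)) = NtoC (fact n) * Poch (NtoC n + 1) h).
  { induction h as [|h IH]; [rewrite Nat.add_0_r; simpl; ring|].
    rewrite Nat.add_succ_r, NtoC_fact_S, IH, NtoC_plus; simpl; ring. }
  assert (H1 := NtoC_fact_neq0 (n + h)); assert (H2 := NtoC_fact_neq0 n).
  rewrite E in *; field; split; [|exact H2].
  intros Z; apply H1; rewrite Z; ring.
Qed.

Lemma half_plus_abs (k : Z) : 1 / 2 * ZtoC (k + Z.abs k) = ZtoC ((k + Z.abs k) / 2).
Proof.
  destruct (Z_le_gt_dec 0 k) as [H|H].
  - rewrite Z.abs_eq by exact H; replace (k + k)%Z with (k * 2)%Z by ring.
    rewrite Z.div_mul by lia; unfold ZtoC; rewrite mult_IZR, RtoC_mult; field.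
  - rewrite Z.abs_neq, Z.add_opp_diag_r by lia; change (0 / 2)%Z with 0%Z.
    unfold ZtoC; field.
Qed.

Lemma coefficient_rhs (i j : Z) (b d x : C) (n : nat) :
  (-3 <= i <= 3)%Z -> (0 <= j <= 3)%Z ->
  Gammas_defined i j b d -> Pochs_defined i j b d ->
  rhs_prefactor i j b d * rhs_term i j b d x n
  = Poch (d - 1 / 2) n
    / (4 ^ n * Poch (d + 1 / 2) n * NtoC (fact n) * Poch (2 * d - b + ZtoC j) n)
    * dixon_value i j d b n * x ^ n.
Proof.
  intros hi hj (G1 & G2 & G3 & G4 & G5 & G6 & G7) HP.
  apply nonpole_not_pole in G1, G2, G3, G4, G5, G6, G7.
  destruct (index_equations d b i j hi hj)
    as (Pd & Py & E1 & E2 & E3 & E4 & F1 & F2 & F3 & F4).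
  destruct (pair_half_nonpole' _ _ _ Pd G1 G2) as [HdA HdB].
  assert (HyA := G6); rewrite F1 in HyA; assert (HyB := G4); rewrite E1 in HyB.
  assert (BA := Gamma_block _ _ _ _ _ _ _ _ _ _ _ _ n Pd Py HdA HdB HyA HyB G5 E1 E2 E3 E4).
  assert (Pd' : pair_half d (d + ZtoC (1 - i mod 2) / 2) (d + ZtoC (i mod 2) / 2))
    by (destruct Pd as [[? ?]|[? ?]]; [right | left]; auto).
  assert (Py' : pair_half (d - b + 1 / 2 * ZtoC j)
      (d - b + ZtoC (j + (i + j) mod 2) / 2) (d - b + ZtoC (j + 1 - (i + j) mod 2) / 2))
    by (destruct Py as [[? ?]|[? ?]]; [right | left]; auto).
  assert (BB := Gamma_block _ _ _ _ _ _ _ _ _ _ _ _ n Pd' Py' HdB HdA HyB HyA G7 F1 F2 F3 F4).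
  assert (Eb : Gamma (b - 1 / 2 * ZtoC (i + j + Z.abs (i + j))) * rGamma b
    = gratio b (- ((i + j + Z.abs (i + j)) / 2))).
  { rewrite half_plus_abs in *; set (s := ((i + j + Z.abs (i + j)) / 2)%Z) in *.
    assert (Hs : (0 <= s)%Z) by (apply Z.div_pos; lia).
    assert (Hb : nonpole b).
    { apply (nonpole_shift _ _ (Z.to_nat s) G3).
      unfold NtoC, ZtoC; rewrite INR_IZR_INZ, Z2Nat.id by exact Hs; ring. }
    rewrite rGamma_nonpole by exact Hb.
    rewrite (Gamma_gratio b (b - ZtoC s) (- s) Hb G3).
    - field; now apply Gamma_neq0.
    - unfold ZtoC; rewrite opp_IZR, RtoC_opp; ring. }
  assert (Nd := nonpole_Poch _ n G1); assert (Nh := nonpole_Poch _ n G2).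
  assert (Nf : Poch (2 * d - b + ZtoC j) n <> 0) by apply (HP n).
  assert (N4 := C4_pow_neq0 n); assert (Fn := NtoC_fact_neq0 n).
  assert (Nn : Poch (NtoC n + 1) (half_abs i) <> 0).
  { apply nonpole_Poch; intros m E; apply (NtoC_S_neq0 (n + m)); rewrite <- E, NtoC_plus; ring. }
  unfold dixon_value; rewrite <- (Cmult_assoc (An i j b d n)), <- (Cmult_assoc (Bn i j b d n)).
  rewrite <- BA, <- BB, <- Eb.
  unfold rhs_prefactor, rhs_term; rewrite fact_ratio.
  set (GA := Gamma (d - b - _ + _) * _ * _ * _).
  set (GB := Gamma (d - b + 1 / 2 - _ + _) * _ * _ * _).
  set (PA := Poch (d - b + ZtoC i / 2 + 1 / 2 + floor_half (j + 1)) n / _).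
  set (PB := Poch (d - b + ZtoC i / 2 + 1 + floor_half j) n / _).
  (* Without their bodies the blocks are atoms for [field] and cause no side conditions. *)
  generalize GA GB PA PB; intros.
  field; repeat split; auto.
Qed.

(** [hyp3F2_transform] yields the sum of the terms multiplied by the prefactor; dividing by it gives
    the convergence of [rhs_term] itself. *)
Lemma prefactor_neq0 (i j : Z) (b d : C) :
  (-3 <= i <= 3)%Z -> (0 <= j <= 3)%Z ->
  Gammas_defined i j b d -> rhs_prefactor i j b d <> 0.
Proof.
  intros hi hj (G1 & G2 & G3 & G4 & G5 & G6 & G7).
  apply nonpole_not_pole in G1, G2, G3, G4, G5, G6, G7.
  destruct (index_equations d b i j hi hj) as (_ & Py & E1 & _ & _ & _ & F1 & _).
  rewrite F1 in G6; rewrite E1 in G4.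
  destruct (pair_half_nonpole _ _ _ Py G6 G4) as [Hy1 Hy2].
  assert (Hb : nonpole b).
  { rewrite half_plus_abs in G3.
    apply (nonpole_shift _ _ (Z.to_nat ((i + j + Z.abs (i + j)) / 2)) G3).
    unfold NtoC, ZtoC; rewrite INR_IZR_INZ, Z2Nat.id by (apply Z.div_pos; lia); ring. }
  unfold rhs_prefactor; repeat apply Cmult_neq_0.
  - intros E; apply RtoC_inj in E; revert E; apply powerRZ_NOR; lra.
  - apply Cpow_nz; intros E; apply C1_nz; transitivity (- - (1)); [ring | rewrite E; ring].
  - now apply Gamma_neq0.
  - now apply Gamma_neq0.
  - now apply Gamma_neq0.
  - rewrite rGamma_nonpole by exact Hb; now apply Cinv_neq0, Gamma_neq0.
  - rewrite rGamma_nonpole by exact Hy1; now apply Cinv_neq0, Gamma_neq0.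
  - rewrite rGamma_nonpole by exact Hy2; now apply Cinv_neq0, Gamma_neq0.
Qed.

Theorem theorem1 (i j : Z) (b d : C)
  (hi : (-3 <= i <= 3)%Z) (hj : (0 <= j <= 3)%Z)
  (hij : ~ In (i, j) [(1, 3); (2, 3); (3, 1); (3, 2); (3, 3)]%Z)
  (hGamma : Gammas_defined i j b d)
  (hPoch : Pochs_defined i j b d)
  (x : C) (hx : in_domain x) :
  ex_Cseries (hyp3F2_term b (d - 1 / 2) (2 * d - 1 - ZtoC i)
                (d + 1 / 2) (2 * d - b + ZtoC j)
                (- (x / (1 + Csqrt (1 - x)) ^ 2))) /\
  ex_Cseries (rhs_term i j b d x) /\
  Cpower (1 / 2 + 1 / 2 * Csqrt (1 - x)) (1 - 2 * d)
  * hyp3F2 b (d - 1 / 2) (2 * d - 1 - ZtoC i)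
      (d + 1 / 2) (2 * d - b + ZtoC j)
      (- (x / (1 + Csqrt (1 - x)) ^ 2))
  = rhs_prefactor i j b d * CSeries (rhs_term i j b d x).
Proof.
  destruct hx as [hx _].
  assert (Hd : nonpole (d + 1 / 2)) by (apply Pochs_nonpole; intros n; apply (hPoch n)).
  assert (Hf : nonpole (2 * d - b + ZtoC j)) by (apply Pochs_nonpole; intros n; apply (hPoch n)).
  assert (H2d : nonpole (2 * d)).
  { apply (nonpole_half d (d + 1 / 2)); auto; apply nonpole_not_pole, hGamma. }
  assert (Hp := prefactor_neq0 i j b d hi hj hGamma).
  set (P := rhs_prefactor i j b d) in *.
  destruct (hyp3F2_transform b (d - 1 / 2) (2 * d - 1 - ZtoC i) (d + 1 / 2)
    (2 * d - b + ZtoC j) (2 * d - 1) x Hd Hf hx) as [HL HR].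
  set (L := hyp3F2 _ _ _ _ _ _) in *.
  replace (- (2 * d - 1)) with (1 - 2 * d) in HR by ring.
  assert (HR' : is_Cser (rhs_term i j b d x)
    (/ P * (Cpower (half_1_sqrt x) (1 - 2 * d) * L))).
  { apply (is_Cser_scal (/ P)) in HR; refine (is_Cser_ext _ _ _ _ HR); intros n.
    rewrite coefficient_sum, (evaluated_all i j hi hj hij d b n) by
      (assumption || now apply regular_of_defined).
    rewrite <- coefficient_rhs by assumption; fold P; field; exact Hp. }
  split; [exact (is_Cser_ex _ _ HL)|].
  split; [exact (is_Cser_ex _ _ HR')|].
  rewrite (is_Cser_unique _ _ HR').
  unfold half_1_sqrt; field; exact Hp.
Qed.
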